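(* Let $\phi:E_1\to E_1$ be a non-zero isogeny of degree $d$ of the elliptic curve $E_1: y^2=x^3-x$ over $\mathbb{C}$. Then $\phi$ transforms the $x$-coordinate as $x\mapsto x\,\mu(x^2)$, where $\mu(s)$ is a rational function over $\mathbb{C}$ with a finite non-zero limit $\mu_0=\lim_{s\to\infty}\mu(s)$. Moreover, the identity $$ {}_2F_1\!\left(\tfrac12,\tfrac14;\tfrac54;\,z\right)=\left(\frac{\mu(1/z)}{\mu_0}\right)^{-1/2}{}_2F_1\!\left(\tfrac12,\tfrac14;\tfrac54;\,\frac{z}{\mu(1/z)^2}\right) $$ holds, and the degree of the rational function $z/\mu(1/z)^2$ (in $z$) is equal to $d$.
   Context: $E_1$ is the elliptic curve over $\mathbb{C}$ given by $y^2=x^3-x$, with the point at infinity as the neutral element. An isogeny here is an isogeny endomorphism: an algebraic map $E_1\to E_1$ respecting the addition law (equivalently, fixing the point at infinity). ''Transforms the $x$-coordinate as $x\mapsto x\,\mu(x^2)$'' means that the $x$-component of $\phi(x,y)$ is the function $x\,\mu(x^2)$. ${}_2F_1(A,B;C;z)$ is the Gauss hypergeometric function. The identity is one of analytic functions in a neighbourhood of $z=0$, where the power factor $(\mu(1/z)/\mu_0)^{-1/2}$ is the branch with value $1$ at $z=0$. The degree of a rational function is its degree as a map $\mathbb{P}^1\to\mathbb{P}^1$. *)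

(* Defs.v *)
From HB Require Import structures.
From mathcomp Require Import all_boot all_order all_algebra.
From mathcomp Require Import complex ring.
From mathcomp Require Import all_classical all_reals all_analysis.
From mathcomp Require mpoly.

Set Implicit Arguments.
Unset Strict Implicit.
Unset Printing Implicit Defensive.

Import Order.TTheory GRing.Theory Num.Theory.
Import numFieldNormedType.Exports.

Local Open Scope classical_set_scope.
Local Open Scope ring_scope.
Local Open Scope complex_scope.

(* Typing R[i] as a numClosedFieldType gives access to the topology that
   MathComp-Analysis puts on every such field, which is not declared on R[i]. *)
Definition Cplx (R : realType) : numClosedFieldType := R[i].

(* A projective curve over C is a type T of points together with a choice
   coord P : 'I_n -> C of homogeneous coordinates for each point P.  The
   definitions below are meant for irreducible curves, where a nonempty Zariski
   open set is the same thing as a nonempty cofinite one. *)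
Section Curves.
Variable C : fieldType.

Definition hval n k (F : mpoly.dhomog n C k) (v : 'I_n -> C) : C :=
  mpoly.meval v (mpoly.mpoly_of_dhomog F).

Definition rational_fun T n (coord : T -> 'I_n -> C) (f : T -> C) : Prop :=
  exists k (G H : mpoly.dhomog n C k),
    (exists P, hval H (coord P) != 0) /\
    (forall P, hval H (coord P) != 0 ->
       f P = hval G (coord P) / hval H (coord P)).

(* Locally at every point, phi is [F_0 : ... : F_(m-1)] for homogeneous
   polynomials of the same degree that do not vanish simultaneously. *)
Definition regular_map T n (coordT : T -> 'I_n -> C)
    U m (coordU : U -> 'I_m -> C) (phi : T -> U) : Prop :=
  forall P, exists k (F : 'I_m -> mpoly.dhomog n C k),
    (exists i, hval (F i) (coordT P) != 0) /\
    (forall Q, (exists i, hval (F i) (coordT Q) != 0) ->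
       exists c, forall i, hval (F i) (coordT Q) = c * coordU (phi Q) i).

(* Elements of the function field C(T) are represented by functions T -> C
   that are rational, two of them being identified when they differ at finitely
   many points only. *)
Definition almost_eq T (f g : T -> C) : Prop :=
  finite_set [set P | f P <> g P].

(* deg phi = [C(T) : phi^* C(U)], where phi^* a = a \o phi: there is a basis b
   of C(T), of size d, over the subfield phi^* C(U). *)
Definition map_degree T n (coordT : T -> 'I_n -> C)
    U m (coordU : U -> 'I_m -> C) (phi : T -> U) (d : nat) : Prop :=
  exists b : 'I_d -> T -> C,
    [/\ forall i, rational_fun coordT (b i),
        forall f, rational_fun coordT f ->
          exists a : 'I_d -> U -> C,
            (forall i, rational_fun coordU (a i)) /\
            almost_eq f (fun P => \sum_(i < d) a i (phi P) * b i P)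
      & forall a : 'I_d -> U -> C,
          (forall i, rational_fun coordU (a i)) ->
          almost_eq (fun P => \sum_(i < d) a i (phi P) * b i P) (fun=> 0) ->
          forall i, almost_eq (a i) (fun=> 0)].

(* The projective line, with None the point at infinity. *)
Definition P1 := option C.

Definition P1_coord (P : P1) (i : 'I_2) : C :=
  if P is Some z then [:: z; 1]`_i else [:: 1; 0]`_i.

(* f : C -> C is a rational function whose values at finitely many points
   (e.g. at its poles) are irrelevant; psi is the map P^1 -> P^1 it defines. *)
Definition rational_degree (f : C -> C) (d : nat) : Prop :=
  exists psi : P1 -> P1,
    [/\ regular_map P1_coord P1_coord psi,
        finite_set [set z | psi (Some z) <> Some (f z)]
      & map_degree P1_coord P1_coord psi d].

Definition on_E1 (P : C * C) : bool := P.2 ^+ 2 == P.1 ^+ 3 - P.1.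

(* None is the point at infinity, i.e. the neutral element. *)
Definition E1 := option {P : C * C | on_E1 P}.

Definition E1_coord (P : E1) (i : 'I_3) : C :=
  if P is Some a then [:: (val a).1; (val a).2; 1]`_i else [:: 0; 1; 0]`_i.

Definition E1_x (P : E1) : P1 := omap (fun a => (val a).1) P.

Definition E1_slope (P Q : C * C) : C :=
  if P.1 == Q.1 then (3 * P.1 ^+ 2 - 1) / (2 * P.2)
  else (Q.2 - P.2) / (Q.1 - P.1).

Definition E1_chord (P Q : C * C) : C * C :=
  let l := E1_slope P Q in
  let x := l ^+ 2 - P.1 - Q.1 in
  (x, l * (P.1 - x) - P.2).

(* By E1_chordP below, insub always succeeds here (in characteristic 0). *)
Definition E1_add (P Q : E1) : E1 :=
  match P, Q with
  | None, _ => Q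
  | _, None => P
  | Some a, Some b =>
      if ((val a).1 == (val b).1) && ((val a).2 == - (val b).2) then None
      else insub (E1_chord (val a) (val b))
  end.

Definition E1_isogeny (phi : E1 -> E1) : Prop :=
  regular_map E1_coord E1_coord phi /\
  forall P Q, phi (E1_add P Q) = E1_add (phi P) (phi Q).

End Curves.

Lemma E1_chordP (C : numFieldType) (P Q : C * C) : on_E1 P -> on_E1 Q ->
  ~~ ((P.1 == Q.1) && (P.2 == - Q.2)) -> on_E1 (E1_chord P Q).
Proof.
case: P Q => [x1 y1] [x2 y2]; rewrite /on_E1 /E1_chord /E1_slope /=.
move=> /eqP e1 /eqP e2; have [ex|nx] := eqVneq x1 x2 => /= ny.
  rewrite -{}ex in e2 *.
  have y12 : y1 = y2.
    have /eqP : (y1 - y2) * (y1 + y2) = 0 by rewrite -subr_sqr e1 e2 subrr.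
    by rewrite mulf_eq0 subr_eq0 addr_eq0 (negbTE ny) orbF => /eqP.
  rewrite -{}y12 in e2 ny *.
  have y0 : y1 != 0 by apply: contraNneq ny => ->; rewrite oppr0.
  have e : (3 * x1 ^+ 2 - 1) / (2 * y1) * (2 * y1) = 3 * x1 ^+ 2 - 1.
    by rewrite divfK// mulf_neq0// pnatr_eq0.
  move: (_ / _) e => l e; set x := _ - _ - x1; apply/eqP/subr0_eq.
  rewrite (_ : _ - _ = (y1 ^+ 2 - (x1 ^+ 3 - x1)) +
     (l * (2 * y1) - (3 * x1 ^+ 2 - 1)) * (x - x1)); last by rewrite /x; ring.
  by rewrite e1 e !subrr mul0r addr0.
have e : (y2 - y1) / (x2 - x1) * (x2 - x1) = y2 - y1.
  by rewrite divfK// subr_eq0 eq_sym.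
move: (_ / _) e => l e; set x := _ - _ - x2; apply/eqP/esym/subr0_eq.
have y2E : y2 = y1 + l * (x2 - x1) by rewrite e addrC subrK.
have nx' : x2 - x1 != 0 by rewrite subr_eq0 eq_sym.
apply: (mulfI nx'); rewrite mulr0.
rewrite (_ : (x2 - x1) * _ = (x1 ^+ 3 - x1 - y1 ^+ 2) * (x2 - x) +
   (x2 ^+ 3 - x2 - y2 ^+ 2) * (x - x1)); last by rewrite y2E /x; ring.
by rewrite e1 e2 !subrr !mul0r addr0.
Qed.

Section Analysis.
Variable C : numClosedFieldType.

(* Neighbourhoods of the point at infinity of the complex plane. *)
Definition infty_nbhs : set_system C :=
  filter_from [set M : C | 0 < M] (fun M => [set s | M < `|s|]).

Definition pochhammer (a : C) (n : nat) : C := \prod_(i < n) (a + i%:R).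

(* Gauss hypergeometric function 2F1(a, b; c; z) on the unit disc; the value is
   meaningful only when the series converges. *)
Definition hyp2F1 (a b c z : C) : C :=
  lim (series (fun n => pochhammer a n * pochhammer b n /
                        (pochhammer c n * n`!%:R) * z ^+ n) @ \oo).

(* g is, near 0, the branch of w ^ (-1/2) that takes the value 1 at 0: it is a
   continuous choice of one of the two values, hence analytic when w is, and
   its germ at 0 is uniquely determined. *)
Definition inv_sqrt_branch (w g : C -> C) : Prop :=
  g 0 = 1 /\ \forall z \near (0 : C), {for z, continuous g} /\ g z ^- 2 = w z.

End Analysis.

(* Main.v *)
Require Import Defs.
From mathcomp Require Import all_boot all_order all_algebra.
From mathcomp Require Import all_field.
From mathcomp Require Import all_classical all_reals all_analysis.
From mathcomp Require Import complex ring zify.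
From mathcomp Require mpoly.

(** Let [X = x (phi P)] and [Y = y (phi P)].  Since [phi] commutes with
    [P |-> - P], the function [X] depends on [x] only, say [X = A / D] in lowest
    terms ([isogeny_x]), and [Y = y r (x)] ([isogeny_y]).

    The differential [dx / y] is invariant under translations, hence multiplied by
    a constant [c] under [phi]: [dX / dx = c r].  Algebraically, the group law gives
    [x (P + Q) - x (P - Q) = - 4 y (P) y (Q) / (x (Q) - x (P)) ^ 2]; comparing this
    identity with its image under [phi] and letting [Q] tend to the neutral element
    yields [(dX / dx) / r] at [P] as a limit that does not involve [P]
    ([isogeny_chord], [isogeny_slope]).  With the equation of the curve this becomes
    [(dX / dx) ^ 2 (x ^ 3 - x) = c ^ 2 (X ^ 3 - X)] ([isogeny_ode]).

    The rest of the argument uses only this differential equation and the pole of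
    [X] at infinity.  Top coefficients give [X ~ x / c ^ 2] at infinity
    ([ode_degree]).  The function [- X (- x)] is a second solution with the same
    leading term, and an analysis of the order at infinity of the difference shows
    that the two agree ([ode_odd]).  So [X] is odd, [X = x mu (x ^ 2)] with
    [mu = p / q] and [mu0 = 1 / c ^ 2] ([odd_ratio], [even_coprime]).

    In the variable [z = 1 / x ^ 2] the pull-back of [z] is [Z = z / mu (1 / z) ^ 2].
    The series [F = 2F1(1/2, 1/4; 5/4; z)] satisfies
    [4 z F' + F = (1 - z) ^ (- 1 / 2)] ([fser_ode], [sser_sqr]): up to a constant
    and a power of [x], it is the integral of [dx / y] from infinity.  If [g] is the branch of
    [(mu (1 / z) / mu0) ^ (- 1 / 2)], the differential equation for [X] says that
    [g F (Z)] satisfies the same equation as [F] ([euler_sqr],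
    [near_euler_pullback]).  The difference [H] is analytic at [0] and satisfies
    [4 z H' + H = 0], so [z H ^ 4] is constant and [H = 0]
    ([hyp_transformation]).

    For the degree, let [n] be the larger of the degrees of [A] and [D].  The powers
    [1, x, ..., x ^ (n - 1)] are a basis of [C(x)] over [C(X)]: they generate because
    [A - X D] vanishes, which allows one to divide by [x - r] inside their span
    ([span_div_XsubC]), and they are free because a generic fibre of [X] has [n]
    points ([generic_fibre]).  As [C(x, y) = C(x) + Y C(x)], they are also a basis
    of [C(x, y)] over [C(X, Y)], so that [d = n] ([isogeny_map_degree],
    [E1_map_degree_uniq]).  The first part, applied to [Z] in place of [X], gives
    the degree of [Z] from those of its numerator and denominator
    ([fibre_rational_degree]), and parity shows that it is [n] as well
    ([rev_degree]). *)

Set Implicit Arguments.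
Unset Strict Implicit.
Unset Printing Implicit Defensive.

Import Order.TTheory GRing.Theory Num.Theory.
Import numFieldNormedType.Exports.

Local Open Scope classical_set_scope.
Local Open Scope ring_scope.

(** * The cofinite filter *)

(** A filter, so that identities which hold at all but finitely many points can be
    combined by the [near] tactics. *)
Definition cofinitely (T : Type) : set_system T := [set A | cofinite_set A].
Arguments cofinitely : clear implicits.

Global Instance cofinitely_filter T : Filter (cofinitely T).
Proof.
split=> [|P Q|P Q PQ]; rewrite /cofinitely /=.
- exact: cofinite_setT.
- by rewrite setCI => fP fQ; rewrite finite_setU.
- exact: sub_cofinite_set.
Qed.

Lemma cofinitely_proper T : infinite_set [set: T] -> ProperFilter (cofinitely T).
Proof.
move=> infT; apply: Build_ProperFilter; rewrite /cofinitely /= => h.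
by apply: infT; rewrite -setC0.
Qed.

Lemma almost_eqP (C : fieldType) T (f g : T -> C) :
  almost_eq f g <-> \forall P \near cofinitely T, f P = g P.
Proof. by []. Qed.

Lemma cofinitely_neq T (x : T) : \forall y \near cofinitely T, y <> x.
Proof.
rewrite nearE /cofinitely /= (_ : ~` _ = [set x]) ?finite_set1//.
by apply/seteqP; split=> [y /contrapT//|y -> /(_ erefl)].
Qed.

Lemma cofinitely_notin (T : eqType) (s : seq T) :
  \forall y \near cofinitely T, y \notin s.
Proof.
elim: s => [|x s IHs]; first by apply: nearW.
apply: filterS2 IHs (cofinitely_neq x) => y ys /eqP yx.
by rewrite inE negb_or yx.
Qed.

Lemma finite_to_one_cofinitely T U (f : T -> U) :
  (forall y, finite_set [set x | f x = y]) ->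
  f @ cofinitely T --> cofinitely U.
Proof.
move=> ff A finA; rewrite /nbhs/= /cofinitely/=.
rewrite (_ : ~` _ = \bigcup_(y in ~` A) [set x | f x = y]); last first.
  by apply/seteqP; split=> [x Ax|x [y Ay fx]]; [by exists (f x)|by move: Ay; rewrite -fx].
exact: bigcup_finite.
Qed.

Lemma surj_cofinitely T U (f : T -> U) (Q : set U) : (forall y, exists x, f x = y) ->
  (\forall x \near cofinitely T, Q (f x)) -> \forall y \near cofinitely U, Q y.
Proof.
move=> fs fQ; apply: sub_finite_set (finite_image f fQ) => y Qy.
by have [x fx] := fs y; exists x; rewrite //= fx.
Qed.

Lemma cofinitely_Some T (Q : option T -> Prop) :
  (\forall P \near cofinitely (option T), Q P) <->
  (\forall x \near cofinitely T, Q (Some x)).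
Proof.
split=> [QP|fQ].
  have : Some @ cofinitely T --> cofinitely (option T).
    apply: finite_to_one_cofinitely => -[y|]; last first.
      by rewrite (_ : [set x | _] = set0) ?finite_set0// -subset0.
    by apply: (sub_finite_set _ (finite_set1 y)) => x [].
  exact.
have : finite_set ([set None] `|` Some @` (~` [set x | Q (Some x)])).
  by rewrite finite_setU; split; [exact: finite_set1|exact: finite_image].
apply: sub_finite_set => -[x|] QP; last by left.
by right; exists x.
Qed.

(** * Polynomials and their zeros *)

Section Polynomials.
Variable C : numClosedFieldType.
Implicit Types p q : {poly C}.

Lemma infinite_num : infinite_set [set: C].
Proof.
move=> finC; apply: infinite_nat.
have -> : [set: nat] = (fun n => n%:R : C) @^-1` [set: C] by [].
by apply: finite_preimage finC => m n _ _ /eqP; rewrite eqr_nat => /eqP.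
Qed.

Global Instance cofinitely_num_proper : ProperFilter (cofinitely C).
Proof. exact: cofinitely_proper infinite_num. Qed.

Lemma neq0_near p : p != 0 -> \forall z \near cofinitely C, p.[z] != 0.
Proof.
move=> p0; have [r pE] := closed_field_poly_normal p.
apply: filterS (cofinitely_notin r) => z; rewrite -/(root p z) pE.
by rewrite rootZ ?lead_coef_eq0// root_prod_XsubC.
Qed.

Lemma near_poly_eq0 p : (\forall z \near cofinitely C, p.[z] = 0) -> p = 0.
Proof.
move=> pz; apply/eqP/negP => /negP /neq0_near p0.
have [z [/eqP pz0 pz1]] := filter_ex (filterI p0 pz).
by apply: pz0.
Qed.

Lemma near_poly_eq p q :
  (\forall z \near cofinitely C, p.[z] = q.[z]) -> p = q.
Proof.
move=> pq; apply/eqP; rewrite -subr_eq0; apply/eqP/near_poly_eq0.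
by apply: filterS pq => z zE; rewrite hornerD hornerN zE subrr.
Qed.

Lemma deriv_eq0 p : p^`() = 0 -> (size p <= 1)%N.
Proof.
move=> dp; apply/leq_sizeP => -[//|j] _.
have /eqP := congr1 (coefp j) dp.
by rewrite /= coef_deriv coef0 mulrn_eq0 => /eqP.
Qed.

Lemma finite_roots p : p != 0 -> finite_set [set z | p.[z] = 0].
Proof.
move=> /neq0_near; apply: sub_finite_set => z /= -> /=.
by rewrite eqxx.
Qed.

End Polynomials.

(** * Homogeneous forms *)

Section Forms.
Variables (C : fieldType) (n : nat).
Implicit Types (f g : ('I_n -> C) -> C).

Local Notation mdeg := (mpoly.mpoly_mdeg__canonical__mpoly_Measure n).

(** Forms are handled through the functions they define on coordinate vectors. *)
Definition is_form k f := exists F : mpoly.dhomog n C k, hval F =1 f.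

Lemma is_form_coord i : is_form 1 (fun v => v i).
Proof.
have h : mpoly.mpolyX C (mpoly.mnm1 i) \is mpoly.ishomog1 1 mdeg.
  by rewrite mpoly.dhomogX; apply/eqP; exact: mpoly.mdeg1.
by exists (mpoly.DHomog h) => v; rewrite /hval /= mpoly.mevalXU.
Qed.

Lemma is_form0 k : is_form k (fun=> 0).
Proof.
exists (mpoly.DHomog (mpoly.dhomog0 C mdeg k)) => v.
by rewrite /hval /= mpoly.meval0.
Qed.

Lemma is_form1 : is_form 0 (fun=> 1).
Proof.
exists (mpoly.DHomog (mpoly.dhomog1 C mdeg)) => v.
by rewrite /hval /= mpoly.meval1.
Qed.

Lemma is_formD k f g : is_form k f -> is_form k g -> is_form k (fun v => f v + g v).
Proof.
move=> [[F hF] fE] [[G hG] gE].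
exists (mpoly.DHomog (mpoly.dhomogD hF hG)) => v.
by rewrite -fE -gE /hval /= mpoly.mevalD.
Qed.

Lemma is_formM k l f g :
  is_form k f -> is_form l g -> is_form (k + l) (fun v => f v * g v).
Proof.
move=> [[F hF] fE] [[G hG] gE].
exists (mpoly.DHomog (mpoly.dhomogM hF hG)) => v.
by rewrite -fE -gE /hval /= mpoly.mevalM.
Qed.

Lemma is_formZ k c f : is_form k f -> is_form k (fun v => c * f v).
Proof.
move=> [[F hF] fE].
exists (mpoly.DHomog (mpoly.dhomogZ c hF)) => v.
by rewrite -fE /hval /= mpoly.mevalZ.
Qed.

Lemma is_formX m i : is_form m (fun v => v i ^+ m).
Proof.
elim: m => [|m IHm]; first exact: is_form1.
have [F FE] := is_formM (is_form_coord i) IHm.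
by exists F => v; rewrite FE exprS.
Qed.

Lemma is_form_sum I k (r : seq I) (F : I -> ('I_n -> C) -> C) :
  (forall i, is_form k (F i)) -> is_form k (fun v => \sum_(i <- r) F i v).
Proof.
move=> hF; elim: r => [|i r IHr].
  by have [G GE] := is_form0 k; exists G => v; rewrite GE big_nil.
have [G GE] := is_formD (hF i) IHr.
by exists G => v; rewrite GE big_cons.
Qed.

(** The homogenisation of [p] in degree [k], in the variables of index [i], [j]. *)
Lemma is_form_homog k i j (p : {poly C}) :
  is_form k (fun v => \sum_(l < k.+1) p`_l * (v i ^+ l * v j ^+ (k - l))).
Proof.
apply: is_form_sum => l; apply: is_formZ.
by have := is_formM (is_formX l i) (is_formX (k - l) j); rewrite subnKC// -ltnS.
Qed.

Lemma homog1E k (p : {poly C}) (x : C) : (size p <= k.+1)%N ->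
  \sum_(l < k.+1) p`_l * (x ^+ l * 1 ^+ (k - l)) = p.[x].
Proof.
move=> sp; rewrite (horner_coef_wide _ sp); apply: eq_bigr => l _.
by rewrite expr1n mulr1.
Qed.

Lemma homog0E k (p : {poly C}) :
  \sum_(l < k.+1) p`_l * (1 ^+ l * 0 ^+ (k - l)) = p`_k.
Proof.
rewrite big_ord_recr/= subnn expr0 expr1n !mulr1 big1 ?add0r// => l _.
by rewrite expr0n subn_eq0 leqNgt ltn_ord/= !mulr0.
Qed.

Lemma form_ind k (Q : (('I_n -> C) -> C) -> Prop) :
  Q (fun=> 0) ->
  (forall c f g, Q f -> Q g -> Q (fun v => c * f v + g v)) ->
  (forall m : 'I_n -> nat, (\sum_i m i)%N = k -> Q (fun v => \prod_i v i ^+ m i)) ->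
  forall F : mpoly.dhomog n C k, Q (hval F).
Proof.
move=> Q0 QD QX [F hF].
have /mpoly.dhomogP hm := hF.
have -> : hval (mpoly.DHomog hF) = fun v => \sum_(m <- mpoly.msupp F)
    mpoly.mcoeff m F * \prod_i v i ^+ mpoly.fun_of_multinom m i.
  by apply/funext => v; rewrite /hval /= mpoly.mevalE.
elim: (mpoly.msupp F) hm => [|m r IHr] hr.
  by under eq_fun do rewrite big_nil.
under eq_fun do rewrite big_cons.
apply: QD; last by apply: IHr => m' rm'; apply: (hr m'); rewrite inE rm' orbT.
by apply: QX; rewrite -mpoly.mdegE; exact: (hr m (mem_head _ _)).
Qed.

End Forms.

(** * Rational functions of one variable *)

Section RatFun.
Variable C : numClosedFieldType.
Implicit Types (p q A D N L : {poly C}) (f g : C -> C).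

(** Values at finitely many points are left free, as in a function field. *)
Definition ratfun f := exists A D,
  D != 0 /\ \forall z \near cofinitely C, f z = A.[z] / D.[z].

Lemma ratfun_near f g : (\forall z \near cofinitely C, f z = g z) ->
  ratfun g -> ratfun f.
Proof.
move=> fg [A [D [D0 gE]]]; exists A, D; split=> //.
by apply: filterS2 fg gE => z ->.
Qed.

Lemma ratfun_poly p : ratfun (fun z => p.[z]).
Proof.
exists p, 1; rewrite oner_eq0; split=> //.
by apply: nearW => z; rewrite hornerC divr1.
Qed.

Lemma ratfun_cst c : ratfun (fun=> c).
Proof.
apply: ratfun_near (ratfun_poly c%:P).
by apply: nearW => z; rewrite hornerC.
Qed.

Lemma ratfun_id : ratfun (fun z => z).
Proof.
by apply: ratfun_near (ratfun_poly 'X); apply: nearW => z; rewrite hornerX.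
Qed.

Lemma ratfunD f g : ratfun f -> ratfun g -> ratfun (fun z => f z + g z).
Proof.
move=> [A [D [D0 fE]]] [B [E [E0 gE]]]; exists (A * E + B * D), (D * E).
split; first by rewrite mulf_neq0.
near=> z.
have Dz : D.[z] != 0 by near: z; exact: neq0_near.
have Ez : E.[z] != 0 by near: z; exact: neq0_near.
have -> : f z = A.[z] / D.[z] by near: z.
have -> : g z = B.[z] / E.[z] by near: z.
by rewrite addf_div// !hornerE.
Unshelve. all: by end_near. Qed.

Lemma ratfunM f g : ratfun f -> ratfun g -> ratfun (fun z => f z * g z).
Proof.
move=> [A [D [D0 fE]]] [B [E [E0 gE]]]; exists (A * B), (D * E).
split; first by rewrite mulf_neq0.
apply: filterS2 fE gE => z -> ->.
by rewrite mulf_div !hornerE.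
Qed.

Lemma ratfunN f : ratfun f -> ratfun (fun z => - f z).
Proof.
move=> rf; have := ratfunM (ratfun_cst (-1)) rf; apply: ratfun_near.
by apply: nearW => z; rewrite mulN1r.
Qed.

Lemma ratfunV f : ratfun f -> ratfun (fun z => (f z)^-1).
Proof.
move=> [A [D [D0 fE]]]; have [A0|A0] := eqVneq A 0.
  apply: ratfun_near (ratfun_cst 0); apply: filterS fE => z ->.
  by rewrite A0 horner0 mul0r invr0.
by exists D, A; split=> //; apply: filterS fE => z ->; rewrite invf_div.
Qed.

Lemma ratfun_dec f : ratfun f -> (\forall z \near cofinitely C, f z = 0) \/
  (\forall z \near cofinitely C, f z != 0).
Proof.
move=> [A [D [D0 fE]]]; have [A0|A0] := eqVneq A 0; [left|right].
  by apply: filterS fE => z ->; rewrite A0 horner0 mul0r.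
apply: filterS3 fE (neq0_near A0) (neq0_near D0) => z -> Az Dz.
by rewrite mulf_neq0// invr_eq0.
Qed.

(** * Rational functions on the projective line *)

Lemma P1_form k (F : mpoly.dhomog 2 C k) : exists2 p : {poly C},
  forall z, hval F (P1_coord (Some z)) = p.[z] & hval F (P1_coord None) = p`_k.
Proof.
pose Q (f : ('I_2 -> C) -> C) := exists2 p : {poly C},
  forall z, f (P1_coord (Some z)) = p.[z] & f (P1_coord None) = p`_k.
apply: (@form_ind _ _ _ Q).
- by exists 0 => [z|]; rewrite ?horner0 ?coef0.
- move=> c f g [p pE pk] [q qE qk].
  by exists (c *: p + q) => [z|]; rewrite ?hornerE ?coefD ?coefZ ?pE ?qE ?pk ?qk.
move=> m; rewrite !big_ord_recl big_ord0 addn0 => mk.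
exists ('X ^+ m ord0) => [z|].
  by rewrite !big_ord_recl big_ord0 /= !hornerE expr1n /= !mulr1.
rewrite !big_ord_recl big_ord0 /= coefXn expr1n expr0n /= mul1r mulr1.
by rewrite -mk -{2}[m ord0]addn0 eqn_add2l; case: (m _).
Qed.

Lemma P1_rational (f : P1 C -> C) : rational_fun (@P1_coord C) f ->
  ratfun (fun z => f (Some z)).
Proof.
move=> [k [G [H [[P HP] fE]]]].
have [p pE pk] := P1_form G; have [q qE qk] := P1_form H.
have q0 : q != 0.
  by apply: contraNneq HP => q0; case: P => [z|]; rewrite ?qE ?qk q0 ?horner0 ?coef0.
exists p, q; split=> //.
by apply: filterS (neq0_near q0) => z qz; rewrite fE qE// pE.
Qed.

Lemma rational_P1 (f : P1 C -> C) : ratfun (fun z => f (Some z)) ->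
  rational_fun (@P1_coord C) f.
Proof.
move=> [A [D [D0 /finite_seqP[s sE]]]].
pose B := \prod_(a <- s) ('X - a%:P).
have B0 : B != 0 by rewrite monic_neq0// monic_prod_XsubC.
pose k := maxn (size (A * B)) (size (D * B)).
(* The factor [B] vanishes at the points where [f] differs from [A / D], and the
   second coordinate vanishes at infinity: the denominator avoids all of them. *)
have [G GE] := is_formM (is_form_coord C (1 : 'I_2)) (is_form_homog k 0 1 (A * B)).
have [H HE] := is_formM (is_form_coord C (1 : 'I_2)) (is_form_homog k 0 1 (D * B)).
have {}GE z : hval G (P1_coord (Some z)) = (A * B).[z].
  by rewrite GE /= mul1r homog1E// (leq_trans _ (leqnSn _))// leq_maxl.
have HN : hval H (P1_coord None) = 0 by rewrite HE /= mul0r.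
have {}HE z : hval H (P1_coord (Some z)) = (D * B).[z].
  by rewrite HE /= mul1r homog1E// (leq_trans _ (leqnSn _))// leq_maxr.
exists (1 + k)%N, G, H; split.
  have [z zDB] := filter_ex (neq0_near (mulf_neq0 D0 B0)).
  by exists (Some z); rewrite HE.
move=> [z|]; last by rewrite HN eqxx.
rewrite GE HE !hornerE mulf_eq0 negb_or => /andP[Dz Bz].
rewrite -mulf_div divff// mulr1; apply: contrapT => fz.
have : (~` [set z | f (Some z) = A.[z] / D.[z]]) z by [].
by rewrite sE /= => zs; move/negP: Bz; apply; rewrite -/(root B z) root_prod_XsubC.
Qed.

End RatFun.

(** * The degree of a map of the projective line *)

Section Fibres.
Variable C : numClosedFieldType.
Implicit Types (p q A D : {poly C}) (f g : C -> C).

Variables N L : {poly C}.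
Hypothesis NL : coprimep N L.
Let n := (maxn (size N) (size L)).-1.
Hypothesis n_gt0 : (0 < n)%N.
Let Z z := N.[z] / L.[z].

Let size_max : maxn (size N) (size L) = n.+1.
Proof. by rewrite prednK//; move: n_gt0; rewrite /n; case: maxn. Qed.

Let size_N : (size N <= n.+1)%N. Proof. by rewrite -size_max leq_maxl. Qed.
Let size_L : (size L <= n.+1)%N. Proof. by rewrite -size_max leq_maxr. Qed.

Lemma no_common_root z : L.[z] = 0 -> N.[z] != 0.
Proof.
by move=> Lz; apply: (coprimep_root (p := L)); [rewrite coprimep_sym|apply/eqP].
Qed.

(** Together with [linear_neq0], this makes [N - w L] of degree [n] for generic [w]. *)
Lemma lead_fibre : (N`_n != 0) || (L`_n != 0).
Proof.
rewrite -negb_and; apply/negP => /andP[/eqP Nn /eqP Ln].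
have small (p : {poly C}) : (size p <= n.+1)%N -> p`_n = 0 -> (size p <= n)%N.
  move=> sp pn; rewrite leqNgt; apply/negP => np.
  have sn : size p = n.+1 by apply/eqP; rewrite eqn_leq sp.
  have : lead_coef p = 0 by rewrite lead_coefE sn.
  by move/eqP; rewrite lead_coef_eq0 => /eqP p0; rewrite p0 size_poly0 in np.
have : (maxn (size N) (size L) <= n)%N by rewrite geq_max !small.
by rewrite size_max ltnn.
Qed.

Lemma linear_neq0 (a b : C) : (a != 0) || (b != 0) ->
  \forall w \near cofinitely C, a - w * b != 0.
Proof.
move=> ab; have p0 : a%:P - b *: 'X != 0.
  apply: contraTneq ab => e; rewrite negb_or !negbK.
  have := congr1 (coefp 0) e; have := congr1 (coefp 1) e.
  rewrite /= !(coefB, coefC, coefZ, coefX, coef0) /= !(mulr0, mulr1, sub0r, subr0).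
  by move/eqP; rewrite oppr_eq0 => -> ->; rewrite eqxx.
by apply: filterS (neq0_near p0) => w; rewrite !hornerE [w * b]mulrC.
Qed.

Lemma fibre_den_neq0 : L != 0.
Proof.
apply: contraTneq NL => L0; rewrite L0 coprimep0.
have := size_max; rewrite L0 size_poly0 maxn0 => sN.
by rewrite -size_poly_eq1 sN eqSS -lt0n.
Qed.

Lemma fibre_num_neq0 : N != 0.
Proof.
apply: contraTneq NL => N0; rewrite N0 coprime0p.
have := size_max; rewrite N0 size_poly0 max0n => sN.
by rewrite -size_poly_eq1 sN eqSS -lt0n.
Qed.

Lemma fibre_eq z w : L.[z] != 0 -> (Z z = w) <-> (N - w *: L).[z] = 0.
Proof.
move=> Lz; rewrite !hornerE /Z; split=> [<-|/eqP]; first by rewrite divfK ?subrr.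
by rewrite subr_eq0 => /eqP ->; rewrite mulfK.
Qed.

Lemma fibre_neq0 w : N - w *: L != 0.
Proof.
apply/negP; rewrite subr_eq0 => /eqP Nw.
have LN : L %| N by rewrite Nw dvdpZr// -?Nw; apply: contraTneq fibre_num_neq0 => w0;
  rewrite Nw w0 scale0r negbK.
have sL : size L = 1%N.
  by move: NL; rewrite coprimep_sym => /coprimepP/(_ L (dvdpp L) LN);
    rewrite -size_poly_eq1 => /eqP.
have sN : (size N <= 1)%N by rewrite Nw -sL size_scale_leq.
by move: n_gt0; rewrite /n sL; case: (size N) sN => [|[]].
Qed.

Lemma fibre_map_cofinitely : Z @ cofinitely C --> cofinitely C.
Proof.
apply: finite_to_one_cofinitely => w.
have : finite_set ([set z | L.[z] = 0] `|` [set z | (N - w *: L).[z] = 0]).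
  by rewrite finite_setU; split; apply: finite_roots;
    [exact: fibre_den_neq0|exact: fibre_neq0].
apply: sub_finite_set => z /= Zz.
by have [Lz|Lz] := eqVneq L.[z] 0; [left|right; apply/fibre_eq].
Qed.

Let W := N^`() * L - N * L^`().

(** If [N' L = N L'], then [N] divides [N'] and [L] divides [L'] by coprimality, so
    that both are constant. *)
Lemma wronskian_neq0 : W != 0.
Proof.
apply/negP; rewrite subr_eq0 => /eqP e.
have small (p q : {poly C}) : coprimep p q -> p %| p^`() * q -> (size p <= 1)%N.
  move=> pq; rewrite Gauss_dvdpl// => pp.
  apply: deriv_eq0; apply/eqP; apply: contraTT pp => p'0.
  rewrite gtNdvdp// lt_size_deriv//.
  by apply: contraNneq p'0 => ->; rewrite deriv0.
have : (maxn (size N) (size L) <= 1)%N.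
  rewrite geq_max (small N L)// ?e ?dvdp_mulr//= (small L N)// 1?coprimep_sym//.
  by rewrite mulrC -e dvdp_mull.
by rewrite size_max ltnS leqNgt n_gt0.
Qed.

(** Over a generic value [w] the polynomial [N - w L] has degree [n], and it is
    separable because a double root would be a zero of the Wronskian. *)
Lemma generic_fibre (G : set C) : (\forall z \near cofinitely C, G z) ->
  \forall w \near cofinitely C, exists rs : seq C,
    [/\ uniq rs, size rs = n & forall z, z \in rs -> G z /\ Z z = w].
Proof.
move=> fG; pose B := [set z | ~ G z] `|` [set z | W.[z] = 0].
have finB : finite_set B.
  by rewrite finite_setU; split=> //; apply: finite_roots wronskian_neq0.
have fB : \forall w \near cofinitely C, forall z, Z z = w -> G z /\ W.[z] != 0.
  apply: sub_finite_set (finite_image Z finB) => w /=.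
  move=> /existsNP[z /not_implyP[zw /not_andP zB]]; exists z => //.
  by case: zB => [|/negP]; [left|rewrite negbK => /eqP; right].
apply: filterS2 (linear_neq0 lead_fibre) fB => w w_lead wB.
have [rs EE] := closed_field_poly_normal (N - w *: L).
have lE : lead_coef (N - w *: L) != 0 by rewrite lead_coef_eq0 fibre_neq0.
have sE : size (N - w *: L) = n.+1.
  apply/eqP; rewrite eqn_leq; apply/andP; split.
    apply: leq_trans (size_polyD _ _) _; rewrite geq_max size_N size_polyN.
    exact: leq_trans (size_scale_leq _ _) _.
  by rewrite ltnNge; apply: contra w_lead => /leq_sizeP/(_ n (leqnn n));
    rewrite coefB coefZ => ->.
have rsP z : z \in rs -> (N - w *: L).[z] = 0 /\ Z z = w.
  rewrite -root_prod_XsubC -(rootZ _ _ lE) -EE => /rootP Ez; split=> //.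
  apply/fibre_eq => //; apply/negP => /eqP Lz; move: Ez.
  by rewrite !hornerE Lz mulr0 subr0; apply/eqP; exact: no_common_root.
exists rs; split=> [||z zrs].
- rewrite -separable_prod_XsubC unlock; apply: Pdiv.ClosedField.root_coprimep => z.
  rewrite root_prod_XsubC => /rsP[Ez Zz]; have [_ /eqP Wz] := wB _ Zz.
  apply/negP => /eqP dE; apply: Wz.
  have Lz : L.[z] != 0.
    apply/negP => /eqP Lz; move: Ez.
    by rewrite !hornerE Lz mulr0 subr0; apply/eqP; exact: no_common_root.
  have {}dE : (N - w *: L)^`().[z] = 0 by rewrite EE derivZ hornerZ dE mulr0.
  rewrite /W; move: Ez dE; rewrite derivB derivZ !hornerE => /subr0_eq -> /subr0_eq ->.
  by rewrite mulrAC subrr.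
- by have := sE; rewrite EE size_scale// size_prod_XsubC => -[].
- by have [_ Zz] := rsP z zrs; split=> //; have [] := wB _ Zz.
Qed.

(** Over a generic [w], the polynomial with coefficients [a i w] has degree less
    than [n] and vanishes at the [n] points of the fibre. *)
Lemma fibre_free (a : 'I_n -> C -> C) :
  (\forall z \near cofinitely C, \sum_(i < n) a i (Z z) * z ^+ i = 0) ->
  forall i, \forall w \near cofinitely C, a i w = 0.
Proof.
move=> /generic_fibre fa i; apply: filterS fa => w [rs [uniq_rs size_rs rsP]].
have p0 : \poly_(j < n) (if insub j is Some k then a k w else 0) = 0.
  apply: (roots_geq_poly_eq0 (rs := rs)) => //; last by rewrite size_rs size_poly.
  apply/allP => z /rsP[/= h Zz]; rewrite rootE horner_poly.
  apply/eqP; rewrite -[RHS]h; apply: eq_bigr => j _.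
  by rewrite valK Zz.
by have := congr1 (coefp i) p0; rewrite /= coef_poly ltn_ord valK coef0.
Qed.

Definition fibre_span f := exists a : 'I_n -> C -> C, (forall i, ratfun (a i)) /\
  \forall z \near cofinitely C, f z = \sum_(i < n) a i (Z z) * z ^+ i.

Lemma span_near f g : (\forall z \near cofinitely C, f z = g z) ->
  fibre_span g -> fibre_span f.
Proof.
move=> fg [a [ra gE]]; exists a; split=> //.
by apply: filterS2 fg gE => z -> ->.
Qed.

Lemma span_add f g : fibre_span f -> fibre_span g -> fibre_span (fun z => f z + g z).
Proof.
move=> [a [ra fE]] [b [rb gE]]; exists (fun i w => a i w + b i w).
split=> [i|]; first exact: ratfunD.
apply: filterS2 fE gE => z -> ->; rewrite -big_split /=.
by apply: eq_bigr => i _; rewrite mulrDl.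
Qed.

Lemma span_scale k f : ratfun k -> fibre_span f -> fibre_span (fun z => k (Z z) * f z).
Proof.
move=> rk [a [ra fE]]; exists (fun i w => k w * a i w).
split=> [i|]; first exact: ratfunM.
apply: filterS fE => z ->; rewrite big_distrr /=.
by apply: eq_bigr => i _; rewrite mulrA.
Qed.

Lemma span_sum I (r : seq I) (F : I -> C -> C) : (forall i, fibre_span (F i)) ->
  fibre_span (fun z => \sum_(i <- r) F i z).
Proof.
move=> sF; elim: r => [|i r IHr].
  exists (fun _ _ => 0); split=> [_|]; first exact: ratfun_cst.
  by apply: nearW => z; rewrite big_nil big1// => i _; rewrite mul0r.
apply: span_near (span_add (sF i) IHr).
by apply: nearW => z; rewrite big_cons.
Qed.

Lemma span_pow (i : 'I_n) : fibre_span (fun z => z ^+ i).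
Proof.
exists (fun j _ => (i == j)%:R); split=> [j|]; first exact: ratfun_cst.
apply: nearW => z; rewrite (bigD1 i)//= eqxx mul1r big1 ?addr0// => j.
by rewrite eq_sym => /negbTE ->; rewrite mul0r.
Qed.

(** On the fibre over [w] the polynomial [N - w L] vanishes; its top term can be
    solved for [z ^ n]. *)
Lemma span_pow_n : fibre_span (fun z => z ^+ n).
Proof.
pose k w := (N`_n - w * L`_n)^-1.
have rl (p q : C) : ratfun (fun w => p - w * q).
  exact: (ratfunD (ratfun_cst p) (ratfunN (ratfunM (@ratfun_id C) (ratfun_cst q)))).
have rk : ratfun k by apply: ratfunV; exact: rl.
have := span_scale (ratfunN rk) (@span_sum _ (index_enum 'I_n)
  (fun i z => (N`_i - Z z * L`_i) * z ^+ i)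
  (fun i => span_scale (rl N`_i L`_i) (span_pow i))).
apply: span_near; near=> z.
have Lz : L.[z] != 0 by near: z; exact: neq0_near fibre_den_neq0.
have kz : N`_n - Z z * L`_n != 0.
  by near: z; exact: (fibre_map_cofinitely (linear_neq0 lead_fibre)).
apply: (mulfI kz); rewrite /k mulrA mulrN divff// mulN1r.
apply/eqP; rewrite -addr_eq0; apply/eqP.
have /(_ erefl) := (fibre_eq (Z z) Lz).1.
rewrite hornerD hornerN hornerZ (horner_coef_wide _ size_N) (horner_coef_wide _ size_L).
rewrite !big_ord_recr/= mulrDr opprD addrACA mulrA -mulrBl => e.
rewrite -[RHS]e addrC; congr (_ + _).
rewrite big_distrr/= -sumrB; apply: eq_bigr => i _.
by rewrite mulrBl mulrA.
Unshelve. all: by end_near. Qed.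

Lemma span_mulX f : fibre_span f -> fibre_span (fun z => z * f z).
Proof.
move=> [a [ra fE]].
apply: (@span_near _ (fun z => \sum_(i <- index_enum 'I_n) a i (Z z) * z ^+ i.+1)).
  apply: filterS fE => z ->; rewrite big_distrr; apply: eq_bigr => i _ /=.
  by rewrite mulrCA exprS.
apply: span_sum => i; apply: span_scale => //.
have := ltn_ord i; rewrite leq_eqVlt => /orP[/eqP ->|i1]; first exact: span_pow_n.
exact: span_pow (Ordinal i1).
Qed.

Lemma span_mul_poly p f : fibre_span f -> fibre_span (fun z => p.[z] * f z).
Proof.
move=> sf; elim/poly_ind: p => [|p c IHp].
  apply: span_near (span_scale (ratfun_cst 0) sf).
  by apply: nearW => z; rewrite horner0.
apply: span_near (span_add (span_mulX IHp) (span_scale (ratfun_cst c) sf)).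
by apply: nearW => z; rewrite !hornerE /=; ring.
Qed.

(** [N(z) - w L(z)] vanishes on the fibre over [w], so the quotient of
    [N - w L] by [z - r] inverts [z - r] up to the scalar [N(r) - w L(r)]. *)
Lemma span_div_XsubC r f : fibre_span f -> fibre_span (fun z => f z / (z - r)).
Proof.
move=> sf; have quot p : exists q, p = q * ('X - r%:P) + p.[r]%:P.
  have /factor_theorem[q e] : root (p - p.[r]%:P) r by rewrite rootE !hornerE subrr.
  by exists q; rewrite -e subrK.
have [N1 NE] := quot N; have [L1 LE] := quot L.
pose k w := (N.[r] - w * L.[r])^-1.
have rid := @ratfun_id C.
have rk : ratfun k.
  apply: ratfunV.
  exact: (ratfunD (ratfun_cst N.[r]) (ratfunN (ratfunM rid (ratfun_cst L.[r])))).
have NLr : (N.[r] != 0) || (L.[r] != 0).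
  by case: (eqVneq L.[r] 0) => [/no_common_root ->|]; rewrite ?orbT.
have := span_scale rk (span_add (span_scale rid (span_mul_poly L1 sf))
   (span_scale (ratfun_cst (-1)) (span_mul_poly N1 sf))).
apply: span_near; near=> z.
have Lz : L.[z] != 0 by near: z; exact: neq0_near fibre_den_neq0.
have zr : z - r != 0.
  by rewrite subr_eq0; near: z; apply: filterS (cofinitely_neq r) => z /eqP.
have kz : N.[r] - Z z * L.[r] != 0.
  by near: z; exact: (fibre_map_cofinitely (linear_neq0 NLr)).
apply: (mulfI kz); apply: (mulfI zr).
rewrite /k mulVKf// mulrCA [X in _ * X]mulrC divfK//.
have /(_ erefl) := (fibre_eq (Z z) Lz).1.
have := congr1 (horner^~ z) LE; have := congr1 (horner^~ z) NE.
rewrite !hornerE /= => -> -> e.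
apply/eqP; rewrite -subr_eq0; apply/eqP.
by rewrite -[RHS](mulr0 (f z)) -[X in f z * X]e; ring.
Unshelve. all: by end_near. Qed.

(** The span contains [1] and is stable under multiplication by polynomials and
    under division by the linear factors of a denominator. *)
Lemma fibre_span_ratfun f : ratfun f -> fibre_span f.
Proof.
move=> [A [D [D0 fE]]]; have [rs DE] := closed_field_poly_normal D.
have lD : lead_coef D != 0 by rewrite lead_coef_eq0.
suff : fibre_span (fun z => A.[z] * ((lead_coef D)^-1 / (\prod_(r <- rs) ('X - r%:P)).[z])).
  apply: span_near; apply: filterS fE => z ->.
  by rewrite {1}DE hornerZ invfM.
apply: span_mul_poly; elim: rs {DE} => [|r rs IHrs].
  apply: span_near (span_scale (ratfun_cst (lead_coef D)^-1) (span_pow (Ordinal n_gt0))).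
  by apply: nearW => z; rewrite big_nil hornerC expr0 divr1 mulr1.
apply: span_near (span_div_XsubC r IHrs).
by apply: nearW => z; rewrite big_cons hornerM !hornerE invfM mulrCA mulrC.
Qed.

Definition P1_map (P : P1 C) : P1 C :=
  if P is Some z then if L.[z] == 0 then None else Some (Z z)
  else if L`_n == 0 then None else Some (N`_n / L`_n).

Lemma P1_map_regular : regular_map (@P1_coord C) (@P1_coord C) P1_map.
Proof.
have [F FE] := is_form_homog n (0 : 'I_2) 1 N.
have [G GE] := is_form_homog n (0 : 'I_2) 1 L.
pose H (i : 'I_2) := if i == 0 then F else G.
have HE Q : exists2 c : C, c != 0 &
    forall i, hval (H i) (P1_coord Q) = c * P1_coord (P1_map Q) i.
  case: Q => [z|] /=.
    have Fz : hval F (P1_coord (Some z)) = N.[z] by rewrite FE /= homog1E.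
    have Gz : hval G (P1_coord (Some z)) = L.[z] by rewrite GE /= homog1E.
    have [Lz|Lz] := eqVneq L.[z] 0.
      exists N.[z]; first exact: no_common_root.
      by case=> -[|[|//]] i; rewrite /H /= ?Fz ?Gz ?Lz ?mulr1 ?mulr0.
    exists L.[z] => //; case=> -[|[|//]] i; rewrite /H /= ?Fz ?Gz ?mulr1//.
    by rewrite /Z mulrC divfK.
  have FN : hval F (P1_coord None) = N`_n by rewrite FE /= homog0E.
  have GN : hval G (P1_coord None) = L`_n by rewrite GE /= homog0E.
  have := lead_fibre; have [Ln|Ln] := eqVneq L`_n 0 => /=.
    rewrite orbF => Nn; exists N`_n => //.
    by case=> -[|[|//]] i; rewrite /H /= ?FN ?GN ?Ln ?mulr1 ?mulr0.
  move=> _; exists L`_n => //; case=> -[|[|//]] i; rewrite /H /= ?FN ?GN ?mulr1//.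
  by rewrite mulrC divfK.
move=> P; exists n, H; split.
  have [c c0 HP] := HE P; case: (P1_map P) HP => [w|] HP.
    by exists 1; rewrite HP /= mulr1.
  by exists 0; rewrite HP /= mulr1.
by move=> Q _; have [c _ HQ] := HE Q; exists c.
Qed.

Definition extend0 f (P : P1 C) : C := if P is Some z then f z else 0.

Lemma extend0_rational f : ratfun f -> rational_fun (@P1_coord C) (extend0 f).
Proof. by move=> rf; exact: rational_P1. Qed.

Lemma fibre_map_degree : map_degree (@P1_coord C) (@P1_coord C) P1_map n.
Proof.
have mapE : \forall z \near cofinitely C, P1_map (Some z) = Some (Z z).
  by apply: filterS (neq0_near fibre_den_neq0) => z Lz; rewrite /= (negbTE Lz).
exists (fun i => extend0 (fun z => z ^+ i)); split.
- move=> i; apply: extend0_rational.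
  by apply: ratfun_near (ratfun_poly 'X^i); apply: nearW => z; rewrite hornerXn.
- move=> f /P1_rational/fibre_span_ratfun[a [ra fE]].
  exists (fun i => extend0 (a i)); split=> [i|]; first exact: extend0_rational.
  apply/almost_eqP/cofinitely_Some.
  by apply: filterS2 mapE fE => z Pz ->; apply: eq_bigr => i _; rewrite Pz.
- move=> a ra /almost_eqP/cofinitely_Some fE i; apply/almost_eqP/cofinitely_Some.
  apply: (@fibre_free (fun i w => a i (Some w))).
  apply: filterS2 mapE fE => z Pz; rewrite Pz => e.
  by rewrite -[RHS]e; apply: eq_bigr.
Qed.

Lemma fibre_rational_degree f :
  (\forall z \near cofinitely C, f z = Z z) -> rational_degree f n.
Proof.
move=> fZ; exists P1_map; split; [exact: P1_map_regular| |exact: fibre_map_degree].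
by apply: filterS2 fZ (neq0_near fibre_den_neq0) => z -> Lz; rewrite /= (negbTE Lz).
Qed.

End Fibres.

(** * Coordinates on the curve *)

Section Curve.
Variable C : numClosedFieldType.
Implicit Types (A B D : {poly C}) (P Q : E1 C) (a b : {P : C * C | on_E1 P}).

Definition xc P : C := if P is Some a then (val a).1 else 0.
Definition yc P : C := if P is Some a then (val a).2 else 0.

Definition cubic : {poly C} := 'X^3 - 'X.

Lemma yc_sqr P : yc P ^+ 2 = cubic.[xc P].
Proof.
case: P => [[[x y] /= /eqP /= e]|]; rewrite /cubic !hornerE ?e//=.
by rewrite !expr0n subr0.
Qed.

Lemma on_E1_opp x y : @on_E1 C (x, y) -> on_E1 (x, - y).
Proof. by rewrite /on_E1 /= sqrrN. Qed.

Definition E1_opp P : E1 C :=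
  if P is Some a then insub ((val a).1, - (val a).2) else None.

Lemma E1_oppE x y h : E1_opp (Some (exist _ (x, y) h)) =
  Some (exist _ (x, - y) (on_E1_opp h)).
Proof.
by rewrite /E1_opp /= insubT//= ?on_E1_opp// => h'; congr (Some (exist _ _ _));
  exact: bool_irrelevance.
Qed.

Lemma E1_opp_neq0 P : P <> None -> E1_opp P <> None.
Proof. by case: P => [[[x y] h]|//]; rewrite E1_oppE. Qed.

Lemma xc_opp P : xc (E1_opp P) = xc P.
Proof. by case: P => [[[x y] h]|//]; rewrite E1_oppE. Qed.

Lemma yc_opp P : yc (E1_opp P) = - yc P.
Proof. by case: P => [[[x y] h]|]; rewrite ?E1_oppE//= oppr0. Qed.

Lemma E1_oppK : involutive E1_opp.
Proof.
case=> [[[x y] h]|//]; rewrite !E1_oppE; congr Some; apply: val_inj => /=.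
by rewrite opprK.
Qed.

Lemma E1_xy_inj P Q : P <> None -> Q <> None -> xc P = xc Q -> yc P = yc Q -> P = Q.
Proof.
case: P => [[[x y] h]|//]; case: Q => [[[x' y'] h']|//] _ _ /= ? ?.
by congr Some; apply: val_inj => /=; congr pair.
Qed.

Lemma xc_surj x : exists P, P <> None /\ xc P = x.
Proof.
have h : on_E1 (x, sqrtC (x ^+ 3 - x)) by rewrite /on_E1 /= sqrtCK.
by exists (Some (exist (fun u : C * C => is_true (on_E1 u)) _ h)).
Qed.

Lemma xc_fibre P Q : P <> None -> Q <> None -> xc P = xc Q ->
  P = Q \/ P = E1_opp Q.
Proof.
move=> P0 Q0 e; have := yc_sqr P; rewrite e -yc_sqr => /eqP.
rewrite eqf_sqr => /orP[] /eqP eyE; [left|right]; apply: E1_xy_inj => //.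
- by case: Q Q0 {e eyE} => [[[x y] h]|//]; rewrite E1_oppE.
- by rewrite xc_opp.
- by rewrite yc_opp.
Qed.

Lemma xc_cofinitely : xc @ cofinitely (E1 C) --> cofinitely C.
Proof.
apply: finite_to_one_cofinitely => x; have [P0 [PN Px]] := xc_surj x.
apply: (sub_finite_set _ (finite_seq [:: None; P0; E1_opp P0])) => Q /= Qx.
have [->|QN] := pselect (Q = None); first by rewrite mem_head.
have [|->|->] := xc_fibre QN PN; rewrite ?Qx ?Px ?inE ?eqxx ?orbT//.
Qed.

Lemma E1_near_xc (U : set C) :
  (\forall P \near cofinitely (E1 C), U (xc P)) <-> (\forall x \near cofinitely C, U x).
Proof.
split=> [|fU]; last exact: xc_cofinitely.
by apply: surj_cofinitely => x; have [P []] := xc_surj x; exists P.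
Qed.

Lemma E1_near_opp (U : set (E1 C)) :
  (\forall P \near cofinitely (E1 C), U P) ->
  \forall P \near cofinitely (E1 C), U (E1_opp P).
Proof.
have : E1_opp @ cofinitely (E1 C) --> cofinitely (E1 C); last exact.
apply: finite_to_one_cofinitely => Q.
apply: (sub_finite_set _ (finite_set1 (E1_opp Q))) => P /= <-.
by rewrite E1_oppK.
Qed.

Lemma infinite_E1 : infinite_set [set: E1 C].
Proof.
move=> finE; apply: (@infinite_num C).
apply: sub_finite_set (finite_image xc finE) => x _.
by have [P [_ Px]] := xc_surj x; exists P.
Qed.

Global Instance cofinitely_E1_proper : ProperFilter (cofinitely (E1 C)).
Proof. exact: cofinitely_proper infinite_E1. Qed.

Lemma cubic_neq0 : cubic != 0.
Proof.
apply/eqP => /(congr1 (coefp 3)) /eqP.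
by rewrite /= coefB coefXn coefX /= subr0 coef0 oner_eq0.
Qed.

Lemma near_yc_neq0 : \forall P \near cofinitely (E1 C), yc P != 0.
Proof.
apply: filterS ((E1_near_xc (fun x => cubic.[x] != 0)).2 (neq0_near cubic_neq0)) => P.
by rewrite /= -yc_sqr sqrf_eq0.
Qed.

(** Adding and subtracting the values at [P] and [- P] separates the two components. *)
Lemma E1_free (f g : C -> C) :
  (\forall P \near cofinitely (E1 C), f (xc P) + yc P * g (xc P) = 0) ->
  (\forall x \near cofinitely C, f x = 0) /\ (\forall x \near cofinitely C, g x = 0).
Proof.
move=> fg; have fg' := E1_near_opp fg.
split; apply/E1_near_xc; near=> P.
  have e : f (xc P) + yc P * g (xc P) = 0 by near: P.
  have : f (xc (E1_opp P)) + yc (E1_opp P) * g (xc (E1_opp P)) = 0 by near: P.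
  rewrite xc_opp yc_opp => e'; have : 2 * f (xc P) = 0.
    by rewrite -[RHS]addr0 -{1}e -e'; ring.
  by move/eqP; rewrite mulf_eq0 pnatr_eq0 /= => /eqP.
have y0 : yc P != 0 by near: P; exact: near_yc_neq0.
have e : f (xc P) + yc P * g (xc P) = 0 by near: P.
have : f (xc (E1_opp P)) + yc (E1_opp P) * g (xc (E1_opp P)) = 0 by near: P.
rewrite xc_opp yc_opp => e'; have : 2 * (yc P * g (xc P)) = 0.
  by rewrite -[RHS]subr0 -{1}e -e'; ring.
by move/eqP; rewrite !mulf_eq0 pnatr_eq0 (negbTE y0) /= => /eqP.
Unshelve. all: by end_near. Qed.

(** The norm of [A + y B] from [C(x, y)] to [C(x)]. *)
Definition norm A B := A ^+ 2 - cubic * B ^+ 2.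

Lemma normE A B P : (norm A B).[xc P] =
  (A.[xc P] + yc P * B.[xc P]) * (A.[xc P] - yc P * B.[xc P]).
Proof. by rewrite mulrC -subr_sqr exprMn yc_sqr /norm !hornerE. Qed.

Lemma size_cubic : size cubic = 4%N.
Proof. by rewrite size_polyDl size_polyXn// size_polyN size_polyX. Qed.

(** The degrees of [A ^ 2] and of [cubic * B ^ 2] have different parities, so that
    their top terms do not cancel. *)
Lemma size_norm A B : size (norm A B) =
  maxn (size A).*2.-1 (if B == 0 then 0%N else (size B).*2.+2).
Proof.
rewrite /norm; have sA : size (A ^+ 2) = (size A).*2.-1.
  have [->|A0] := eqVneq A 0; first by rewrite expr0n/= size_poly0.
  by rewrite expr2 size_mul// addnn.
have [->|B0] := eqVneq B 0; first by rewrite expr0n/= mulr0 subr0 maxn0.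
have sB : size (- (cubic * B ^+ 2)) = (size B).*2.+2.
  rewrite size_polyN size_mul ?expf_neq0 ?cubic_neq0// size_cubic expr2 size_mul//.
  by move: B0; rewrite -size_poly_gt0; case: (size B) => [|s]; lia.
have sB' : (size B).*2.+2 != (size A).*2.-1 by lia.
have [lt|lt|e] := ltngtP (size (A ^+ 2)) (size (- (cubic * B ^+ 2))).
- by rewrite addrC size_polyDl// sB; lia.
- by rewrite size_polyDl// sA; lia.
- by rewrite sA sB in e; rewrite e eqxx in sB'.
Qed.

Lemma norm_eq0 A B : norm A B = 0 -> A = 0 /\ B = 0.
Proof.
move=> /(congr1 (fun p : {poly C} => size p)); rewrite /= size_norm size_poly0.
have [->|B0] := eqVneq B 0; last by lia.
by move=> sA; split=> //; apply/eqP; rewrite -size_poly_eq0; lia.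
Qed.

(** * Forms restricted to the curve *)

(** Giving [x] weight 2 and [y] weight 3, a form of degree [k] has weight at most
    [3 k], and its value at the point at infinity is the coefficient of weight [3 k]. *)
Lemma E1_form k (F : mpoly.dhomog 3 C k) : exists A B,
  [/\ forall P, P <> None -> hval F (E1_coord P) = A.[xc P] + yc P * B.[xc P],
      forall i, (3 * k < i.*2)%N -> A`_i = 0,
      forall i, (3 * k < i.*2 + 3)%N -> B`_i = 0
    & hval F (E1_coord None) = (if odd k then B else A)`_(3 * k./2)%N].
Proof.
pose Q (f : ('I_3 -> C) -> C) := exists A B,
  [/\ forall P, P <> None -> f (E1_coord P) = A.[xc P] + yc P * B.[xc P],
      forall i, (3 * k < i.*2)%N -> A`_i = 0,
      forall i, (3 * k < i.*2 + 3)%N -> B`_i = 0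
    & f (E1_coord None) = (if odd k then B else A)`_(3 * k./2)%N].
apply: (@form_ind _ _ _ Q).
- by exists 0, 0; split=> *; rewrite ?if_same ?horner0 ?mulr0 ?addr0 ?coef0.
- move=> c f g [A [B [fE A0 B0 fN]]] [A' [B' [gE A'0 B'0 gN]]].
  exists (c *: A + A'), (c *: B + B'); split=> [P PN|i i1|i i1|].
  + by rewrite fE// gE// !(hornerD, hornerZ); ring.
  + by rewrite coefD coefZ A0// A'0// mulr0 addr0.
  + by rewrite coefD coefZ B0// B'0// mulr0 addr0.
  + by rewrite fN gN; case: ifP; rewrite coefD coefZ.
move=> m; rewrite !big_ord_recl big_ord0 addn0.
set m0 := m _; set m1 := m _; set m2 := m _ => mk.
(* Even powers of [y] are replaced by powers of the cubic. *)
pose M := 'X^m0 * cubic ^+ m1./2.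
have monM : M \is monic.
  rewrite monicMl ?monicXn// monic_exp// monicE lead_coefDl ?lead_coefXn//.
  by rewrite size_polyN size_polyX size_polyXn.
have sc : size (cubic ^+ m1./2) = (3 * m1./2)%N.+1.
  by rewrite -[LHS]prednK ?size_exp ?size_cubic// size_poly_gt0 expf_neq0 ?cubic_neq0.
have sM : size M = (m0 + 3 * m1./2)%N.+1.
  rewrite size_mul ?expf_neq0 ?cubic_neq0 ?polyX_eq0//.
  by rewrite size_polyXn sc addSn addnS.
have M0 i : (m0 + 3 * m1./2 < i)%N -> M`_i = 0 by move=> i1; apply: nth_default; rewrite sM.
have Mtop : M`_(m0 + 3 * m1./2)%N = 1 by rewrite -[RHS](monicP monM) lead_coefE sM.
have ME P : P <> None -> \prod_(i < 3) E1_coord P i ^+ m i =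
    M.[xc P] * (if odd m1 then yc P else 1).
  move=> PN; rewrite !big_ord_recl big_ord0 /= -/m0 -/m1 -/m2.
  case: P PN => [[[x y] h]|//] _ /=; rewrite expr1n !mulr1 /M !hornerE -mulrA.
  congr (_ * _).
  have /eqP /= <- := h.
  by rewrite -exprM mul2n -{1}(odd_double_half m1) exprD mulrC; case: (odd m1).
have MN : \prod_(i < 3) E1_coord (None : E1 C) i ^+ m i = (m1 == k)%:R.
  rewrite !big_ord_recl big_ord0 /= -/m0 -/m1 -/m2 expr1n !expr0n /= mul1r mulr1 -natrM.
  by congr _%:R; case: eqP; case: eqP; case: eqP; lia.
case om1 : (odd m1) in ME; [exists 0, M|exists M, 0]; split.
- by move=> P PN; rewrite ME// horner0 add0r mulrC.
- by move=> i _; rewrite coef0.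
- by move=> i i1; rewrite M0//; lia.
- rewrite MN; case: eqP => mk1; last first.
    by case: ifP => ok; rewrite ?coef0// M0//; lia.
  by rewrite -mk1 om1 (_ : (_ * _)%N = (m0 + 3 * m1./2)%N) ?Mtop//; lia.
- by move=> P PN; rewrite ME// horner0 mulr0 addr0 mulr1.
- by move=> i i1; rewrite M0//; lia.
- by move=> i _; rewrite coef0.
- rewrite MN; case: eqP => mk1; last first.
    by case: ifP => ok; rewrite ?coef0// M0//; lia.
  by rewrite -mk1 om1 (_ : (_ * _)%N = (m0 + 3 * m1./2)%N) ?Mtop//; lia.
Qed.

End Curve.

(** * The function field of the curve *)

Section CurveRational.
Variable C : numClosedFieldType.
Implicit Types (A B D : {poly C}) (P Q : E1 C).

Lemma size_coef_le (p : {poly C}) m :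
  (forall i, (m <= i)%N -> p`_i = 0) -> (size p <= m)%N.
Proof. by move=> p0; apply/leq_sizeP => j; apply: p0. Qed.

(** By Bezout a form of degree [k] has [3 k] zeros on the curve; the degree of its
    norm counts those at finite distance, and is less than [3 k] exactly when the
    point at infinity is a zero. *)
Lemma E1_form_norm k (F : mpoly.dhomog 3 C k) : exists A B,
  [/\ forall P, P <> None -> hval F (E1_coord P) = A.[xc P] + yc P * B.[xc P],
      hval F (E1_coord (None : E1 C)) != 0 -> size (norm A B) = (3 * k)%N.+1
    & hval F (E1_coord (None : E1 C)) = 0 -> (size (norm A B) <= 3 * k)%N].
Proof.
have [A [B [FE A0 B0 FN]]] := E1_form F; exists A, B.
rewrite FN; pose h := k./2; have kE : k = (odd k + h.*2)%N by rewrite odd_double_half.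
have sA : (size A <= (3 * k)./2.+1)%N by apply: size_coef_le => i i1; apply: A0; lia.
have sB : ((size B).*2 <= (3 * k).-1)%N.
  have : (size B <= (3 * k - 1)./2)%N by apply: size_coef_le => i i1; apply: B0; lia.
  lia.
have sB0 : B != 0 -> (0 < size B)%N by rewrite size_poly_gt0.
split=> // [top|top]; rewrite size_norm.
- case ok : (odd k) in top kE.
    have : (3 * h < size B)%N.
      by rewrite ltnNge; apply: contra top => /leq_sizeP/(_ _ (leqnn _)) ->.
    case: eqVneq => [->|_]; first by rewrite size_poly0.
    by move: (size B) (size A) sA sB => sb sa; lia.
  have : (3 * h < size A)%N.
    by rewrite ltnNge; apply: contra top => /leq_sizeP/(_ _ (leqnn _)) ->.
  by case: eqVneq => [_|/sB0]; move: (size B) (size A) sA sB => sb sa; lia.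
- case ok : (odd k) in top kE.
    have : (size B <= 3 * h)%N.
      apply: size_coef_le => i; rewrite leq_eqVlt => /orP[/eqP <- //|i1].
      by apply: B0; lia.
    by case: eqVneq => _; move: (size B) (size A) sA sB => sb sa; lia.
  have : (size A <= 3 * h)%N.
    apply: size_coef_le => i; rewrite leq_eqVlt => /orP[/eqP <- //|i1].
    by apply: A0; lia.
  by case: eqVneq => [_|/sB0]; move: (size B) (size A) sA sB => sb sa; lia.
Qed.

(** The zeros of a form at finite distance are zeros of its norm, a polynomial in
    [x]; if the norm is zero, so is the value at infinity, by [E1_form_norm]. *)
Lemma E1_form_dec k (F : mpoly.dhomog 3 C k) :
  (forall P, hval F (E1_coord P) = 0) \/
  (\forall P \near cofinitely (E1 C), hval F (E1_coord P) != 0).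
Proof.
have [A [B [FE FN1 FN0]]] := E1_form_norm F.
have [n0|n0] := eqVneq (norm A B) 0; [left|right].
  have [A0 B0] := norm_eq0 n0; case=> [a|];
    first by rewrite FE// A0 B0 !horner0 mulr0 addr0.
  apply/eqP; apply: contraT => /FN1; rewrite n0 size_poly0//.
apply: filterS2 ((E1_near_xc (fun x => (norm A B).[x] != 0)).2 (neq0_near n0))
  (cofinitely_neq None) => P nP PN.
by rewrite FE//; apply: contraNneq nP => e; rewrite normE e mul0r.
Qed.

Definition E1_ratfun (f : E1 C -> C) := exists a b : C -> C,
  [/\ ratfun a, ratfun b &
   \forall P \near cofinitely (E1 C), f P = a (xc P) + yc P * b (xc P)].

Lemma E1_ratfun_near f g : (\forall P \near cofinitely (E1 C), f P = g P) ->
  E1_ratfun g -> E1_ratfun f.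
Proof.
move=> fg [a [b [ra rb gE]]]; exists a, b; split=> //.
by apply: filterS2 fg gE => P -> ->.
Qed.

Lemma E1_ratfun_xc (a : C -> C) : ratfun a -> E1_ratfun (fun P => a (xc P)).
Proof.
move=> ra; exists a, (fun=> 0); split=> //; first exact: ratfun_cst.
by apply: nearW => P; rewrite mulr0 addr0.
Qed.

Lemma E1_ratfun_cst c : E1_ratfun (fun=> c).
Proof. exact: (E1_ratfun_xc (ratfun_cst c)). Qed.

Lemma E1_ratfun_yc : E1_ratfun (@yc C).
Proof.
exists (fun=> 0), (fun=> 1); split; try exact: ratfun_cst.
by apply: nearW => P; rewrite mulr1 add0r.
Qed.

Lemma E1_ratfunD f g : E1_ratfun f -> E1_ratfun g -> E1_ratfun (fun P => f P + g P).
Proof.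
move=> [a [b [ra rb fE]]] [a' [b' [ra' rb' gE]]].
exists (fun x => a x + a' x), (fun x => b x + b' x).
split; try exact: ratfunD.
by apply: filterS2 fE gE => P -> ->; ring.
Qed.

Lemma E1_ratfunM f g : E1_ratfun f -> E1_ratfun g -> E1_ratfun (fun P => f P * g P).
Proof.
move=> [a [b [ra rb fE]]] [a' [b' [ra' rb' gE]]].
exists (fun x => a x * a' x + (cubic C).[x] * (b x * b' x)),
  (fun x => a x * b' x + b x * a' x).
split.
- exact: ratfunD (ratfunM ra ra') (ratfunM (ratfun_poly _) (ratfunM rb rb')).
- exact: ratfunD (ratfunM ra rb') (ratfunM rb ra').
- by apply: filterS2 fE gE => P -> ->; rewrite -yc_sqr; ring.
Qed.

Lemma E1_ratfun_sum I (r : seq I) (F : I -> E1 C -> C) :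
  (forall i, E1_ratfun (F i)) -> E1_ratfun (fun P => \sum_(i <- r) F i P).
Proof.
move=> rF; elim: r => [|i r IHr].
  by apply: E1_ratfun_near (E1_ratfun_cst 0); apply: nearW => P; rewrite big_nil.
apply: E1_ratfun_near (E1_ratfunD (rF i) IHr).
by apply: nearW => P; rewrite big_cons.
Qed.

(** Multiplying by the conjugate of the denominator replaces it by its norm. *)
Lemma E1_rational f : rational_fun (@E1_coord C) f -> E1_ratfun f.
Proof.
move=> [k [G [H [[P0 HP0] fE]]]].
have [A [B [GE _ _]]] := E1_form_norm G; have [A' [B' [HE _ _]]] := E1_form_norm H.
have [H0|H0] := E1_form_dec H; first by rewrite H0 eqxx in HP0.
have n0 : norm A' B' != 0.
  apply/negP => /eqP /norm_eq0[A0 B0].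
  have [P [HP PN]] := filter_ex (filterI H0 (cofinitely_neq None)).
  by move: HP; rewrite HE// A0 B0 !horner0 mulr0 addr0 eqxx.
have rG : E1_ratfun (fun P => A.[xc P] + yc P * B.[xc P]).
  by exists (horner A), (horner B); split; try exact: ratfun_poly; exact: nearW.
have rH : E1_ratfun (fun P => A'.[xc P] + yc P * - B'.[xc P]).
  exists (horner A'), (fun x => - B'.[x]); split; try exact: ratfun_poly.
    exact: ratfunN (ratfun_poly _).
  exact: nearW.
have rn : E1_ratfun (fun P => (norm A' B').[xc P]^-1).
  exact: (E1_ratfun_xc (ratfunV (ratfun_poly _))).
apply: E1_ratfun_near (E1_ratfunM rG (E1_ratfunM rH rn)).
apply: filterS3 H0 (cofinitely_neq None)
  ((E1_near_xc (fun x => (norm A' B').[x] != 0)).2 (neq0_near n0)) => P HP PN nP.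
rewrite fE// GE// HE// normE; congr (_ * _).
rewrite normE mulf_eq0 negb_or in nP; have /andP[_ n2] := nP.
by rewrite invfM mulrCA mulrN divff// mulr1.
Qed.

Lemma rational_E1 f : E1_ratfun f -> rational_fun (@E1_coord C) f.
Proof.
move=> [a [b [[A [D [D0 aE]]] [B [E [E0 bE]]] fE]]].
have {A B D E D0 E0 a aE b bE fE} [A [B [D [D0 fE]]]] : exists A B D, D != 0 /\
    \forall P \near cofinitely (E1 C), f P = (A.[xc P] + yc P * B.[xc P]) / D.[xc P].
  exists (A * E), (B * D), (D * E); split; first by rewrite mulf_neq0.
  near=> P.
  have -> : f P = a (xc P) + yc P * b (xc P) by near: P.
  have -> : a (xc P) = A.[xc P] / D.[xc P].
    by near: P; apply/(E1_near_xc (fun x => a x = A.[x] / D.[x])).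
  have -> : b (xc P) = B.[xc P] / E.[xc P].
    by near: P; apply/(E1_near_xc (fun x => b x = B.[x] / E.[x])).
  have Dx : D.[xc P] != 0.
    by near: P; apply/(E1_near_xc (fun x => D.[x] != 0)); exact: neq0_near.
  have Ex : E.[xc P] != 0.
    by near: P; apply/(E1_near_xc (fun x => E.[x] != 0)); exact: neq0_near.
  by rewrite mulrA addf_div// !hornerM; congr (_ / _); ring.
move: fE => /finite_seqP[s sE].
(* [M] vanishes at the points where [f] is not given by the formula. *)
pose M := \prod_(P <- s) ('X - (xc P)%:P).
have M0 : M != 0 by rewrite monic_neq0// monic_prod// => P _; exact: monicXsubC.
pose k := maxn (size (A * M)) (maxn (size (B * M)) (size (D * M))).
pose i0 : 'I_3 := 0; pose i1 : 'I_3 := 1; pose i2 : 'I_3 := 2%:R.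
have F1 (i : 'I_3) := is_form_coord C i.
have [G GE] := is_formD (is_formM (F1 i2) (is_form_homog k i0 i2 (A * M)))
                        (is_formM (F1 i1) (is_form_homog k i0 i2 (B * M))).
have [H HE] := is_formM (F1 i2) (is_form_homog k i0 i2 (D * M)).
have {}GE P : P <> None -> hval G (E1_coord P) = (A * M).[xc P] + yc P * (B * M).[xc P].
  case: P => [[[x y] h]|//] _; rewrite GE /= mul1r !homog1E//.
    by rewrite (leq_trans _ (leqnSn _))// leq_max leq_max leqnn !orbT.
  by rewrite (leq_trans _ (leqnSn _))// leq_max leqnn.
have HN : hval H (E1_coord (None : E1 C)) = 0 by rewrite HE /= mul0r.
have {}HE P : P <> None -> hval H (E1_coord P) = (D * M).[xc P].
  case: P => [[[x y] h]|//] _; rewrite HE /= mul1r !homog1E//.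
  by rewrite (leq_trans _ (leqnSn _))// leq_max leq_max leqnn !orbT.
exists (1 + k)%N, G, H; split.
  have [P [zDB PN]] := filter_ex (filterI ((E1_near_xc (fun x => (D * M).[x] != 0)).2
    (neq0_near (mulf_neq0 D0 M0))) (cofinitely_neq None)).
  by exists P; rewrite HE.
move=> P HP; have PN : P <> None by move=> PN; rewrite PN HN eqxx in HP.
move: HP; rewrite GE// HE// !hornerM mulf_eq0 negb_or => /andP[Dz Mz].
rewrite mulrA -mulrDl -mulf_div divff// mulr1; apply: contrapT => fz.
have : (~` [set P | f P = (A.[xc P] + yc P * B.[xc P]) / D.[xc P]]) P by [].
rewrite sE /= => zs; move/negP: Mz; apply; rewrite horner_prod.
by rewrite (big_rem P)//= !hornerE subrr mul0r.
Unshelve. all: by end_near. Qed.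

(** Bases of the function field over the image of [phi^*] all have the same
    cardinal: the product of the two change-of-basis matrices is the identity
    at a generic point, where they are matrices of numbers. *)
Lemma E1_map_degree_le (phi : E1 C -> E1 C) d n :
  map_degree (@E1_coord C) (@E1_coord C) phi d ->
  map_degree (@E1_coord C) (@E1_coord C) phi n -> (d <= n)%N.
Proof.
move=> [b [rb spanb freeb]] [e [re spane _]].
have /choice[u uP] : forall i, exists u : 'I_n -> E1 C -> C,
    (forall j, rational_fun (@E1_coord C) (u j)) /\
    almost_eq (b i) (fun P => \sum_(j < n) u j (phi P) * e j P).
  by move=> i; apply: spane.
have /choice[v vP] : forall j, exists v : 'I_d -> E1 C -> C,
    (forall i, rational_fun (@E1_coord C) (v i)) /\
    almost_eq (e j) (fun P => \sum_(i < d) v i (phi P) * b i P).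
  by move=> j; apply: spanb.
pose w i k Q := \sum_(j <- index_enum 'I_n) u i j Q * v j k Q - (i == k)%:R.
have rw i k : rational_fun (@E1_coord C) (w i k).
  apply: rational_E1; apply: E1_ratfunD; last exact: E1_ratfun_cst.
  apply: E1_ratfun_sum => j; apply: E1_ratfunM; apply: E1_rational.
    by have [] := uP i.
  by have [] := vP j.
have w0 i k : \forall Q \near cofinitely (E1 C), w i k Q = 0.
  apply: (freeb (w i)) => //; apply/almost_eqP.
  have bE : \forall P \near cofinitely (E1 C),
      b i P = \sum_(j < n) u i j (phi P) * e j P by have [_] := uP i.
  have eE : \forall P \near cofinitely (E1 C), forall j,
      e j P = \sum_(k < d) v j k (phi P) * b k P.
    by apply: filter_forall => j; have [_] := vP j.
  apply: filterS2 bE eE => P bP eP; rewrite /w.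
  under eq_bigr do rewrite mulrBl mulr_suml.
  rewrite sumrB exchange_big /= [X in _ - X](bigD1 i)//= eqxx mul1r.
  rewrite [X in _ - (_ + X)]big1 ?addr0; last first.
    by move=> l; rewrite eq_sym => /negbTE ->; rewrite mul0r.
  rewrite bP -sumrB big1// => j _; rewrite eP mulr_sumr.
  by apply/eqP; rewrite subr_eq0; apply/eqP/eq_bigr => l _; rewrite mulrA.
have [Q wQ] := filter_ex (filter_forall _ (fun i => filter_forall _ (w0 i))).
pose A := \matrix_(i < d, j < n) u i j Q; pose B := \matrix_(j < n, k < d) v j k Q.
apply: (@mulmx1_min _ _ _ A B); apply/matrixP => i k; rewrite !mxE.
apply/eqP; rewrite -subr_eq0; apply/eqP; rewrite -[RHS](wQ i k) /w.
by congr (_ - _); apply: eq_bigr => j _; rewrite !mxE.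
Qed.

Lemma E1_map_degree_uniq (phi : E1 C -> E1 C) d n :
  map_degree (@E1_coord C) (@E1_coord C) phi d ->
  map_degree (@E1_coord C) (@E1_coord C) phi n -> d = n.
Proof.
by move=> hd hn; apply/eqP;
  rewrite eqn_leq !(E1_map_degree_le hd hn, E1_map_degree_le hn hd).
Qed.

End CurveRational.

(** * Isogenies and their coordinates *)

Section Isogeny.
Variable C : numClosedFieldType.
Implicit Types (A B D : {poly C}) (P Q : E1 C).

Lemma E1_add_opp P : E1_add P (E1_opp P) = None.
Proof.
by case: P => [[[x y] h]|//]; rewrite E1_oppE /= opprK !eqxx.
Qed.

Lemma E1_add_eq_None P Q : E1_add P Q = None -> Q = E1_opp P.
Proof.
case: P Q => [[[x y] h]|] [[[x' y'] h']|]//; last first.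
rewrite E1_oppE /=; case: ifP => [/andP[/eqP e /eqP e'] _|n12].
  congr Some; apply: val_inj => /=; rewrite e e' opprK//.
by rewrite insubT ?E1_chordP ?n12// => h0.
Qed.

Lemma xc_add P Q : P <> None -> Q <> None -> xc P != xc Q ->
  E1_add P Q <> None /\
  xc (E1_add P Q) = ((yc Q - yc P) / (xc Q - xc P)) ^+ 2 - xc P - xc Q.
Proof.
case: P Q => [[[x y] h]|] [[[x' y'] h']|]// _ _ /= xx'.
rewrite (negbTE xx') /= insubT ?E1_chordP ?(negbTE xx')//= => h0.
by rewrite /E1_slope /= (negbTE xx').
Qed.

Lemma E1_add_idem P : E1_add P P = P -> P = None.
Proof.
case: P => [[[x y] h]|//] /=; rewrite eqxx /=.
case: eqP => [//|/eqP yy]; rewrite insubT ?E1_chordP ?eqxx//= => h0 [].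
set l := E1_slope _ _; move=> ->; rewrite subrr mulr0 sub0r => /eqP.
by rewrite eq_sym (negbTE yy).
Qed.

(** * Functions regular on the affine curve *)

Definition E1_reg (f : E1 C -> C) := exists A B, forall P, P <> None ->
  f P = A.[xc P] + yc P * B.[xc P].

Lemma E1_reg_poly A : E1_reg (fun P => A.[xc P]).
Proof. by exists A, 0 => P _; rewrite horner0 mulr0 addr0. Qed.

Lemma E1_reg_form k (F : mpoly.dhomog 3 C k) : E1_reg (fun P => hval F (E1_coord P)).
Proof. by have [A [B [FE _ _]]] := E1_form_norm F; exists A, B. Qed.

Lemma E1_regB f g : E1_reg f -> E1_reg g -> E1_reg (fun P => f P - g P).
Proof.
move=> [A [B fE]] [A' [B' gE]]; exists (A - A'), (B - B') => P PN.
by rewrite fE// gE// !(hornerD, hornerN); ring.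
Qed.

Lemma E1_regM f g : E1_reg f -> E1_reg g -> E1_reg (fun P => f P * g P).
Proof.
move=> [A [B fE]] [A' [B' gE]].
exists (A * A' + cubic C * (B * B')), (A * B' + B * A') => P PN.
have := yc_sqr P; rewrite fE// gE//; move: (cubic C) => q e.
by rewrite !(hornerD, hornerM) -e; ring.
Qed.

Lemma E1_regX f n : E1_reg f -> E1_reg (fun P => f P ^+ n).
Proof.
move=> rf; elim: n => [|n IHn].
  by exists 1, 0 => P _; rewrite hornerC horner0 mulr0 addr0.
by have [A [B fE]] := E1_regM rf IHn; exists A, B => P PN; rewrite exprS fE.
Qed.

Lemma E1_reg_eq f g : E1_reg f -> E1_reg g ->
  (\forall P \near cofinitely (E1 C), f P = g P) -> forall P, P <> None -> f P = g P.
Proof.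
move=> rf rg fg P PN; have [A [B fgE]] := E1_regB rf rg.
have [/near_poly_eq0 A0 /near_poly_eq0 B0] : (\forall x \near cofinitely C, A.[x] = 0) /\
    (\forall x \near cofinitely C, B.[x] = 0).
  apply: E1_free; apply: filterS2 fg (cofinitely_neq None) => Q e QN.
  by rewrite -fgE// e subrr.
by apply/eqP; rewrite -subr_eq0 fgE// A0 B0 !horner0 mulr0 addr0.
Qed.

Lemma ratfun_coprime (f : C -> C) : ratfun f -> exists A D,
  [/\ D != 0, coprimep A D & \forall z \near cofinitely C, f z = A.[z] / D.[z]].
Proof.
move=> [A [D [D0 fE]]]; pose G := gcdp A D.
have G0 : G != 0 by rewrite gcdp_eq0 negb_and D0 orbT.
have AE : A = A %/ G * G by rewrite divpK// dvdp_gcdl.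
have DE : D = D %/ G * G by rewrite divpK// dvdp_gcdr.
exists (A %/ G), (D %/ G); split.
- by apply: contraNneq D0 => D1; rewrite DE D1 mul0r.
- by rewrite coprimep_div_gcd// D0 orbT.
- apply: filterS2 (neq0_near G0) fE => z Gz ->.
  by rewrite {1}AE {1}DE !hornerM -mulf_div divff// mulr1.
Qed.

Variable phi : E1 C -> E1 C.
Hypothesis phi_iso : E1_isogeny phi.
Hypothesis phi_neq0 : exists P, phi P <> None.

Lemma isogeny_None : phi None = None.
Proof. by apply: E1_add_idem; rewrite -phi_iso.2. Qed.

Lemma isogeny_opp P : phi (E1_opp P) = E1_opp (phi P).
Proof. by apply: E1_add_eq_None; rewrite -phi_iso.2 E1_add_opp isogeny_None. Qed.

(** The image point is [0 : 1 : 0] or [x : y : 1], up to a scalar which is non-zero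
    as soon as one of the three forms is. *)
Lemma isogeny_local P : exists k (F0 F1 F2 : mpoly.dhomog 3 C k),
  let v F Q := hval F (E1_coord Q) in
  let nz Q := [|| v F0 Q != 0, v F1 Q != 0 | v F2 Q != 0] in
  [/\ nz P, \forall Q \near cofinitely (E1 C), nz Q,
      forall Q, nz Q -> phi Q = None -> [/\ v F0 Q = 0, v F1 Q != 0 & v F2 Q = 0]
    & forall Q, nz Q -> phi Q <> None -> [/\ v F2 Q != 0,
        v F0 Q = xc (phi Q) * v F2 Q & v F1 Q = yc (phi Q) * v F2 Q]].
Proof.
have [k [F [nzP FE]]] := phi_iso.1 P.
pose i0 : 'I_3 := 0; pose i1 : 'I_3 := 1; pose i2 : 'I_3 := 2%:R.
exists k, (F i0), (F i1), (F i2) => v nz.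
have nzE Q : nz Q <-> exists i, hval (F i) (E1_coord Q) != 0.
  split; first by case/or3P; [exists i0|exists i1|exists i2].
  have ordE (i : 'I_3) : [|| i == i0, i == i1 | i == i2].
    by case: i => -[|[|[|]]].
  by case=> i; have /or3P[] := ordE i => /eqP-> Fi; rewrite /nz /v Fi ?orbT.
have cP Q : nz Q -> exists2 c : C, c != 0 &
    forall i, hval (F i) (E1_coord Q) = c * E1_coord (phi Q) i.
  move=> /nzE nzQ; have [c cE] := FE Q nzQ; exists c => //.
  by case: nzQ => i; rewrite cE; apply: contraNneq => ->; rewrite mul0r.
split.
- exact/nzE.
- have [i Fi] := nzP; have [F0|] := E1_form_dec (F i); first by rewrite F0 eqxx in Fi.
  by apply: filterS => Q FQ; apply/nzE; exists i.
- move=> Q /cP[c c0 cE] phiQ; rewrite /v !cE phiQ /= !mulr0 mulr1; split=> //.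
- move=> Q /cP[c c0 cE]; rewrite /v !cE.
  case: (phi Q) => [[[x y] h]|//] _ /=; rewrite mulr1; split=> //; exact: mulrC.
Qed.

Lemma isogeny_near_neq : \forall P \near cofinitely (E1 C), phi P <> None.
Proof.
have [P0 phiP0] := phi_neq0;
  have [k [F0 [F1 [F2 [nzP nearnz phiN phiS]]]]] := isogeny_local P0.
have [F2P _ _] := phiS _ nzP phiP0.
have [F20|] := E1_form_dec F2; first by rewrite F20 eqxx in F2P.
apply: filterS2 nearnz => Q nzQ F2Q phiQ.
by have [_ _ F2Q0] := phiN Q nzQ phiQ; rewrite F2Q0 eqxx in F2Q.
Qed.

Lemma isogeny_ratfun : E1_ratfun (fun P => xc (phi P)) /\ E1_ratfun (fun P => yc (phi P)).
Proof.
have [P0 phiP0] := phi_neq0;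
  have [k [F0 [F1 [F2 [nzP nearnz phiN phiS]]]]] := isogeny_local P0.
have [F2P _ _] := phiS _ nzP phiP0.
have nzQ Q : hval F2 (E1_coord Q) != 0 ->
    [|| hval F0 (E1_coord Q) != 0, hval F1 (E1_coord Q) != 0 | hval F2 (E1_coord Q) != 0].
  by move=> ->; rewrite !orbT.
have phiQ Q : hval F2 (E1_coord Q) != 0 -> phi Q <> None.
  move=> F2Q e; have [_ _ F2Q0] := phiN Q (nzQ _ F2Q) e.
  by rewrite F2Q0 eqxx in F2Q.
split; apply: E1_rational; [exists k, F0, F2|exists k, F1, F2]; split; try by exists P0.
  by move=> Q F2Q; have [_ -> _] := phiS Q (nzQ _ F2Q) (phiQ _ F2Q); rewrite mulfK.
by move=> Q F2Q; have [_ _ ->] := phiS Q (nzQ _ F2Q) (phiQ _ F2Q); rewrite mulfK.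
Qed.

(** The function [x (phi P)] is invariant under [P |-> - P], hence has no component
    along [y]. *)
Lemma isogeny_x : exists A D, [/\ D != 0, coprimep A D &
  \forall P \near cofinitely (E1 C), xc (phi P) = A.[xc P] / D.[xc P]].
Proof.
have [[a [b [ra rb xE]]] _] := isogeny_ratfun.
have [_ b0] : (\forall x \near cofinitely C, 0 = 0 :> C) /\
    (\forall x \near cofinitely C, 2 * b x = 0).
  apply: (E1_free (f := fun=> 0)); apply: filterS2 xE (E1_near_opp xE) => P.
  rewrite isogeny_opp !xc_opp yc_opp => -> e.
  by rewrite -[RHS](subrr (a (xc P) + yc P * b (xc P))) [X in _ - X]e /=; ring.
have [A [D [D0 AD aE]]] := ratfun_coprime ra; exists A, D; split=> //.
apply: filterS3 xE ((E1_near_xc (fun x => 2 * b x = 0)).2 b0)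
  ((E1_near_xc (fun x => a x = A.[x] / D.[x])).2 aE) => P -> /eqP.
by rewrite mulf_eq0 pnatr_eq0 /= => /eqP -> ->; rewrite mulr0 addr0.
Qed.

(** The function [y (phi P)] is odd under [P |-> - P], hence a multiple of [y]. *)
Lemma isogeny_y : exists r : C -> C, ratfun r /\
  \forall P \near cofinitely (E1 C), yc (phi P) = yc P * r (xc P).
Proof.
have [_ [a [b [ra rb yE]]]] := isogeny_ratfun.
have [a0 _] : (\forall x \near cofinitely C, 2 * a x = 0) /\
    (\forall x \near cofinitely C, 0 = 0 :> C).
  apply: (E1_free (g := fun=> 0)); apply: filterS2 yE (E1_near_opp yE) => P.
  rewrite isogeny_opp !yc_opp xc_opp => -> e.
  rewrite /= mulr0 addr0 -[RHS](subrr (a (xc P) + yc P * b (xc P))).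
  by rewrite [X in _ = _ + X]e; ring.
exists b; split=> //.
apply: filterS2 yE ((E1_near_xc (fun x => 2 * a x = 0)).2 a0) => P -> /eqP.
by rewrite mulf_eq0 pnatr_eq0 /= => /eqP ->; rewrite add0r.
Qed.

(** * The induced map on the x-line *)

Variables A D : {poly C}.
Hypothesis D_neq0 : D != 0.
Hypothesis phiX : \forall P \near cofinitely (E1 C), xc (phi P) = A.[xc P] / D.[xc P].

Lemma near_D_neq0 : \forall P \near cofinitely (E1 C), D.[xc P] != 0.
Proof. exact: (E1_near_xc (fun x => D.[x] != 0)).2 (neq0_near D_neq0). Qed.

(** Two identities between forms and polynomials in [x] that encode
    [X = A / D] and [Y ^ 2 = X ^ 3 - X]; they persist at the zeros of [D]. *)
Lemma isogeny_local_eq P0 : exists k (F0 F1 F2 : mpoly.dhomog 3 C k),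
  let v F Q := hval F (E1_coord Q) in
  let nz Q := [|| v F0 Q != 0, v F1 Q != 0 | v F2 Q != 0] in
  [/\ nz P0, forall Q, nz Q -> phi Q = None -> [/\ v F0 Q = 0, v F1 Q != 0 & v F2 Q = 0],
      forall Q, nz Q -> phi Q <> None -> [/\ v F2 Q != 0,
        v F0 Q = xc (phi Q) * v F2 Q & v F1 Q = yc (phi Q) * v F2 Q],
      forall Q, Q <> None -> v F0 Q * D.[xc Q] = v F2 Q * A.[xc Q]
    & forall Q, Q <> None -> v F1 Q ^+ 2 * D.[xc Q] ^+ 3 =
        v F2 Q ^+ 2 * (A ^+ 3 - A * D ^+ 2).[xc Q]].
Proof.
have [k [F0 [F1 [F2 [nzP nearnz phiN phiS]]]]] := isogeny_local P0.
exists k, F0, F1, F2; split=> //; apply: E1_reg_eq.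
- exact: E1_regM (E1_reg_form _) (E1_reg_poly _).
- exact: E1_regM (E1_reg_form _) (E1_reg_poly _).
- near=> Q.
  have DQ : D.[xc Q] != 0 by near: Q; exact: near_D_neq0.
  have phiQ : phi Q <> None by near: Q; exact: isogeny_near_neq.
  have XQ : xc (phi Q) = A.[xc Q] / D.[xc Q] by near: Q.
  have [|_ -> _] := phiS Q _ phiQ; first by near: Q.
  by rewrite XQ mulrAC divfK// mulrC.
- exact: E1_regM (E1_regX _ (E1_reg_form _)) (E1_regX _ (E1_reg_poly _)).
- exact: E1_regM (E1_regX _ (E1_reg_form _)) (E1_reg_poly _).
- near=> Q.
  have DQ : D.[xc Q] != 0 by near: Q; exact: near_D_neq0.
  have phiQ : phi Q <> None by near: Q; exact: isogeny_near_neq.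
  have XQ : xc (phi Q) = A.[xc Q] / D.[xc Q] by near: Q.
  have [|_ _ ->] := phiS Q _ phiQ; first by near: Q.
  rewrite exprMn yc_sqr XQ /cubic !hornerE /=; field.
  exact: DQ.
Unshelve. all: by end_near. Qed.

(** The point at infinity is fixed, so [F2] vanishes there and [F1] does not.  If
    [A / D] were finite at infinity, the left side of the identity between [F1] and
    [F2] would have the norm of larger degree. *)
Lemma isogeny_pole : (size D < size A)%N.
Proof.
have [k [F0 [F1 [F2 /= [nzN phiN _ _ e2]]]]] := isogeny_local_eq None.
have [_ F1N F2N] := phiN None nzN isogeny_None.
have [A1 [B1 [F1E /(_ F1N) s1 _]]] := E1_form_norm F1.
have [A2 [B2 [F2E _ /(_ F2N) s2]]] := E1_form_norm F2.
pose T := A ^+ 3 - A * D ^+ 2.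
have e : norm A1 B1 ^+ 2 * D ^+ 6 = norm A2 B2 ^+ 2 * T ^+ 2.
  apply: near_poly_eq; apply/(E1_near_xc (fun x => (norm A1 B1 ^+ 2 * D ^+ 6).[x] =
    (norm A2 B2 ^+ 2 * T ^+ 2).[x])).
  apply: filterS (cofinitely_neq None) => P PN.
  have oPN := E1_opp_neq0 PN.
  have := e2 P PN; have := e2 _ oPN; rewrite !F1E// !F2E// xc_opp yc_opp -/T => eo eP.
  rewrite !(hornerM, horner_exp) !normE.
  transitivity (((A1.[xc P] + yc P * B1.[xc P]) ^+ 2 * D.[xc P] ^+ 3) *
    ((A1.[xc P] + - yc P * B1.[xc P]) ^+ 2 * D.[xc P] ^+ 3)); first by ring.
  by rewrite eo eP; ring.
rewrite ltnNge; apply/negP => sAD.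
have D3 : size (D ^+ 6) = ((size D).-1 * 6)%N.+1.
  by rewrite -[LHS]prednK ?size_exp// size_poly_gt0 expf_neq0.
have N1 : size (norm A1 B1 ^+ 2) = (3 * k * 2)%N.+1.
  rewrite -[LHS]prednK ?size_exp ?s1// size_poly_gt0 expf_neq0//.
  by rewrite -size_poly_gt0 s1.
have sL : size (norm A1 B1 ^+ 2 * D ^+ 6) = (3 * k * 2 + (size D).-1 * 6)%N.+1.
  by rewrite size_mul ?N1 ?D3 ?addSn ?addnS// -size_poly_gt0 ?N1 ?D3.
have sexp (p : {poly C}) n m : (size p <= m.+1)%N -> (size (p ^+ n) <= (m * n).+1)%N.
  move=> pm; apply: leq_trans (size_poly_exp_leq _ _) _; rewrite ltnS leq_mul2r.
  by move: (size p) pm => a; lia.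
have smul (p q : {poly C}) m n : (size p <= m.+1)%N -> (size q <= n.+1)%N ->
    (size (p * q)%R <= (m + n).+1)%N.
  move=> pm qn; apply: leq_trans (size_polyMleq _ _) _.
  by move: (size p) (size q) pm qn => a b; lia.
set dl := (size D).-1.
have sD : (size D <= dl.+1)%N by rewrite leqSpred.
have sA : (size A <= dl.+1)%N by apply: leq_trans sD.
have sT : (size T <= (dl * 3).+1)%N.
  apply: leq_trans (size_polyD _ _) _; rewrite geq_max sexp//= size_polyN.
  by rewrite (_ : (dl * 3)%N = (dl + dl * 2)%N); [apply: smul => //; exact: sexp|lia].
have [k0|k0] := posnP (3 * k).
  have n20 : norm A2 B2 = 0 by apply/eqP; rewrite -size_poly_eq0 -leqn0; rewrite k0 in s2.
  by have := sL; rewrite e n20 expr0n mul0r size_poly0.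
have sN2 : (size (norm A2 B2) <= (3 * k).-1.+1)%N by rewrite prednK.
have := smul _ _ _ _ (sexp _ 2 _ sN2) (sexp _ 2 _ sT).
rewrite -e sL -/dl; lia.
Qed.

(** * The degree of the isogeny *)

Let n := (maxn (size A) (size D)).-1.

Lemma isogeny_degree_gt0 : (0 < n)%N.
Proof.
have sAD := isogeny_pole; have D0 : (0 < size D)%N by rewrite size_poly_gt0.
by rewrite /n; move: (size A) (size D) sAD D0 => a b; lia.
Qed.
Let n_gt0 := isogeny_degree_gt0.

Hypothesis AD_coprime : coprimep A D.

(** Finiteness of [X] at a point excludes the point at infinity as image, since
    [Y ^ 2 = X ^ 3 - X] would be finite too. *)
Lemma isogeny_xE P : P <> None ->
  E1_x (phi P) = if D.[xc P] == 0 then None else Some (A.[xc P] / D.[xc P]).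
Proof.
move=> PN; have [k [F0 [F1 [F2 /= [nzP phiN phiS e1 e2]]]]] := isogeny_local_eq P.
have {}e1 := e1 P PN; have {}e2 := e2 P PN.
case: eqVneq => DP.
  have AP : A.[xc P] != 0.
    by apply: (coprimep_root (p := D)); [rewrite coprimep_sym|apply/eqP].
  have F2P : hval F2 (E1_coord P) = 0.
    by apply/eqP; move/eqP: e1; rewrite DP mulr0 eq_sym mulf_eq0 (negbTE AP) orbF.
  have [->//|phiP] := pselect (phi P = None).
  by have [] := phiS P nzP phiP; rewrite F2P eqxx.
have [phiP|phiP] := pselect (phi P = None).
  have [_ F1P F2P] := phiN P nzP phiP; move/eqP: e2.
  by rewrite F2P expr0n mul0r mulf_eq0 !expf_eq0 /= (negbTE F1P) (negbTE DP).
have [F2P F0E _] := phiS P nzP phiP.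
have -> : A.[xc P] / D.[xc P] = xc (phi P).
  apply: (mulfI F2P); rewrite mulrA -e1 F0E mulfK//; exact: mulrC.
by case: (phi P) phiP => [[[x y] h]|].
Qed.

Let Z x := A.[x] / D.[x].

Lemma isogeny_cofinitely : phi @ cofinitely (E1 C) --> cofinitely (E1 C).
Proof.
apply: finite_to_one_cofinitely => Q.
have ZQ : \forall x \near cofinitely C, Z x <> xc Q.
  exact: (fibre_map_cofinitely AD_coprime n_gt0 (cofinitely_neq (xc Q))).
have : \forall P \near cofinitely (E1 C), phi P <> Q.
  apply: filterS2 phiX ((E1_near_xc (fun x => Z x <> xc Q)).2 ZQ) => P PE ZP PQ.
  by apply: ZP; rewrite -PQ PE.
by apply: sub_finite_set => P /= PQ; rewrite PQ.
Qed.

(** If [r] were zero, so would be [X ^ 3 - X], and [X] would not have a pole. *)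
Lemma isogeny_y_neq0 (r : C -> C) : ratfun r ->
  (\forall P \near cofinitely (E1 C), yc (phi P) = yc P * r (xc P)) ->
  \forall x \near cofinitely C, r x != 0.
Proof.
move=> rr yE; have [r0|//] := ratfun_dec rr.
have T0 : A ^+ 3 - A * D ^+ 2 = 0.
  apply: near_poly_eq0; apply/(E1_near_xc (fun x => (A ^+ 3 - A * D ^+ 2).[x] = 0)).
  near=> P.
  have rP : r (xc P) = 0 by near: P; exact: (E1_near_xc (fun x => r x = 0)).2 r0.
  have yP : yc (phi P) = yc P * r (xc P) by near: P.
  have xP : xc (phi P) = A.[xc P] / D.[xc P] by near: P.
  have DP : D.[xc P] != 0 by near: P; exact: near_D_neq0.
  have -> : (A ^+ 3 - A * D ^+ 2).[xc P] = D.[xc P] ^+ 3 * (cubic C).[xc (phi P)].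
    by rewrite xP /cubic !hornerE /=; field; exact: DP.
  by rewrite -yc_sqr yP rP mulr0 expr0n mulr0.
have sAD := isogeny_pole; have : A * (A - D) * (A + D) = 0 by rewrite -[RHS]T0; ring.
move/eqP; rewrite !mulf_eq0 => /orP[/orP[]|].
- by move/eqP => A0; rewrite A0 size_poly0 in sAD.
- by rewrite subr_eq0 => /eqP AD; rewrite AD ltnn in sAD.
- by rewrite addr_eq0 => /eqP AD; rewrite AD size_polyN ltnn in sAD.
Unshelve. all: by end_near. Qed.

(** The powers [x ^ i] with [i < n] form a basis of [C(x)] over [C(X)], hence of
    [C(x, y) = C(x) + Y C(x)] over [C(X, Y) = C(X) + Y C(X)]. *)
Lemma isogeny_map_degree : map_degree (@E1_coord C) (@E1_coord C) phi n.
Proof.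
have [r [rr yE]] := isogeny_y; have r0 := isogeny_y_neq0 rr yE.
exists (fun i P => xc P ^+ i); split.
- move=> i; apply: rational_E1; apply: (E1_ratfun_xc (a := fun x => x ^+ i)).
  by apply: ratfun_near (ratfun_poly 'X^i); apply: nearW => z; rewrite hornerXn.
- move=> f /E1_rational[a [b [ra rb fE]]].
  have [u [ru uE]] := fibre_span_ratfun AD_coprime n_gt0 ra.
  have [v [rv vE]] := fibre_span_ratfun AD_coprime n_gt0 (ratfunM rb (ratfunV rr)).
  exists (fun i Q => u i (xc Q) + yc Q * v i (xc Q)); split=> [i|].
    apply: rational_E1; apply: E1_ratfunD; first exact: E1_ratfun_xc.
    by apply: E1_ratfunM; [exact: E1_ratfun_yc|exact: E1_ratfun_xc].
  apply/almost_eqP; near=> P.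
  have -> : f P = a (xc P) + yc P * b (xc P) by near: P.
  have -> : xc (phi P) = Z (xc P) by near: P.
  have -> : yc (phi P) = yc P * r (xc P) by near: P.
  have -> : a (xc P) = \sum_(i < n) u i (Z (xc P)) * xc P ^+ i.
    by near: P; exact: (E1_near_xc (fun x => a x = \sum_(i < n) u i (Z x) * x ^+ i)).2 uE.
  have vP : b (xc P) * (r (xc P))^-1 = \sum_(i < n) v i (Z (xc P)) * xc P ^+ i.
    near: P.
    exact: (E1_near_xc (fun x => b x * (r x)^-1 = \sum_(i < n) v i (Z x) * x ^+ i)).2 vE.
  have rP : r (xc P) != 0 by near: P; exact: (E1_near_xc (fun x => r x != 0)).2 r0.
  have -> : b (xc P) = r (xc P) * \sum_(i < n) v i (Z (xc P)) * xc P ^+ i.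
    by rewrite -vP mulrCA divff// mulr1.
  rewrite !mulr_sumr -big_split; apply: eq_bigr => i _ /=.
  by rewrite mulrDl !mulrA.
- move=> c rc /almost_eqP cE.
  have /choice[u /choice[v uvP]] : forall i, exists u v : C -> C,
      [/\ ratfun u, ratfun v & \forall Q \near cofinitely (E1 C),
        c i Q = u (xc Q) + yc Q * v (xc Q)].
    by move=> i; exact: E1_rational.
  have uvE : \forall Q \near cofinitely (E1 C), forall i,
      c i Q = u i (xc Q) + yc Q * v i (xc Q).
    by apply: filter_forall => i; have [] := uvP i.
  have [u0 v0] : (\forall x \near cofinitely C, \sum_(i < n) u i (Z x) * x ^+ i = 0) /\
      (\forall x \near cofinitely C, r x * \sum_(i < n) v i (Z x) * x ^+ i = 0).
    apply: (E1_free (f := fun x => \sum_(i < n) u i (Z x) * x ^+ i)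
      (g := fun x => r x * \sum_(i < n) v i (Z x) * x ^+ i)).
    near=> P.
    have XP : xc (phi P) = Z (xc P) by near: P.
    have YP : yc (phi P) = yc P * r (xc P) by near: P.
    have cP : forall i, c i (phi P) = u i (xc (phi P)) + yc (phi P) * v i (xc (phi P)).
      by near: P; exact: (isogeny_cofinitely uvE).
    have c0 : \sum_(i < n) c i (phi P) * xc P ^+ i = 0 by near: P.
    rewrite -[RHS]c0 !mulr_sumr -big_split; apply: eq_bigr => i _ /=.
    by rewrite cP XP YP mulrDl !mulrA.
  have {}v0 : \forall x \near cofinitely C, \sum_(i < n) v i (Z x) * x ^+ i = 0.
    by apply: filterS2 r0 v0 => x rx /eqP; rewrite mulf_eq0 (negbTE rx) => /eqP.
  move=> i; have {}u0 := fibre_free AD_coprime n_gt0 u0 i.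
  have {}v0 := fibre_free AD_coprime n_gt0 v0 i.
  apply/almost_eqP; have [_ _ cQ] := uvP i.
  apply: filterS3 cQ ((E1_near_xc (fun x => u i x = 0)).2 u0)
    ((E1_near_xc (fun x => v i x = 0)).2 v0) => Q -> -> ->.
  by rewrite mulr0 addr0.
Unshelve. all: by end_near. Qed.

Lemma isogeny_degreeE d : map_degree (@E1_coord C) (@E1_coord C) phi d -> d = n.
Proof. by move=> hd; exact: E1_map_degree_uniq hd isogeny_map_degree. Qed.

End Isogeny.

(** * Limits *)

Section Limits.
Variable C : numClosedFieldType.
Implicit Types (p : {poly C}).

Lemma cvg_near_eq T (F : set_system T) (FF : Filter F) (f g : T -> C) (l : C) :
  (\forall t \near F, f t = g t) -> g t @[t --> F] --> l -> f t @[t --> F] --> l.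
Proof.
by move=> fg; apply: cvg_trans; apply: near_eq_cvg; apply: filterS fg => t ->.
Qed.

Lemma cvg_horner T (F : set_system T) (FF : Filter F) p (a : T -> C) x :
  a t @[t --> F] --> x -> p.[a t] @[t --> F] --> p.[x].
Proof.
move=> ax; elim/poly_ind: p => [|p c IHp].
  by under eq_cvg do rewrite horner0; rewrite horner0; exact: cvg_cst.
under eq_cvg do rewrite !hornerE; rewrite !hornerE.
by apply: cvgD; [exact: cvgM|exact: cvg_cst].
Qed.
Arguments cvg_horner {T F FF} p {a x}.

(** Both arguments may move: the limit of [isogeny_slope] compares [x (P + Q)] with
    [x (P - Q)], both close to [x (P)]. *)
Lemma divided_difference p : exists dq : C -> C -> C,
  (forall a b, p.[a] - p.[b] = (a - b) * dq a b) /\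
  forall T (F : set_system T) (FF : Filter F) (a b : T -> C) x,
    a t @[t --> F] --> x -> b t @[t --> F] --> x ->
    dq (a t) (b t) @[t --> F] --> p^`().[x].
Proof.
elim/poly_ind: p => [|p c [dq [dqE dqL]]].
  exists (fun _ _ => 0); split=> [a b|T F FF a b x _ _];
    first by rewrite !horner0 subrr mulr0.
  by rewrite deriv0 horner0; exact: cvg_cst.
exists (fun a b => p.[a] + b * dq a b); split=> [a b|T F FF a b x ax bx].
  by rewrite !hornerE mulrDr [(a - b) * (b * _)]mulrCA -dqE; ring.
have -> : (p * 'X + c%:P)^`().[x] = p.[x] + x * p^`().[x].
  by rewrite derivD derivM derivX derivC addr0 !hornerE; ring.
exact: (cvgD (cvg_horner p ax) (cvgM bx (dqL _ _ FF _ _ _ ax bx))).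
Qed.

(** The polynomial [v ^ m p (1 / v)]. *)
Definition rev_poly m p := \poly_(i < m.+1) p`_(m - i).

Lemma rev_polyE m p v : (size p <= m.+1)%N -> v != 0 ->
  (rev_poly m p).[v] = v ^+ m * p.[v^-1].
Proof.
move=> sp v0; rewrite horner_poly (horner_coef_wide _ sp) mulr_sumr.
rewrite (reindex_inj rev_ord_inj) /=; apply: eq_bigr => i _; rewrite subSS.
have im : (i <= m)%N by rewrite -ltnS.
by rewrite subKn// mulrCA exprVn -expfB_cond ?(negbTE v0).
Qed.

Lemma rev_poly0 m p : (rev_poly m p).[0] = p`_m.
Proof. by rewrite horner_coef0 coef_poly subn0. Qed.

Lemma dnbhs_cofinitely (x : C) (U : set C) :
  (\forall z \near cofinitely C, U z) -> \forall z \near x^', U z.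
Proof.
move=> /finite_seqP[s sE].
have : \forall z \near x^', z \notin s.
  elim: (s) => [|y r IHr]; first exact: nearW.
  have yn : \forall z \near x^', z != y.
    have [->|xy] := eqVneq x y; first by apply: nbhs_dnbhs_neq.
    apply: nbhs_dnbhs; near=> z; apply/negP => /eqP zy.
    have : `|x - z| < `|x - y|.
      near: z; apply: cvgr_dist_lt; first exact: cvg_id.
      by rewrite normr_gt0 subr_eq0.
    by rewrite zy ltxx.
  by apply: filterS2 yn IHr => z zy zr; rewrite inE negb_or zy.
apply: filterS => z zs; apply: contrapT => nU.
have : (~` U) z by [].
by rewrite (_ : ~` U = [set` s])//= (negbTE zs).
Unshelve. all: by end_near. Qed.

Lemma cvg0_sqr T (F : set_system T) (FF : Filter F) (f : T -> C) :
  f t ^+ 2 @[t --> F] --> 0 -> f t @[t --> F] --> 0.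
Proof.
move=> /cvgr0Pnorm_lt f2; apply/cvgr0Pnorm_lt => e e0.
apply: filterS (f2 (e ^+ 2) (exprn_gt0 _ e0)) => t.
by rewrite normrX ltr_pXn2r ?nnegrE// ltW.
Qed.

End Limits.
Arguments cvg_horner {C T F FF} p {a x}.

(** * The invariant differential *)

Section InvariantDifferential.
Variable C : numClosedFieldType.
Implicit Types (P Q : E1 C).
Variable phi : E1 C -> E1 C.
Hypothesis phi_iso : E1_isogeny phi.
Hypothesis phi_neq0 : exists P, phi P <> None.
Variables A D : {poly C}.
Hypothesis D_neq0 : D != 0.
Hypothesis AD_coprime : coprimep A D.
Hypothesis phiX : \forall P \near cofinitely (E1 C), xc (phi P) = A.[xc P] / D.[xc P].
Variable r : C -> C.
Hypothesis r_rat : ratfun r.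
Hypothesis phiY : \forall P \near cofinitely (E1 C), yc (phi P) = yc P * r (xc P).

Let xE := isogeny_xE phi_iso phi_neq0 D_neq0 phiX AD_coprime.
Let sizeAD := isogeny_pole phi_iso phi_neq0 D_neq0 phiX.
Let W := A^`() * D - A * D^`().

Let A_neq0 : A != 0.
Proof. by rewrite -size_poly_gt0 (leq_trans _ sizeAD). Qed.

Lemma isogeny_xP P : P <> None -> phi P <> None ->
  D.[xc P] != 0 /\ xc (phi P) = A.[xc P] / D.[xc P].
Proof.
move=> PN phiN; have := xE PN; case: (phi P) phiN => [[[x y] h]|//] _ /=.
by case: eqP => [//|/eqP DP [->]].
Qed.

(** In [x (P + Q) - x (P - Q)] only the cross terms of the squared slopes survive; the
    same computation applies to the images, as [phi] is additive. *)
Lemma isogeny_chord P Q : P <> None -> Q <> None -> phi P <> None -> phi Q <> None ->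
  xc P != xc Q -> xc (phi P) != xc (phi Q) ->
  let xp := xc (E1_add P Q) in let xm := xc (E1_add P (E1_opp Q)) in
  [/\ D.[xp] != 0, D.[xm] != 0,
     xp - xm = - (4 * yc P * yc Q) / (xc Q - xc P) ^+ 2 &
     A.[xp] / D.[xp] - A.[xm] / D.[xm] =
       - (4 * yc (phi P) * yc (phi Q)) / (xc (phi Q) - xc (phi P)) ^+ 2].
Proof.
move=> PN QN fPN fQN xPQ XPQ xp xm.
have x0 : xc Q - xc P != 0 by rewrite subr_eq0 eq_sym.
have X0 : xc (phi Q) - xc (phi P) != 0 by rewrite subr_eq0 eq_sym.
have [pN pE] := xc_add PN QN xPQ; have [fpN fpE] := xc_add fPN fQN XPQ.
have [mN mE] : E1_add P (E1_opp Q) <> None /\ _ :=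
  xc_add PN (E1_opp_neq0 QN) (etrans (congr1 (fun t => xc P != t) (xc_opp Q)) xPQ).
have [fmN fmE] : E1_add (phi P) (E1_opp (phi Q)) <> None /\ _ :=
  xc_add fPN (E1_opp_neq0 fQN) (etrans (congr1 (fun t => xc (phi P) != t) (xc_opp _)) XPQ).
rewrite -isogeny_opp// in fmN fmE.
rewrite -phi_iso.2 in fpN fpE; rewrite -phi_iso.2 in fmN fmE.
have [Dp Xp] := isogeny_xP pN fpN; have [Dm Xm] := isogeny_xP mN fmN.
split=> //.
  by rewrite /xp /xm pE mE xc_opp yc_opp; field.
rewrite -Xp -Xm fpE fmE isogeny_opp// xc_opp yc_opp; field; exact: X0.
Qed.

(** For a section [q] of the coordinate [x], the point [q v^-1] tends to the neutral
    element as [v] tends to [0]. *)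
Lemma near_infinity (U : set (E1 C)) (q : C -> E1 C) :
  (forall x, q x <> None /\ xc (q x) = x) ->
  (\forall Q \near cofinitely (E1 C), U Q) -> \forall v \near 0^', U (q v^-1).
Proof.
move=> qE fU; apply: dnbhs_cofinitely.
have : (fun v => q v^-1) @ cofinitely C --> cofinitely (E1 C); last exact.
apply: finite_to_one_cofinitely => Q.
apply: (sub_finite_set _ (finite_set1 (xc Q)^-1)) => v /= <-.
by rewrite (qE _).2 invrK.
Qed.

(** Letting [Q] tend to the neutral element in the difference of chords shows
    that [x'(phi P) / r(P)] is a limit that does not depend on [P]. *)
Lemma isogeny_slope P : P <> None -> yc P != 0 -> phi P <> None ->
  yc (phi P) = yc P * r (xc P) -> r (xc P) != 0 ->
  r v^-1 * (v^-1 * D.[v^-1] / A.[v^-1]) ^+ 2 @[v --> 0^'] -->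
    W.[xc P] / D.[xc P] ^+ 2 / r (xc P).
Proof.
move=> PN yP phiP YP rP; have [DP XP] := isogeny_xP PN phiP.
have /choice[q qE] := @xc_surj C.
set x1 := xc P in DP XP rP YP *; set X1 := xc (phi P) in XP *.
(* With [v = 1 / x (Q)], the quantities that tend to [0] are [v] itself,
   [w = y (Q) / x (Q) ^ 2] and [u = 1 / x (phi Q)]. *)
pose w v := yc (q v^-1) * v ^+ 2.
have v0 : \forall v \near (0 : C)^', v != 0 by exact: nbhs_dnbhs_neq.
have idv : v @[v --> (0 : C)^'] --> (0 : C) by apply: cvg_within.
have w0 : w v @[v --> 0^'] --> 0.
  apply: cvg0_sqr; have : v - v ^+ 3 @[v --> (0 : C)^'] --> (0 : C).
    have p0 : ('X - 'X^3 : {poly C}).[0] = 0 by rewrite !hornerE /=; ring.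
    rewrite -[X in _ --> X]p0.
    apply: cvg_near_eq (cvg_horner ('X - 'X^3) idv); apply: nearW => v.
    by rewrite !hornerE.
  apply: cvg_near_eq; apply: filterS v0 => v v0.
  rewrite /w exprMn yc_sqr (qE _).2 /cubic !hornerE /=; field.
  exact: v0.
pose u v := D.[v^-1] / A.[v^-1].
have u0 : u v @[v --> 0^'] --> 0.
  pose m := (size A).-1; have sA : size A = m.+1 by rewrite prednK// size_poly_gt0.
  have lA : (rev_poly m A).[0] != 0 by rewrite rev_poly0 -lead_coefE lead_coef_eq0.
  have D0 : (rev_poly m D).[0] = 0 by rewrite rev_poly0 nth_default// -ltnS -sA.
  have : (rev_poly m D).[v] / (rev_poly m A).[v] @[v --> 0^'] --> 0.
    have := cvgM (cvg_horner (rev_poly m D) idv) (cvgV lA (cvg_horner (rev_poly m A) idv)).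
    by rewrite D0 mul0r; apply.
  apply: cvg_near_eq; apply: filterS v0 => v v0.
  rewrite /= !rev_polyE// ?sA//; last by apply: leq_trans (ltnW sizeAD) _; rewrite sA.
  by rewrite -mulf_div divff ?expf_neq0// mul1r.
have lim s : (x1 + x1 ^+ 2 * v - x1 * v ^+ 2 - v + s * w v) / (1 - x1 * v) ^+ 2
    @[v --> 0^'] --> x1.
  have c1 : (x1 + x1 ^+ 2 * v - x1 * v ^+ 2 - v) @[v --> 0^'] --> x1.
    pose p := x1%:P + x1 ^+ 2 *: 'X - x1 *: 'X^2 - 'X.
    have p0 : p.[0] = x1 by rewrite /p !hornerE /=; ring.
    rewrite -[X in _ --> X]p0; apply: cvg_near_eq (cvg_horner p idv); apply: nearW => v.
    by rewrite /p !hornerE.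
  have c2 : (1 - x1 * v) ^+ 2 @[v --> 0^'] --> (1 : C).
    pose p := (1 - x1 *: 'X) ^+ 2.
    have p0 : p.[0] = 1 by rewrite /p !hornerE /=; ring.
    rewrite -[X in _ --> X]p0; apply: cvg_near_eq (cvg_horner p idv); apply: nearW => v.
    by rewrite /p !hornerE.
  have := cvgM (cvgD c1 (cvgM (cvg_cst s) w0)) (cvgV (oner_neq0 C) c2).
  by rewrite mulr0 addr0 invr1 mulr1; apply.
have [dA [dAE dAL]] := divided_difference A; have [dD [dDE dDL]] := divided_difference D.
pose dd a b := dA a b * D.[b] - A.[b] * dD a b.
have ddE a b : D.[a] != 0 -> D.[b] != 0 ->
    A.[a] / D.[a] - A.[b] / D.[b] = (a - b) * dd a b / (D.[a] * D.[b]).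
  move=> Da Db; rewrite /dd mulrBr mulrA -dAE [(a - b) * (_ * _)]mulrCA -dDE.
  by field; rewrite Da Db.
(* [x (P + Q)] and [x (P - Q)], where the equation of the curve has removed the
   terms that diverge. *)
pose xp v := (x1 + x1 ^+ 2 * v - x1 * v ^+ 2 - v + (- 2 * yc P) * w v) / (1 - x1 * v) ^+ 2.
pose xm v := (x1 + x1 ^+ 2 * v - x1 * v ^+ 2 - v + (2 * yc P) * w v) / (1 - x1 * v) ^+ 2.
have xpL : xp v @[v --> 0^'] --> x1 by exact: lim.
have xmL : xm v @[v --> 0^'] --> x1 by exact: lim.
have ddL : dd (xp v) (xm v) @[v --> 0^'] --> W.[x1].
  rewrite /W hornerD hornerN !hornerM; apply: cvgB.
    exact: cvgM (dAL _ _ _ _ _ _ xpL xmL) (cvg_horner D xmL).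
  exact: cvgM (cvg_horner A xmL) (dDL _ _ _ _ _ _ xpL xmL).
have : dd (xp v) (xm v) / (D.[xp v] * D.[xm v]) / r x1 *
    ((1 - X1 * u v) / (1 - x1 * v)) ^+ 2 @[v --> 0^'] --> W.[x1] / D.[x1] ^+ 2 / r x1.
  have c1 : dd (xp v) (xm v) / (D.[xp v] * D.[xm v]) @[v --> 0^'] -->
      W.[x1] / (D.[x1] * D.[x1]).
    exact: cvgM ddL (cvgV (mulf_neq0 DP DP) (cvgM (cvg_horner D xpL) (cvg_horner D xmL))).
  have c2 : dd (xp v) (xm v) / (D.[xp v] * D.[xm v]) / r x1 @[v --> 0^'] -->
      W.[x1] / (D.[x1] * D.[x1]) / r x1.
    exact: cvgM c1 (cvg_cst (r x1)^-1).
  have c3 : 1 - X1 * u v @[v --> 0^'] --> (1 : C).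
    have := cvgB (cvg_cst (1 : C)) (cvgM (cvg_cst X1) u0).
    by rewrite mulr0 subr0; apply.
  have c4 : 1 - x1 * v @[v --> 0^'] --> (1 : C).
    have := cvgB (cvg_cst (1 : C)) (cvgM (cvg_cst x1) idv).
    by rewrite mulr0 subr0; apply.
  have c5 : (1 - X1 * u v) / (1 - x1 * v) @[v --> 0^'] --> 1 / (1 : C).
    exact: cvgM c3 (cvgV (oner_neq0 C) c4).
  have := cvgM c2 (cvgM c5 c5).
  by rewrite invr1 !mulr1 -expr2; apply.
apply: cvg_near_eq; near=> v.
have v_neq0 : v != 0 by near: v.
have xq : xc (q v^-1) = v^-1 by exact: (qE _).2.
have phiQ : phi (q v^-1) <> None.
  near: v; apply: (near_infinity (U := fun Q => phi Q <> None) qE).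
  exact: isogeny_near_neq phi_iso phi_neq0.
have yQ : yc (q v^-1) != 0.
  by near: v; exact: (near_infinity (U := fun Q => yc Q != 0) qE (@near_yc_neq0 C)).
have YQ : yc (phi (q v^-1)) = yc (q v^-1) * r (xc (q v^-1)).
  by near: v; exact: (near_infinity (U := fun Q => yc (phi Q) = yc Q * r (xc Q)) qE phiY).
have AQ : A.[xc (q v^-1)] != 0.
  near: v; apply: (near_infinity (U := fun Q => A.[xc Q] != 0) qE).
  exact: (E1_near_xc (fun x => A.[x] != 0)).2 (neq0_near A_neq0).
have xPQ : x1 != xc (q v^-1).
  near: v; apply: (near_infinity (U := fun Q => x1 != xc Q) qE).
  apply: (E1_near_xc (fun x => x1 != x)).2; apply: filterS (cofinitely_neq x1) => x xx.
  by rewrite eq_sym; apply/eqP.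
have XPQ : X1 != A.[xc (q v^-1)] / D.[xc (q v^-1)].
  near: v; apply: (near_infinity (U := fun Q => X1 != A.[xc Q] / D.[xc Q]) qE).
  apply: (E1_near_xc (fun x => X1 != A.[x] / D.[x])).2.
  have h : \forall x \near cofinitely C, A.[x] / D.[x] <> X1.
    exact: (fibre_map_cofinitely AD_coprime
      (isogeny_degree_gt0 phi_iso phi_neq0 D_neq0 phiX) (cofinitely_neq X1)).
  by apply: filterS h => x xx; rewrite eq_sym; apply/eqP.
rewrite xq in YQ AQ xPQ XPQ.
set Q := q v^-1 in phiQ yQ YQ; have [QN xQ] : Q <> None /\ xc Q = v^-1 by exact: qE.
have [DQ XQ] := isogeny_xP QN phiQ; rewrite xQ in DQ XQ.
have xPQ' : xc P != xc Q by rewrite xQ.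
have XPQ' : xc (phi P) != xc (phi Q) by rewrite XQ.
have /= := isogeny_chord PN QN phiP phiQ xPQ' XPQ'.
have n1 : 1 - x1 * v != 0.
  apply: contraNneq xPQ => /subr0_eq e; apply/eqP.
  by apply: (mulIf v_neq0); rewrite -e mulVf.
have x12 : v^-1 - x1 != 0 by rewrite subr_eq0 eq_sym.
have [mN mE] := xc_add PN (E1_opp_neq0 QN)
  (etrans (congr1 (fun t => xc P != t) (xc_opp Q)) xPQ').
have [pN pE] := xc_add PN QN xPQ'.
have wE : yc Q ^+ 2 = v^-1 ^+ 3 - v^-1 by rewrite yc_sqr xQ /cubic !hornerE.
have yPE : yc P ^+ 2 = x1 ^+ 3 - x1 by rewrite yc_sqr /cubic !hornerE.
have xpE : xc (E1_add P Q) = xp v.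
  rewrite pE xQ -/x1 /xp /w -/Q expr_div_n sqrrB wE yPE.
  by field; rewrite v_neq0 n1.
have xmE : xc (E1_add P (E1_opp Q)) = xm v.
  rewrite mE xc_opp yc_opp xQ -/x1 /xm /w -/Q expr_div_n sqrrB sqrrN wE yPE.
  by field; rewrite v_neq0 n1.
rewrite xpE xmE xQ -/x1 XQ -/X1 YQ YP => -[Dp Dm xpm].
rewrite ddE// xpm => e.
have X12 : A.[v^-1] / D.[v^-1] - X1 != 0 by rewrite subr_eq0 eq_sym.
have {}e : dd (xp v) (xm v) / (D.[xp v] * D.[xm v]) =
    r x1 * r v^-1 * ((v^-1 - x1) / (A.[v^-1] / D.[v^-1] - X1)) ^+ 2.
  have c0 : - (4 * yc P * yc Q) / (v^-1 - x1) ^+ 2 != 0.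
    by rewrite mulf_neq0 ?oppr_eq0 ?mulf_neq0 ?invr_eq0 ?expf_neq0 ?pnatr_eq0.
  apply: (mulfI c0); rewrite mulrA e expr_div_n.
  move: (v^-1 - x1) x12 (_ - X1) X12 => s s0 t t0; field.
  by rewrite s0 t0.
have X12' : A.[v^-1] - X1 * D.[v^-1] != 0.
  by apply: contraNneq XPQ => /subr0_eq ->; rewrite mulfK.
rewrite e -/x1 /u; field.
by rewrite -mulNr in X12'; rewrite v_neq0 n1 DQ AQ rP X12'.
Unshelve. all: by end_near. Qed.

(** The limit in [isogeny_slope] is a constant [c], so [W / D ^ 2 = c r]; squaring
    and multiplying by [y ^ 2 = x ^ 3 - x] eliminates [r].  Since [X] is not
    constant, [c] is not zero. *)
Lemma isogeny_ode : exists2 c : C, c != 0 &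
  W ^+ 2 * cubic C = c ^+ 2 *: (D * (A ^+ 3 - A * D ^+ 2)).
Proof.
have r0 := isogeny_y_neq0 phi_iso phi_neq0 D_neq0 phiX r_rat phiY.
pose good P := [/\ P <> None, yc P != 0, phi P <> None,
  yc (phi P) = yc P * r (xc P) & r (xc P) != 0].
have fgood : \forall P \near cofinitely (E1 C), good P.
  near=> P; split; near: P.
  - exact: cofinitely_neq.
  - exact: near_yc_neq0.
  - exact: isogeny_near_neq.
  - exact: phiY.
  - exact: (E1_near_xc (fun x => r x != 0)).2 r0.
have [P0 [P0N yP0 phiP0 YP0 rP0]] := filter_ex fgood.
pose c := W.[xc P0] / D.[xc P0] ^+ 2 / r (xc P0); exists c; last first.
  apply: near_poly_eq.
  apply/(E1_near_xc (fun x => (W ^+ 2 * cubic C).[x] =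
    (c ^+ 2 *: (D * (A ^+ 3 - A * D ^+ 2))).[x])).
  apply: filterS fgood => P [PN yP phiP YP rP].
  have [DP XP] := isogeny_xP PN phiP.
  have cE : W.[xc P] / D.[xc P] ^+ 2 / r (xc P) = c.
    exact: norm_cvg_unique (isogeny_slope PN yP phiP YP rP)
      (isogeny_slope P0N yP0 phiP0 YP0 rP0).
  have WE : W.[xc P] = c * r (xc P) * D.[xc P] ^+ 2 by rewrite -cE; field; rewrite rP DP.
  have -> : (c ^+ 2 *: (D * (A ^+ 3 - A * D ^+ 2))).[xc P] =
      c ^+ 2 * D.[xc P] ^+ 4 * (cubic C).[xc (phi P)].
    by rewrite XP /cubic !hornerE /=; field; exact: DP.
  by rewrite hornerM -!yc_sqr YP horner_exp WE; ring.
apply: contraTneq (wronskian_neq0 AD_coprime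
  (isogeny_degree_gt0 phi_iso phi_neq0 D_neq0 phiX)) => c0.
rewrite negbK; apply/eqP/near_poly_eq0/(E1_near_xc (fun x => W.[x] = 0)).
apply: filterS fgood => P [PN yP phiP YP rP]; have [DP XP] := isogeny_xP PN phiP.
have /eqP : W.[xc P] / D.[xc P] ^+ 2 / r (xc P) = c.
  exact: norm_cvg_unique (isogeny_slope PN yP phiP YP rP)
    (isogeny_slope P0N yP0 phiP0 YP0 rP0).
by rewrite c0 !mulf_eq0 !invr_eq0 expf_eq0 /= (negbTE DP) (negbTE rP) !orbF => /eqP.
Unshelve. all: by end_near. Qed.

End InvariantDifferential.

(** * Top coefficients *)

Section Tops.
Variable C : numClosedFieldType.
Implicit Types (p q : {poly C}) (a b : nat) (s t : C).

(** The value [t] may be zero, so that these facts can be multiplied and added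
    without knowing the exact degrees. *)
Definition top p a t := (size p <= a.+1)%N /\ p`_a = t.

Lemma top_lead p : top p (size p).-1 (lead_coef p).
Proof. by split; rewrite ?leqSpred. Qed.

Lemma top_eq p q a s t : top p a s -> top q a t -> p = q -> s = t.
Proof. by move=> [_ <-] [_ <-] ->. Qed.

Lemma top_size p a t : top p a t -> t != 0 -> size p = a.+1.
Proof.
move=> [sp <-] pa; apply/eqP; rewrite eqn_leq sp ltnNge.
by apply: contra pa => /leq_sizeP ->.
Qed.

Lemma topM p q a b s t : top p a s -> top q b t -> top (p * q) (a + b) (s * t).
Proof.
move=> [sp <-] [sq <-]; split.
  apply: leq_trans (size_polyMleq _ _) _.
  by move: (size p) (size q) sp sq => m n; lia.
rewrite coefM (bigD1 (inord a)) //= inordK ?ltnS ?leq_addr// addKn big1 ?addr0//.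
move=> i ia; have [ai|ai|ai] := ltngtP i a.
- by rewrite [q`__]nth_default ?mulr0// (leq_trans sq)// ltn_subRL; lia.
- by rewrite nth_default ?mul0r// (leq_trans sp).
- by case/eqP: ia; apply: val_inj; rewrite /= inordK ?ltnS ?leq_addr.
Qed.

Lemma topD p q a s t : top p a s -> top q a t -> top (p + q) a (s + t).
Proof.
move=> [sp <-] [sq <-]; split; last by rewrite coefD.
by rewrite (leq_trans (size_polyD _ _))// geq_max sp.
Qed.

Lemma topN p a t : top p a t -> top (- p) a (- t).
Proof. by move=> [sp <-]; split; rewrite ?size_polyN ?coefN. Qed.

Lemma topB p q a s t : top p a s -> top q a t -> top (p - q) a (s - t).
Proof. by move=> tp tq; apply: topD => //; apply: topN. Qed.

Lemma topZ c p a t : top p a t -> top (c *: p) a (c * t).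
Proof.
by move=> [sp <-]; split; rewrite ?coefZ// (leq_trans (size_scale_leq _ _)).
Qed.

Lemma top_lt p a b t : top p a t -> (a < b)%N -> top p b 0.
Proof.
move=> [sp _] ab; split; first by rewrite (leq_trans sp)// ltnW.
by rewrite nth_default// (leq_trans sp).
Qed.

Lemma topE p n a t : top p n t -> n = a -> top p a t.
Proof. by move=> ? <-. Qed.

Lemma topX : top 'X 1 1.
Proof. by split; rewrite ?size_polyX ?coefX. Qed.

Lemma top_exp p a t n : top p a t -> top (p ^+ n) (a * n) (t ^+ n).
Proof.
move=> tp; elim: n => [|n IHn]; first by rewrite muln0; split; rewrite ?size_poly1 ?coef1.
by rewrite mulnS !exprS; apply: topM.
Qed.

Lemma top_cubic : top (cubic C) 3 1.
Proof. by split; rewrite ?size_cubic// coefB coefXn coefX subr0. Qed.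

Lemma coef_euler p i : ('X * p^`())`_i = i%:R * p`_i.
Proof. by rewrite coefXM; case: i => [|i]; rewrite ?mul0r// coef_deriv mulr_natl. Qed.

Lemma top_euler p a t : top p a t -> top ('X * p^`()) a (a%:R * t).
Proof.
move=> [sp <-]; split; last exact: coef_euler.
by apply: size_coef_le => i ai; rewrite coef_euler nth_default ?mulr0// (leq_trans sp).
Qed.

Definition flip p := p \Po (- 'X).

Lemma flipE p x : (flip p).[x] = p.[- x].
Proof. by rewrite horner_comp !hornerE. Qed.

Lemma coef_flip p i : (flip p)`_i = (-1) ^+ i * p`_i.
Proof.
elim/poly_ind: p i => [|p c IHp] i; first by rewrite /flip comp_poly0 coef0 mulr0.
rewrite /flip comp_poly_MXaddC coefD coefC mulrN coefN coefMX coefD coefC coefMX.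
case: i => [|i] /=; first by rewrite oppr0 !add0r mul1r.
by rewrite !addr0 -/(flip p) IHp exprS mulN1r mulNr.
Qed.

Lemma top_flip p a t : top p a t -> top (flip p) a ((-1) ^+ a * t).
Proof.
move=> [sp <-]; split; last exact: coef_flip.
by apply: size_coef_le => i ai; rewrite coef_flip nth_default ?mulr0// (leq_trans sp).
Qed.

(** The numerator of the derivative of [p / q]. *)
Definition wronsk p q := p^`() * q - p * q^`().

Lemma top_wronsk p q a b s t : top p a s -> top q b t ->
  top ('X * wronsk p q) (a + b) ((a%:R - b%:R) * (s * t)).
Proof.
move=> tp tq; have -> : 'X * wronsk p q = ('X * p^`()) * q - p * ('X * q^`()).
  by rewrite /wronsk; ring.
rewrite mulrBl [a%:R * (s * t)]mulrA [b%:R * (s * t)]mulrCA.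
by apply: topB; apply: topM => //; apply: top_euler.
Qed.

End Tops.

(** * The solution of the differential equation is odd *)

Section OddSolution.
Variable C : numClosedFieldType.
Variables (A D : {poly C}) (c : C).
Hypothesis D_neq0 : D != 0.
Hypothesis sizeAD : (size D < size A)%N.
Hypothesis c_neq0 : c != 0.
Hypothesis ode : wronsk A D ^+ 2 * cubic C = c ^+ 2 *: (D * (A ^+ 3 - A * D ^+ 2)).

Let lA := lead_coef A.
Let lD := lead_coef D.

Let A_neq0 : A != 0.
Proof. by rewrite -size_poly_gt0 (leq_trans _ sizeAD). Qed.
Let lA0 : lA != 0. Proof. by rewrite lead_coef_eq0. Qed.
Let lD0 : lD != 0. Proof. by rewrite lead_coef_eq0. Qed.

(** At infinity the equation reads [X' ^ 2 x ^ 3 ~ c ^ 2 X ^ 3], whence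
    [X ~ x / c ^ 2]. *)
Lemma ode_degree : size A = (size D).+1 /\ lD = c ^+ 2 * lA.
Proof.
have tA := top_lead A; have tD := top_lead D; rewrite -/lA -/lD in tA tD.
have sA : size A = (size A).-1.+1 by rewrite prednK// size_poly_gt0.
have sD : size D = (size D).-1.+1 by rewrite prednK// size_poly_gt0.
move: sA sD tA tD; set a := (size A).-1; set d := (size D).-1 => sA sD tA tD.
have da : (d < a)%N by rewrite -ltnS -sA -sD.
have tL := topM (top_exp 2 (top_wronsk tA tD)) (top_cubic C).
have tR0 : top (A ^+ 3 - A * D ^+ 2) (a * 3) (lA ^+ 3).
  rewrite -[lA ^+ 3]subr0; apply: topB; first exact: top_exp.
  by apply: top_lt (topM tA (top_exp 2 tD)) _; lia.
have tR := topZ (c ^+ 2) (topM (top_exp 2 (topX C)) (topM tD tR0)).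
have e : ('X * wronsk A D) ^+ 2 * cubic C =
  c ^+ 2 *: ('X ^+ 2 * (D * (A ^+ 3 - A * D ^+ 2))).
  by rewrite exprMn -mulrA ode -scalerAr.
have tL0 : ((a%:R - d%:R) * (lA * lD)) ^+ 2 * 1 != 0 :> C.
  rewrite mulr1 expf_neq0// !mulf_neq0// subr_eq0 eqr_nat.
  by rewrite gtn_eqF.
have tR1 : c ^+ 2 * (1 ^+ 2 * (lD * lA ^+ 3)) != 0.
  by rewrite !mulf_neq0 ?expf_neq0 ?oner_neq0.
have := top_size tL tL0; rewrite e (top_size tR tR1) => - [] deg.
have ad : a = d.+1 by lia.
split; first by rewrite sA sD ad.
have := top_eq (topE tL (esym deg)) tR e.
have -> : a%:R - d%:R = 1 :> C by rewrite ad -natr1 addrAC subrr add0r.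
rewrite expr1n !mul1r mulr1 => eq2; apply: (mulfI (mulf_neq0 lD0 (expf_neq0 2 lA0))).
by transitivity ((lA * lD) ^+ 2); [ring|rewrite eq2; ring].
Qed.

(** Both [X = A / D] and [X~ = - X (- x)] solve the differential equation and are
    equivalent to [x / c ^ 2].  Subtracting the two equations gives
    [(X - X~)' (X + X~)' (x ^ 3 - x) = c ^ 2 (X - X~) (X ^ 2 + X X~ + X~ ^ 2 - 1)],
    so a non-zero difference of order [x ^ e] would satisfy [2 e = 3]. *)
Lemma ode_odd : A * flip D + flip A * D = 0.
Proof.
have [sAD lDA] := ode_degree.
have tA := top_lead A; have tD := top_lead D; rewrite sAD /= -/lA -/lD in tA tD.
have sD : size D = (size D).-1.+1 by rewrite prednK// size_poly_gt0.
rewrite {1}sD in tA; move: tA tD; set d := (size D).-1 => tA tD.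
have tD' := top_flip tD; have tA' := topN (top_flip tA).
move: tD' tA'; set eps := (-1) ^+ d; rewrite exprS -/eps mulN1r mulNr opprK => tD' tA'.
have eps2 : eps ^+ 2 = 1 by rewrite -exprM mulnC exprM sqrrN expr1n expr1n.
pose At := - flip A; pose Dt := flip D; pose E := D * Dt.
rewrite -/At -/Dt in tA' tD'.
have ode' : wronsk At Dt ^+ 2 * cubic C = c ^+ 2 *: (Dt * (At ^+ 3 - At * Dt ^+ 2)).
  have dflip p : (flip p)^`() = - flip p^`().
    by rewrite /flip deriv_comp derivN derivX mulrN1.
  apply: near_poly_eq; apply: nearW => x.
  have := congr1 (horner^~ (- x)) ode.
  rewrite /wronsk /At /Dt derivN !dflip /cubic.
  rewrite !(hornerM, hornerZ, hornerD, hornerN, horner_exp, flipE, hornerX, hornerXn) => e.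
  transitivity (- ((A^`().[- x] * D.[- x] - A.[- x] * D^`().[- x]) ^+ 2 *
    ((- x) ^+ 3 - - x))).
    by ring.
  by rewrite e; ring.
(* [U / E], [S / E] and [B / E ^ 2] are the difference of the two solutions, their
   sum, and the last factor of the equation for the difference. *)
pose U := A * Dt - At * D; pose S := A * Dt + At * D.
pose B := (A * Dt) ^+ 2 + A * Dt * (At * D) + (At * D) ^+ 2 - E ^+ 2.
suff : U = 0 by rewrite /U /At mulNr opprK.
apply/eqP; apply: contraT => U0.
have key : wronsk U E * wronsk S E * cubic C = c ^+ 2 *: (U * E * B).
  have -> : wronsk U E = wronsk A D * Dt ^+ 2 - wronsk At Dt * D ^+ 2.
    by rewrite /wronsk /U /E !(derivB, derivD, derivM); ring.
  have -> : wronsk S E = wronsk A D * Dt ^+ 2 + wronsk At Dt * D ^+ 2.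
    by rewrite /wronsk /S /E !(derivB, derivD, derivM); ring.
  transitivity (wronsk A D ^+ 2 * cubic C * Dt ^+ 4 - wronsk At Dt ^+ 2 * cubic C * D ^+ 4).
    by ring.
  by rewrite ode ode' -!mul_polyC /B /U /E; ring.
have tE : top E (d + d) (lD * (eps * lD)) by exact: topM.
have tS : top S (d.+1 + d) (lA * (eps * lD) + (eps * lA) * lD).
  exact: topD (topM tA tD') (topM tA' tD).
have tAD := topM tA tD'; have tAD' := topM tA' tD.
have tB : top B ((d.+1 + d) * 2) (3 * lA ^+ 2 * lD ^+ 2).
  have -> : 3 * lA ^+ 2 * lD ^+ 2 = (lA * (eps * lD)) ^+ 2 +
      (lA * (eps * lD)) * ((eps * lA) * lD) + ((eps * lA) * lD) ^+ 2 - 0.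
    rewrite subr0 !exprMn eps2; transitivity ((2 + eps ^+ 2) * lA ^+ 2 * lD ^+ 2);
      last by ring.
    by rewrite eps2; ring.
  apply: topB; last by apply: top_lt (top_exp 2 tE) _; lia.
  by apply: topD (top_exp 2 tAD'); apply: topD (top_exp 2 tAD) _; rewrite muln2 -addnn;
    exact: topM.
pose u := (size U).-1; pose lU := lead_coef U.
have tU : top U u lU := top_lead U.
have tL := topM (topM (top_wronsk tU tE) (top_wronsk tS tE)) (top_cubic C).
have tR := topZ (c ^+ 2) (topM (top_exp 2 (topX C)) (topM (topM tU tE) tB)).
have key' : 'X * wronsk U E * ('X * wronsk S E) * cubic C =
    c ^+ 2 *: ('X ^+ 2 * (U * E * B)).
  by rewrite scalerAr -key; ring.
have tR' := topE (a := u + (d + d) + (d.+1 + d + (d + d)) + 3) tR _.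
have {tR'} h := top_eq tL (tR' ltac:(lia)) key'.
have {}h : (u%:R - (d + d)%:R) * 2 = 3 :> C.
  have eps0 : eps != 0 by rewrite -sqrf_eq0 eps2 oner_eq0.
  have lU0 : lU != 0 by rewrite lead_coef_eq0.
  apply: (mulfI (mulf_neq0 (mulf_neq0 (mulf_neq0 lU0 lA0) (expf_neq0 5 lD0)) eps0)).
  transitivity (c ^+ 2 * (1 ^+ 2 * (lU * (lD * (eps * lD)) * (3 * lA ^+ 2 * lD ^+ 2)))).
    rewrite -h; have -> : (d.+1 + d)%:R - (d + d)%:R = 1 :> C.
      by rewrite addSn -natr1 addrAC subrr add0r.
    transitivity ((u%:R - (d + d)%:R) * 2 * lU * lA * lD ^+ 5 * eps * eps ^+ 2);
      last by ring.
    by rewrite eps2; ring.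
  transitivity (3 * (c ^+ 2 * lA) * lU * lA * lD ^+ 4 * eps); first by ring.
  by rewrite -lDA; ring.
have : (u * 2 = 3 + (d + d) * 2)%N.
  apply/eqP; rewrite -(eqr_nat C) natrD !natrM -h; apply/eqP; ring.
lia.
Qed.

End OddSolution.

(** * Odd ratios of polynomials *)

Section OddRatio.
Variable C : numClosedFieldType.
Implicit Types (A D p q : {poly C}).

Lemma parity_even p : (forall i, odd i -> p`_i = 0) -> p = even_poly p \Po 'X^2.
Proof.
move=> p0; apply/polyP => i; rewrite coef_comp_poly_Xn// coef_even_poly dvdn2.
case: ifP => [oi|/negbT]; last by rewrite negbK => /p0.
by rewrite divn2 even_halfK.
Qed.

Lemma parity_odd p : (forall i, ~~ odd i -> p`_i = 0) -> p = 'X * (odd_poly p \Po 'X^2).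
Proof.
move=> p0; apply/polyP => i; rewrite coefXM; case: i => [|i] /=; first exact: p0.
rewrite coef_comp_poly_Xn// coef_odd_poly dvdn2.
case: ifP => [oi|]; last by move=> oi; apply: p0; rewrite /= oi.
by rewrite divn2 even_halfK.
Qed.

(** By coprimality [A] divides [A (- x)]; the degrees agree, and the quotient is
    read off the leading coefficients. *)
Lemma flip_ratio A D : coprimep A D -> A != 0 -> A * flip D + flip A * D = 0 ->
  flip A = (-1) ^+ (size A).-1 *: A /\ flip D = (-1) ^+ (size A) *: D.
Proof.
move=> AD A0 e.
have e' : flip A * D = - (A * flip D) by apply/eqP; rewrite -addr_eq0 addrC e.
have A_dvd : A %| flip A by rewrite -(Gauss_dvdpl _ AD) e' dvdpNr dvdp_mulr.
have [k k0 kE] : exists2 k : C, k != 0 & flip A = k *: A.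
  have : A %= flip A.
    by rewrite -dvdp_size_eqp// /flip size_comp_poly2// size_polyN size_polyX.
  by rewrite eqp_sym => /eqpf_eq.
have kV : k = (-1) ^+ (size A).-1.
  have := congr1 (fun p : {poly C} => p`_(size A).-1) kE.
  by rewrite coef_flip coefZ -lead_coefE => /mulIf ->//; rewrite lead_coef_eq0.
split; first by rewrite kE kV.
apply: (mulfI A0); rewrite -[LHS]opprK -e' kE -!scalerAr -scalerAl -scaleNr kV;
  congr (_ *: _).
by rewrite -[in RHS](prednK (_ : 0 < size A)%N) ?size_poly_gt0// exprS mulN1r.
Qed.

(** [A / D] is odd exactly when [A] and [D] have opposite parities; multiplying
    both by [f = 1] or [f = x] makes the denominator even. *)
Lemma odd_ratio A D : coprimep A D -> D != 0 -> size A = (size D).+1 ->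
    A * flip D + flip A * D = 0 ->
  exists p q m f, [/\ f = 1 \/ (f = 'X /\ D.[0] = 0),
    f * A = 'X * (p \Po 'X^2), f * D = q \Po 'X^2,
    top p m (lead_coef A) /\ top q m (lead_coef D) &
    (size A).-1 = (if f == 1%R then m.*2.+1 else m.*2)].
Proof.
move=> AD D0 sAD e.
have A0 : A != 0 by rewrite -size_poly_gt0 sAD.
have [fA fD] := flip_ratio AD A0 e.
have par (p : {poly C}) (b : bool) : flip p = (-1) ^+ b *: p ->
  forall i, odd i != b -> p`_i = 0.
  move=> fp i ib; have := congr1 (fun p : {poly C} => p`_i) fp.
  rewrite coef_flip coefZ -signr_odd; case: (odd i) b ib {fp} => -[]//= _.
    by rewrite expr1 expr0 mul1r mulN1r => /eqP; rewrite eqNr => /eqP.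
  by rewrite expr1 expr0 mul1r mulN1r => /esym/eqP; rewrite eqNr => /eqP.
have sA : size A = (size A).-1.+1 by rewrite sAD.
have sD : size D = (size A).-1 by rewrite sAD.
rewrite -signr_odd in fA; rewrite sA -signr_odd /= in fD.
have lAE : lead_coef A = A`_(size A).-1 by [].
have lDE : lead_coef D = D`_(size A).-2 by rewrite lead_coefE sD.
have D1 : (0 < size D)%N by rewrite size_poly_gt0.
move: sA sD fA fD lAE lDE; set a := (size A).-1 => sA sD.
case oa : (odd a) => fA fD lAE lDE.
- exists (odd_poly A), (even_poly D), a./2, 1; rewrite eqxx; split.
  + by left.
  + by rewrite mul1r -parity_odd// => i oi; apply: (par _ _ fA); rewrite (negbTE oi).
  + by rewrite mul1r -parity_even// => i oi; apply: (par _ _ fD); rewrite oi.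
  + split; split.
    * apply: size_coef_le => i i1; rewrite coef_odd_poly nth_default// sA; lia.
    * by rewrite coef_odd_poly lAE; congr (A`_ _); lia.
    * apply: size_coef_le => i i1; rewrite coef_even_poly nth_default// sD; lia.
    * by rewrite coef_even_poly lDE; congr (D`_ _); lia.
  + lia.
- exists (even_poly A), ('X * odd_poly D), a./2, 'X.
  have -> : ('X == 1 :> {poly C}) = false.
    apply/negbTE/negP => /eqP /(congr1 (fun p : {poly C} => size p)).
    by rewrite size_polyX size_poly1.
  have DE : D = 'X * (odd_poly D \Po 'X^2).
    by apply: parity_odd => i oi; apply: (par _ _ fD); rewrite (negbTE oi).
  split.
  + by right; split=> //; rewrite DE !hornerE.
  + by rewrite -parity_even// => i oi; apply: (par _ _ fA); rewrite oi.
  + by rewrite {1}DE comp_polyM comp_polyX; ring.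
  + split; split.
    * apply: size_coef_le => i i1; rewrite coef_even_poly nth_default// sA; lia.
    * by rewrite coef_even_poly lAE; congr (A`_ _); lia.
    * apply: size_coef_le => -[|i] i1;
      rewrite coefXM//= coef_odd_poly nth_default// sD; lia.
    * rewrite coefXM lDE; have -> : (a./2 == 0)%N = false by lia.
      by rewrite coef_odd_poly; congr (D`_ _); lia.
  + lia.
Qed.

End OddRatio.

(** * The differential equation in [z = 1 / x ^ 2] *)

Section EvenReduction.
Variable C : numClosedFieldType.
Variables (A D p q f : {poly C}) (m : nat) (c : C).
Hypothesis AD_coprime : coprimep A D.
Hypothesis D_neq0 : D != 0.
Hypothesis A_neq0 : A != 0.
Hypothesis ode : wronsk A D ^+ 2 * cubic C = c ^+ 2 *: (D * (A ^+ 3 - A * D ^+ 2)).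
Hypothesis fP : f = 1 \/ (f = 'X /\ D.[0] = 0).
Hypothesis fA : f * A = 'X * (p \Po 'X^2).
Hypothesis fD : f * D = q \Po 'X^2.
Hypothesis top_p : top p m (lead_coef A).
Hypothesis top_q : top q m (lead_coef D).
Hypothesis deg_A : (size A).-1 = (if f == 1%R then m.*2.+1 else m.*2).

Let P := rev_poly m p.
Let Q := rev_poly m q.

Lemma factor_neq0 x : D.[x] != 0 -> f.[x] != 0.
Proof.
case: fP => [->|[-> D0]]; first by rewrite hornerC oner_eq0.
by rewrite hornerX; apply: contraNneq => ->; rewrite D0.
Qed.

Lemma p_sqr x : x * p.[x ^+ 2] = f.[x] * A.[x].
Proof.
by have := congr1 (horner^~ x) fA; rewrite !hornerM horner_comp hornerX hornerXn.
Qed.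

Lemma q_sqr x : q.[x ^+ 2] = f.[x] * D.[x].
Proof. by have := congr1 (horner^~ x) fD; rewrite hornerM horner_comp hornerXn. Qed.

Lemma q_sqr_eq0 x : (q.[x ^+ 2] == 0) = (D.[x] == 0).
Proof.
rewrite q_sqr mulf_eq0; case: (eqVneq D.[x] 0) => [_|/factor_neq0/negbTE ->]//.
by rewrite orbT.
Qed.

Lemma ratio_sqr x : D.[x] != 0 -> A.[x] / D.[x] = x * (p.[x ^+ 2] / q.[x ^+ 2]).
Proof.
move=> Dx; rewrite mulrA p_sqr q_sqr -mulf_div divff ?mul1r//; exact: factor_neq0.
Qed.

(** A common root [s] of [p] and [q] would make the square roots of [s] common roots
    of [A] and [D]; when [f = x] the root [s = 0] is excluded by [p (0) = A (0)]. *)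
Lemma even_coprime : coprimep p q.
Proof.
apply: Pdiv.ClosedField.root_coprimep => s /rootP ps.
have sE : sqrtC s ^+ 2 = s by rewrite sqrtCK.
rewrite -sE q_sqr_eq0; apply: (coprimep_root AD_coprime); apply/rootP.
have := p_sqr (sqrtC s); rewrite sE ps mulr0 => /esym/eqP.
rewrite mulf_eq0 => /orP[f0|/eqP//].
case: fP => [fE|[fE D0]]; first by rewrite fE hornerC oner_eq0 in f0.
rewrite fE hornerX in f0.
apply/eqP; apply: contraT => As.
have : p.[0] = 0 by move: sE; rewrite (eqP f0) expr0n => s0; rewrite -s0 /= in ps.
have pX : A = p \Po 'X^2.
  by apply: (mulfI (negbT (polyX_eq0 C))); rewrite -fA fE.
by move=> p0; move: As; rewrite (eqP f0) pX horner_comp hornerXn expr0n p0 eqxx.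
Qed.

Let size_pm : (size p <= m.+1)%N. Proof. by case: top_p. Qed.
Let size_qm : (size q <= m.+1)%N. Proof. by case: top_q. Qed.

Lemma rev_p z : z != 0 -> P.[z] = z ^+ m * p.[z^-1].
Proof. by move=> z0; apply: rev_polyE => //; exact: size_pm. Qed.

Lemma rev_q z : z != 0 -> Q.[z] = z ^+ m * q.[z^-1].
Proof. by move=> z0; apply: rev_polyE => //; exact: size_qm. Qed.

Lemma rev_p0 : P.[0] = lead_coef A. Proof. by rewrite rev_poly0; case: top_p. Qed.
Lemma rev_q0 : Q.[0] = lead_coef D. Proof. by rewrite rev_poly0; case: top_q. Qed.

Lemma rev_euler (g : {poly C}) :
  'X * (rev_poly m g)^`() = m%:R *: rev_poly m g - rev_poly m ('X * g^`()).
Proof.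
apply/polyP => i; rewrite coef_euler coefB coefZ !coef_poly coef_euler.
case: ltnP => [im|_]; last by rewrite !mulr0 subr0.
by rewrite -mulrBl natrB// opprB addrC subrK.
Qed.

Lemma rev_wronsk z : z != 0 ->
  z * (wronsk P Q).[z] = - (z ^+ m * z ^+ m * (z^-1 * (wronsk p q).[z^-1])).
Proof.
move=> z0; have eu (g : {poly C}) : (size g <= m.+1)%N -> z * (rev_poly m g)^`().[z] =
    m%:R * (z ^+ m * g.[z^-1]) - z ^+ m * (z^-1 * g^`().[z^-1]).
  move=> sg; have := congr1 (horner^~ z) (rev_euler g).
  rewrite hornerM hornerX hornerD hornerN hornerZ => ->.
  rewrite !rev_polyE ?hornerM ?hornerX//.
  by have [] := top_euler (conj sg erefl).
have := eu _ size_pm; have := eu _ size_qm; rewrite -/P -/Q => eQ eP.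
rewrite /wronsk !(hornerD, hornerN, hornerM) mulrBr [z * (_ * Q.[z])]mulrA eP
  [z * (P.[z] * _)]mulrCA eQ rev_p// rev_q//.
by ring.
Qed.

(** In terms of [G = x p (x ^ 2)] and [H = q (x ^ 2)], proportional to [A] and [D], the
    equation has the same form; both sides are then functions of [x ^ 2 = 1 / z]. *)
Lemma ode_rev : (P * Q - 2 *: ('X * wronsk P Q)) ^+ 2 * (1 - 'X) =
  c ^+ 2 *: (P * Q * (P ^+ 2 - 'X * Q ^+ 2)).
Proof.
apply: near_poly_eq; apply: filterS (cofinitely_neq 0) => z /eqP z0.
have x2 : sqrtC z^-1 ^+ 2 = z^-1 by rewrite sqrtCK.
have x0 : sqrtC z^-1 != 0 by rewrite sqrtC_eq0 invr_eq0.
set x := sqrtC z^-1 in x2 x0.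
pose G := p \Po 'X^2; pose H := q \Po 'X^2.
have scaled : wronsk ('X * G) H ^+ 2 * cubic C =
    c ^+ 2 *: (H * (('X * G) ^+ 3 - 'X * G * H ^+ 2)).
  rewrite -[H]fD -[_ * G]fA.
  have -> : wronsk (f * A) (f * D) = f ^+ 2 * wronsk A D.
    by rewrite /wronsk !derivM; ring.
  transitivity (f ^+ 4 * (wronsk A D ^+ 2 * cubic C)); first by ring.
  by rewrite ode -!mul_polyC; ring.
have wE : wronsk ('X * G) H = (p * q + 2 *: ('X * wronsk p q)) \Po 'X^2.
  rewrite /wronsk /G /H !deriv_comp !derivM derivX !deriv_comp derivXn /=.
  rewrite !(comp_polyD, comp_polyM, comp_polyZ, comp_polyB, comp_polyX) expr1 -!mul_polyC.
  by rewrite -mulr_natl -polyC_natr; ring.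
have := congr1 (horner^~ x) scaled; rewrite wE /G /H /cubic.
have -> : ((P * Q - 2 *: ('X * wronsk P Q)) ^+ 2 * (1 - 'X)).[z] =
    (P.[z] * Q.[z] - 2 * (z * (wronsk P Q).[z])) ^+ 2 * (1 - z).
  move: (wronsk P Q) => w.
  by rewrite !(horner_exp, hornerM, hornerZ, hornerD, hornerN, hornerX, hornerC).
rewrite rev_wronsk//; move: (wronsk p q) => w.
rewrite !(horner_exp, hornerXn, hornerX, hornerM, hornerZ, hornerD, hornerN, horner_comp).
rewrite x2 => e.
have {}e : (p.[z^-1] * q.[z^-1] + 2 * (z^-1 * w.[z^-1])) ^+ 2 * (z^-1 - 1) =
    c ^+ 2 * (q.[z^-1] * p.[z^-1] * (z^-1 * p.[z^-1] ^+ 2 - q.[z^-1] ^+ 2)).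
  apply: (mulfI x0); move: e.
  move: (p.[z^-1]) (q.[z^-1]) (w.[z^-1]) => ps qs ws; rewrite -x2 => e.
  transitivity ((ps * qs + 2 * (x ^+ 2 * ws)) ^+ 2 * (x ^+ 3 - x)); first by ring.
  by rewrite e; ring.
rewrite rev_p// rev_q//.
move: (p.[z^-1]) (q.[z^-1]) (w.[z^-1]) e => ps qs ws e.
transitivity (z ^+ m ^+ 4 * z * ((ps * qs + 2 * (z^-1 * ws)) ^+ 2 * (z^-1 - 1))).
  by field.
by rewrite e; field.
Qed.

Lemma rev_coprime : coprimep ('X * Q ^+ 2) (P ^+ 2).
Proof.
apply: Pdiv.ClosedField.root_coprimep => z /rootP;
  rewrite hornerM hornerX !horner_exp => /eqP.
rewrite mulf_eq0 expf_eq0 /= => zQ; rewrite expf_neq0//.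
have [z0|z0] := eqVneq z 0; first by rewrite z0 rev_p0 lead_coef_eq0.
move: zQ; rewrite (negbTE z0) /= rev_q// mulf_eq0 expf_eq0 (negbTE z0) andbF /= => qz.
rewrite rev_p// mulf_neq0 ?expf_neq0//.
by apply: (coprimep_root (p := q)); rewrite 1?coprimep_sym ?even_coprime//.
Qed.

(** If [f = 1] then [q (0) != 0], so [Q] has degree [m] and [x Q ^ 2] has degree
    [2 m + 1].  If [f = x] then [p (0) != 0] and [q (0) = 0], so [P ^ 2] has degree
    [2 m] and [x Q ^ 2] a smaller one. *)
Lemma rev_degree : (maxn (size ('X * Q ^+ 2)) (size (P ^+ 2))).-1 = (size A).-1.
Proof.
have sP : (size P <= m.+1)%N by exact: size_poly.
have sQ : (size Q <= m.+1)%N by exact: size_poly.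
have Q0 : Q != 0.
  apply/eqP => Q0; have /esym/eqP := rev_q0.
  by rewrite Q0 horner0 lead_coef_eq0 (negbTE D_neq0).
have P0 : P != 0.
  apply/eqP => P0; have /esym/eqP := rev_p0.
  by rewrite P0 horner0 lead_coef_eq0 (negbTE A_neq0).
have sP2 : size (P ^+ 2) = ((size P).*2).-1 by rewrite expr2 size_mul// addnn.
have sQ2 : size ('X * Q ^+ 2) = (size Q).*2.
  rewrite mulrC size_mulX ?expf_neq0// expr2 size_mul// addnn.
  by move: Q0; rewrite -size_poly_gt0; case: (size Q).
rewrite deg_A sP2 sQ2.
have top0 (g : {poly C}) : g.[0] != 0 -> size (rev_poly m g) = m.+1.
  move=> g0; apply/eqP; rewrite eqn_leq size_poly ltnNge; apply: contra g0 => /leq_sizeP.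
  by move/(_ m (leqnn m)); rewrite coef_poly ltnSn subnn horner_coef0 => ->.
have pos (g : {poly C}) : g != 0 -> (0 < size g)%N by rewrite size_poly_gt0.
case: fP => [fE|[fE D0]].
  rewrite fE eqxx.
  have q0 : q.[0] != 0.
    have := q_sqr_eq0 0; rewrite expr0n /= => ->; apply: (coprimep_root AD_coprime).
    by rewrite rootE -[A]mul1r -fE fA !hornerE.
  rewrite (top0 _ q0); have := pos _ P0.
  by move: (size P) sP => sp; lia.
rewrite fE; have -> : ('X == 1 :> {poly C}) = false.
  apply/negbTE/negP => /eqP /(congr1 (fun p : {poly C} => size p)).
  by rewrite size_polyX size_poly1.
have p0 : p.[0] != 0.
  have AX : A = p \Po 'X^2 by apply: (mulfI (negbT (polyX_eq0 C))); rewrite -fA fE.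
  have -> : p.[0] = A.[0] by rewrite AX horner_comp hornerXn expr0n.
  by apply: (coprimep_root (p := D)); rewrite 1?coprimep_sym// rootE D0.
have sQm : (size Q <= m)%N.
  apply: size_coef_le => i; rewrite leq_eqVlt => /orP[/eqP <-|im].
    rewrite coef_poly ltnSn subnn -horner_coef0.
    by have /eqP := q_sqr_eq0 0; rewrite expr0n D0 eqxx => /eqP/eqP.
  by rewrite nth_default// (leq_trans sQ).
rewrite (top0 _ p0); have := pos _ Q0.
by move: (size Q) sQm => sq; lia.
Qed.

End EvenReduction.

(** * Complex derivatives *)

Section ComplexDerivative.
Variable C : numClosedFieldType.
Implicit Types (f g : C -> C) (z l : C).

(** General facts on filters, specialised to the neighbourhoods of a point. *)
Lemma cvg_near_at f g z l : (\forall w \near z, f w = g w) ->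
  g w @[w --> z] --> l -> f w @[w --> z] --> l.
Proof. by move=> fg gl; exact: (@cvg_near_eq C C (nbhs z) _ f g l fg gl). Qed.

Lemma cvg_cst_at (c : C) z : c @[w --> z] --> c.
Proof. exact: (@cvg_cst C c C (nbhs z) _). Qed.
Arguments cvg_cst_at : clear implicits.

Lemma near_all {z} (P : C -> Prop) : (forall w, P w) -> \forall w \near z, P w.
Proof. exact: (@filterE C (nbhs z) _ P). Qed.

Lemma near_imp {z} (P Q : C -> Prop) : (forall w, P w -> Q w) ->
  (\forall w \near z, P w) -> \forall w \near z, Q w.
Proof. by move=> PQ; apply: filterS. Qed.

Lemma near_imp2 {z} (P1 P2 Q : C -> Prop) : (forall w, P1 w -> P2 w -> Q w) ->
  (\forall w \near z, P1 w) -> (\forall w \near z, P2 w) -> \forall w \near z, Q w.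
Proof. by move=> PQ; apply: filterS2. Qed.

(** Caratheodory's form of complex differentiability. *)
Definition cder f z l := exists2 phi : C -> C, phi w @[w --> z] --> l &
  \forall w \near z, f w - f z = (w - z) * phi w.

Lemma cder_cvg f z l : cder f z l -> f w @[w --> z] --> f z.
Proof.
move=> [phi phil fE].
have : f z + (w - z) * phi w @[w --> z] --> f z + (z - z) * l.
  exact: (cvgD (cvg_cst_at (f z) z) (cvgM (cvgB cvg_id (cvg_cst_at z z)) phil)).
rewrite subrr mul0r addr0 => h; have e : \forall w \near z, f w = f z + (w - z) * phi w.
  by apply: near_imp fE => w <-; rewrite addrC subrK.
exact: (cvg_near_at e h).
Qed.

Lemma cder_near f g z l : (\forall w \near z, f w = g w) -> cder g z l -> cder f z l.
Proof.
move=> fg [phi phil gE]; exists phi => //; have fz : f z = g z := nbhs_singleton fg.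
by apply: near_imp2 fg gE => w ->; rewrite fz.
Qed.

Lemma cder_eq f z l l' : cder f z l -> l = l' -> cder f z l'.
Proof. by move=> ? <-. Qed.

Lemma cder_cst c z : cder (fun=> c) z 0.
Proof.
exists (fun=> 0); first exact: (cvg_cst_at _ z).
by apply: near_all => w; rewrite subrr mulr0.
Qed.

Lemma cder_id z : cder (fun w => w) z 1.
Proof.
exists (fun=> 1); first exact: (cvg_cst_at _ z).
by apply: near_all => w; rewrite mulr1.
Qed.

Lemma cderD f g z l l' : cder f z l -> cder g z l' -> cder (fun w => f w + g w) z (l + l').
Proof.
move=> [phi phil fE] [psi psil gE]; exists (fun w => phi w + psi w);
  first exact: (cvgD phil psil).
by apply: near_imp2 fE gE => w fw gw; rewrite opprD addrACA fw gw mulrDr.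
Qed.

Lemma cderM f g z l l' : cder f z l -> cder g z l' ->
  cder (fun w => f w * g w) z (l * g z + f z * l').
Proof.
move=> df dg; have gz := cder_cvg dg; case: df dg => [phi phil fE] [psi psil gE].
exists (fun w => phi w * g w + f z * psi w).
  exact: (cvgD (cvgM phil gz) (cvgM (cvg_cst_at (f z) z) psil)).
apply: near_imp2 fE gE => w fw gw.
rewrite mulrDr mulrA -fw mulrCA -gw; ring.
Qed.

Lemma cderN f z l : cder f z l -> cder (fun w => - f w) z (- l).
Proof.
move=> [phi phil fE]; exists (fun w => - phi w); first exact: (cvgN phil).
by apply: near_imp fE => w fw; rewrite mulrN -fw opprB opprK addrC.
Qed.

Lemma cderV f z l : f z != 0 -> cder f z l -> cder (fun w => (f w)^-1) z (- l / f z ^+ 2).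
Proof.
move=> fz df; have fzc := cder_cvg df; case: df => [phi phil fE].
exists (fun w => - phi w / (f w * f z)).
  rewrite expr2.
  exact: (cvgM (cvgN phil) (cvgV (mulf_neq0 fz fz) (cvgM fzc (cvg_cst_at (f z) z)))).
have fw0 : \forall w \near z, f w != 0 by exact: cvgr_neq0 fzc fz.
apply: near_imp2 fE fw0 => w fw fw0; rewrite mulrA mulrN -fw; field.
by rewrite fw0 fz.
Qed.

Lemma cder_comp f g z l l' : cder f (g z) l -> cder g z l' ->
  cder (fun w => f (g w)) z (l * l').
Proof.
move=> [phi phil fE] dg; have gz := cder_cvg dg; case: dg => [psi psil gE].
exists (fun w => phi (g w) * psi w).
  exact: (cvgM (cvg_comp _ _ gz phil) psil).
have fgE : \forall w \near z, f (g w) - f (g z) = (g w - g z) * phi (g w) by exact: gz fE.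
by apply: near_imp2 fgE gE => w -> ->; ring.
Qed.

Lemma cderX f n z l : cder f z l -> cder (fun w => f w ^+ n) z (n%:R * f z ^+ n.-1 * l).
Proof.
move=> df; elim: n => [|n IHn].
  by apply: cder_eq (cder_cst 1 z) _; rewrite !mul0r.
have h : \forall w \near z, f w ^+ n.+1 = f w * f w ^+ n.
  by apply: near_all => w; rewrite exprS.
apply: cder_near h _; apply: cder_eq (cderM df IHn) _.
case: n {IHn} => [|n] /=; first by rewrite !expr0; ring.
by rewrite [f z ^+ n.+1]exprS -[n.+2%:R]natr1; ring.
Qed.

Lemma cder_horner (p : {poly C}) z : cder (horner p) z p^`().[z].
Proof.
have [dq [dqE dqL]] := divided_difference p; exists (fun w => dq w z).
  exact: (dqL C (nbhs z) _ (fun w => w) (fun=> z) z cvg_id (cvg_cst_at z z)).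
by apply: near_all => w; exact: dqE.
Qed.

End ComplexDerivative.
Arguments cvg_cst_at {C} c z.

(** * The complex plane over the real line *)

Section ComplexPlane.
Variable R : realType.
Local Notation C := (Cplx R).
Local Open Scope complex_scope.

Definition cplx (t : R) : C := t%:C.

Lemma cplx_norm t : `|cplx t| = cplx `|t| :> C.
Proof.
rewrite [LHS](normc_def (t%:C)) /= expr0n addr0 sqrtr_sqr.
by [].
Qed.

Lemma real_eps (e : C) : 0 < e -> exists2 r : R, 0 < r & e = cplx r.
Proof.
rewrite (ltcE 0 e) => /andP[/eqP /= e0 re]; exists (complex.Re e) => //.
by case: e e0 {re} => a b /= ->.
Qed.

Lemma cplx_lt (s t : R) : (cplx s < cplx t) = (s < t).
Proof. by rewrite (ltcE s%:C t%:C) /= eqxx. Qed.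

Lemma cplx_le (s t : R) : (cplx s <= cplx t) = (s <= t).
Proof. by rewrite (lecE s%:C t%:C) /= eqxx. Qed.

Lemma Re_norm (z : C) : cplx `|complex.Re z| <= `|z|.
Proof. exact: normc_ge_Re. Qed.

Lemma Im_norm (z : C) : cplx `|complex.Im z| <= `|z|.
Proof.
rewrite [leRHS]normc_def cplx_le -sqrtr_sqr ler_wsqrtr// lerDr; exact: sqr_ge0.
Qed.

Lemma ReB (a b : C) : complex.Re (a - b) = complex.Re a - complex.Re b.
Proof. by case: a; case: b. Qed.

Lemma ImB (a b : C) : complex.Im (a - b) = complex.Im a - complex.Im b.
Proof. by case: a; case: b. Qed.

Lemma norm_ReIm (z : C) : `|z| <= cplx (`|complex.Re z| + `|complex.Im z|).
Proof.
rewrite [leLHS]normc_def cplx_le.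
have -> : `|complex.Re z| + `|complex.Im z| =
    Num.sqrt ((`|complex.Re z| + `|complex.Im z|) ^+ 2).
  by rewrite sqrtr_sqr [RHS]ger0_norm ?addr_ge0.
rewrite ler_wsqrtr// sqrrD !real_normK ?num_real// addrAC lerDl.
by rewrite mulrn_wge0// mulr_ge0.
Qed.

Lemma cvg_Re T (F : set_system T) (FF : Filter F) (u : T -> C) (l : C) :
  u t @[t --> F] --> l -> complex.Re (u t) @[t --> F] --> complex.Re l.
Proof.
move=> ul; apply/cvgrPdist_lt => e e0.
have e0' : 0 < cplx e :> C by rewrite (cplx_lt 0).
apply: filterS (cvgr_dist_lt _ _ ul _ e0') => t.
by rewrite -ReB -cplx_lt; apply: le_lt_trans; exact: Re_norm.
Qed.

Lemma cvg_Im T (F : set_system T) (FF : Filter F) (u : T -> C) (l : C) :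
  u t @[t --> F] --> l -> complex.Im (u t) @[t --> F] --> complex.Im l.
Proof.
move=> ul; apply/cvgrPdist_lt => e e0.
have e0' : 0 < cplx e :> C by rewrite (cplx_lt 0).
apply: filterS (cvgr_dist_lt _ _ ul _ e0') => t.
by rewrite -ImB -cplx_lt; apply: le_lt_trans; exact: Im_norm.
Qed.

Lemma cvg_ReIm T (F : set_system T) (FF : Filter F) (u : T -> C) (l : C) :
  complex.Re (u t) @[t --> F] --> complex.Re l ->
  complex.Im (u t) @[t --> F] --> complex.Im l -> u t @[t --> F] --> l.
Proof.
move=> ure uim; apply/cvgrPdist_lt => e /real_eps[r r0 ->].
have r2 : 0 < r / 2 by rewrite divr_gt0.
have [ur ui] := (cvgr_dist_lt _ _ ure _ r2, cvgr_dist_lt _ _ uim _ r2).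
apply: filterS2 ur ui => t; rewrite -ReB -ImB => ur ui.
apply: le_lt_trans (norm_ReIm _) _; rewrite cplx_lt.
by rewrite [ltRHS]splitr ltrD.
Qed.

(** The real and imaginary parts converge absolutely. *)
Lemma cvg_dominated_series (u : nat -> C) (K : R) :
  (forall n, `|u n| <= cplx (K * 2^-1 ^+ n)) -> cvgn (series u).
Proof.
move=> uK; have lt1 : `|2^-1 : R| < 1 by rewrite ger0_norm ?invr_ge0// invf_lt1// ltr1n.
have part (L : C -> R) : (forall z, cplx `|L z| <= `|z|) -> cvgn (series (L \o u)).
  move=> LN; apply: normed_cvg.
  apply: (@series_le_cvg _ _ (geometric K 2^-1)) => [n|n|n|].
  - exact: normr_ge0.
  - by have := le_trans (LN _) (uK n); rewrite cplx_le; apply: le_trans.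
  - by have := le_trans (LN _) (uK n); rewrite cplx_le.
  - exact: is_cvg_geometric_series.
have [] := (part _ Re_norm, part _ Im_norm) => /cvg_ex[a aP] /cvg_ex[b bP].
apply/cvg_ex; exists (Complex a b); apply: cvg_ReIm.
  rewrite (_ : (fun n => _) = series (complex.Re (R := R) \o u)); first exact: aP.
  apply/funext => n; rewrite /series /=; elim: n => [|n IHn]; first by rewrite !big_geq.
  by rewrite !big_nat_recr//= -IHn; case: (\sum_(_ <= _ < _) _); case: (u n).
rewrite (_ : (fun n => _) = series (complex.Im (R := R) \o u)); first exact: bP.
apply/funext => n; rewrite /series /=; elim: n => [|n IHn]; first by rewrite !big_geq.
by rewrite !big_nat_recr//= -IHn; case: (\sum_(_ <= _ < _) _); case: (u n).
Qed.

Lemma cvg_ray (w : C) (t : R) : cplx (t + s) * w @[s --> (0 : R)^'] --> cplx t * w.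
Proof.
apply/cvgrPdist_lt => e e0.
have w0 : 0 < `|w| + 1 by rewrite ltr_wpDl.
have /real_eps[r r0 rE] : 0 < e / (`|w| + 1) by rewrite divr_gt0.
near=> s.
rewrite -mulrBl normrM (_ : cplx t - _ = cplx (- s)); last first.
  by rewrite /cplx -rmorphB opprD addNKr.
rewrite cplx_norm normrN.
have sr : `|s| < r by near: s; exact: dnbhs0_lt.
apply: (@le_lt_trans _ _ (cplx `|s| * (`|w| + 1))).
  by rewrite ler_wpM2l// ?lerDl// (cplx_le 0).
by rewrite -ltr_pdivlMr// rE cplx_lt.
Unshelve. all: by end_near. Qed.

Arguments cvg_ray : clear implicits.

Lemma cder_ray (k : C -> C) (w l : C) (t : R) : cder k (cplx t * w) l ->
  (k (cplx (t + s) * w) - k (cplx t * w)) / cplx s @[s --> (0 : R)^'] --> w * l.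
Proof.
move=> [phi phil kE]; have lim := cvg_ray w t.
have h : w * phi (cplx (t + s) * w) @[s --> (0 : R)^'] --> w * l.
  exact: (cvgM (cvg_cst w) (cvg_comp _ _ lim phil)).
apply: cvg_trans h; apply: near_eq_cvg.
have s0 : \forall s \near (0 : R)^', s != 0 by exact: nbhs_dnbhs_neq.
have kE' : \forall s \near (0 : R)^', k (cplx (t + s) * w) - k (cplx t * w) =
  (cplx (t + s) * w - cplx t * w) * phi (cplx (t + s) * w) by exact: lim kE.
apply: filterS2 s0 kE' => s s0 ->.
have cs0 : cplx s != 0 :> C by rewrite /cplx (_ : s%:C != 0)// (inj_eq (@complexI R) s 0).
rewrite -mulrBl (_ : cplx (t + s) - cplx t = cplx s); first by field.
by rewrite /cplx -rmorphB addrAC subrr add0r.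
Qed.

(** The mean value theorem applies to the real and imaginary parts along rays. *)
Lemma cder0_cst (k : C -> C) (rho : C) :
  (forall z, `|z| < rho -> cder k z 0) -> forall z, `|z| < rho -> k z = k 0.
Proof.
move=> k0 w wrho.
have ray (t : R) : 0 <= t <= 1 -> cder k (cplx t * w) 0.
  move=> /andP[t0 t1]; apply: k0; rewrite normrM cplx_norm (ger0_norm t0).
  by apply: le_lt_trans wrho; apply: ler_piMl => //; rewrite (cplx_le t 1).
have part (L : C -> R) : (forall T (F : set_system T) (FF : Filter F) (u : T -> C) l,
      u t @[t --> F] --> l -> L (u t) @[t --> F] --> L l) ->
    L 0 = 0 -> (forall a b : C, L (a - b) = L a - L b) ->
    (forall (s : R) (a : C), L (a / cplx s) = s^-1 * L a) -> L (k w) = L (k 0).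
  move=> Lcvg L0 LB LZ; pose h t := L (k (cplx t * w)).
  have dh (t : R) : 0 <= t <= 1 -> is_derive t 1 h (0 : R).
    move=> /ray/cder_ray/Lcvg; rewrite mulr0 L0 => hl.
    have {}hl : s^-1 *: ((h \o shift t) (s *: 1) - h t) @[s --> (0 : R)^'] --> (0 : R).
      apply: cvg_trans hl; apply: near_eq_cvg; apply: nearW => s /=.
      by rewrite LZ LB /h /= scaler1 [s + t]addrC.
    by apply: DeriveDef; [apply/cvg_ex; exists 0|exact: cvg_lim hl].
  have [||t _] := @MVT R h (fun=> 0) 0 1 ltr01.
  - by move=> t; rewrite in_itv /= => /andP[/ltW t0 /ltW t1]; apply: dh; rewrite t0.
  - apply: derivable_within_continuous => t; rewrite in_itv /= => tI.
    by have [] := dh t tI.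
  rewrite mul0r => /subr0_eq; rewrite /h (_ : cplx 1 = 1)// mul1r => ->.
  by rewrite (_ : cplx 0 = 0)// mul0r.
have [] : complex.Re (k w) = complex.Re (k 0) /\ complex.Im (k w) = complex.Im (k 0).
  have sV (s : R) : (cplx s)^-1 = cplx s^-1 :> C by rewrite /cplx -fmorphV.
  split.
    apply: (part _ (@cvg_Re) erefl ReB) => s [a b].
    by rewrite sV /= mulr0 subr0 mulrC.
  apply: (part _ (@cvg_Im) erefl ImB) => s [a b].
  by rewrite sV /= mulr0 add0r mulrC.
by case: (k w) (k 0) => a b [a' b'] /= -> ->.
Qed.

End ComplexPlane.

(** * Power series with bounded coefficients *)

Section PowerSeries.
Variable R : realType.
Local Notation C := (Cplx R).
Implicit Types (a : nat -> C) (z w : C).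

Lemma cplx_nat_half (K n : nat) : cplx (K%:R * 2^-1 ^+ n) = K%:R * 2^-1 ^+ n :> C.
Proof. by rewrite /cplx rmorphM rmorph_nat rmorphXn fmorphV rmorph_nat. Qed.

Lemma dominated_cvg (u : nat -> C) (K : nat) :
  (forall n, `|u n| <= K%:R * 2^-1 ^+ n) -> cvgn (series u).
Proof.
by move=> uK; apply: (@cvg_dominated_series _ _ K%:R) => n; rewrite cplx_nat_half.
Qed.

Lemma dominated_lim (u : nat -> C) (K : nat) :
  (forall n, `|u n| <= K%:R * 2^-1 ^+ n) -> `|limn (series u)| <= K%:R * 2.
Proof.
move=> uK; have sK n : `|series u n| <= K%:R * 2.
  have : `|series u n| <= K%:R * (2 - 2 * 2^-1 ^+ n).
    rewrite /series /=; elim: n => [|n IHn].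
      by rewrite big_geq// normr0 expr0 mulr1 subrr mulr0.
    rewrite big_nat_recr//=; apply: le_trans (ler_normD _ _) _.
    apply: le_trans (lerD IHn (uK n)) _;
      rewrite exprS [2 * (_ * _)]mulrA divff ?pnatr_eq0//.
    by rewrite le_eqVlt; apply/orP; left; apply/eqP; ring.
  move/le_trans; apply; rewrite ler_wpM2l// gerBl.
  by rewrite mulr_ge0// exprn_ge0// invr_ge0.
apply/ler_addgt0Pr => e e0; have ul := dominated_cvg uK.
have [N _ /(_ N (leqnn N)) lN] := cvgr_dist_lt _ _ ul _ e0.
rewrite -[limn _](subrK (series u N)) addrC.
apply: le_trans (ler_normD _ _) _; apply: lerD => //; exact: ltW.
Qed.

Definition pser a z := limn (series (fun n => a n * z ^+ n)).
Definition dpser a z := limn (series (fun n => a n * (n%:R * z ^+ n.-1))).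

(** On the disc of radius [1 / 4], the terms of a series with bounded coefficients,
    those of its derivative and its second order remainders are all dominated by
    geometric sequences of ratio [1 / 2]. *)
Lemma half_pow (z : C) n : `|z| <= 4^-1 -> `|z ^+ n| <= 2^-1 ^+ n * 2^-1 ^+ n.
Proof.
move=> z4; rewrite normrX -exprMn lerXn2r ?nnegrE ?mulr_ge0 ?invr_ge0//.
by rewrite -invfM -natrM.
Qed.

Lemma nat_half_pow n : n.+1%:R * 2^-1 ^+ n <= 1 :> C.
Proof.
rewrite exprVn -natrX ler_pdivrMr ?ltr0n ?expn_gt0// mul1r ler_nat.
exact: ltn_expl.
Qed.

Lemma deriv_pow (z : C) n : `|z| <= 4^-1 -> `|n%:R * z ^+ n.-1| <= 2 * 2^-1 ^+ n.
Proof.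
move=> z4; case: n => [|n]; first by rewrite mul0r normr0 mulr_ge0.
rewrite normrM normr_nat /= exprS mulrA divff ?pnatr_eq0// mul1r.
apply: le_trans (ler_wpM2l (ler0n _ _) (half_pow n z4)) _.
rewrite mulrA; apply: ler_piMl; last exact: nat_half_pow.
by rewrite exprn_ge0// invr_ge0.
Qed.

Section Bounded.
Variable a : nat -> C.
Hypothesis a1 : forall n, `|a n| <= 1.

Lemma bounded_mul (b : nat -> C) (K : nat) :
  (forall n, `|b n| <= K%:R * 2^-1 ^+ n) -> forall n, `|a n * b n| <= K%:R * 2^-1 ^+ n.
Proof. by move=> bK n; rewrite normrM; apply: le_trans (bK n); apply: ler_piMl. Qed.

Lemma pow_bound z n : `|z| <= 4^-1 -> `|z ^+ n| <= 1%:R * 2^-1 ^+ n.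
Proof.
move=> z4; apply: le_trans (half_pow n z4) _; rewrite mul1r; apply: ler_piMl.
  by rewrite exprn_ge0// invr_ge0.
by rewrite exprn_ile1 ?invr_ge0// invf_le1// ler1n.
Qed.

Lemma pser_cvg z : `|z| <= 4^-1 -> series (fun n => a n * z ^+ n) @ \oo --> pser a z.
Proof.
by move=> z4; apply: (@dominated_cvg _ 1); apply: bounded_mul => n; exact: pow_bound.
Qed.

Lemma dpser_cvg z : `|z| <= 4^-1 ->
  series (fun n => a n * (n%:R * z ^+ n.-1)) @ \oo --> dpser a z.
Proof.
by move=> z4; apply: (@dominated_cvg _ 2); apply: bounded_mul => n; exact: deriv_pow.
Qed.

(** The quotient of [w ^ n - z ^ n - n (w - z) z ^ (n - 1)] by [(w - z) ^ 2]. *)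
Fixpoint taylor2 w z n : C :=
  if n is n'.+1 then w * taylor2 w z n' + n'%:R * z ^+ n'.-1 else 0.

Lemma taylor2E w z n :
  w ^+ n - z ^+ n - (w - z) * (n%:R * z ^+ n.-1) = (w - z) ^+ 2 * taylor2 w z n.
Proof.
elim: n => [|n IHn] /=; first by rewrite !expr0; ring.
rewrite mulrDr [(w - z) ^+ 2 * (w * _)]mulrCA -IHn -[n.+1%:R]natr1;
  case: n {IHn} => [|n] /=.
  by rewrite !expr0 !expr1; ring.
by rewrite !exprS; ring.
Qed.

Lemma taylor2_bound w z n : `|w| <= 4^-1 -> `|z| <= 4^-1 ->
  `|taylor2 w z n| <= 8%:R * 2^-1 ^+ n.
Proof.
move=> w4 z4; elim: n => [|n IHn] /=; first by rewrite normr0 mulr_ge0.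
apply: le_trans (ler_normD _ _) _; rewrite normrM.
apply: le_trans (lerD (ler_pM (normr_ge0 _) (normr_ge0 _) w4 IHn) (deriv_pow n z4)) _.
by rewrite exprS le_eqVlt; apply/orP; left; apply/eqP; field.
Qed.

(** The slope of the power series, with a remainder that is bounded by
    [taylor2_bound]. *)
Lemma pser_quot w z : `|w| <= 4^-1 -> `|z| <= 4^-1 ->
  pser a w - pser a z =
  (w - z) * (dpser a z + (w - z) * limn (series (fun n => a n * taylor2 w z n))).
Proof.
move=> w4 z4; have tb n := taylor2_bound n w4 z4.
have tc : series (fun n => a n * taylor2 w z n) N @[N --> \oo] -->
    limn (series (fun n => a n * taylor2 w z n)) := dominated_cvg (bounded_mul tb).
have c1 : series (fun n => a n * w ^+ n) N - series (fun n => a n * z ^+ n) N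
    @[N --> \oo] --> pser a w - pser a z by exact: cvgB (pser_cvg w4) (pser_cvg z4).
have c2 : (w - z) * (series (fun n => a n * (n%:R * z ^+ n.-1)) N +
      (w - z) * series (fun n => a n * taylor2 w z n) N) @[N --> \oo] -->
    (w - z) * (dpser a z + (w - z) * limn (series (fun n => a n * taylor2 w z n))).
  exact: (cvgM (cvg_cst (w - z)) (cvgD (dpser_cvg z4) (cvgM (cvg_cst (w - z)) tc))).
apply: norm_cvg_unique c1 _.
rewrite (_ : (fun N => _) = (fun N =>
    (w - z) * (series (fun n => a n * (n%:R * z ^+ n.-1)) N +
      (w - z) * series (fun n => a n * taylor2 w z n) N)))//.
apply/funext => N; rewrite /series /= mulrDr !mulr_sumr -sumrB -big_split /=.
apply: eq_bigr => n _.
transitivity (a n * ((w - z) * (n%:R * z ^+ n.-1) + (w - z) ^+ 2 * taylor2 w z n)).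
  by rewrite -taylor2E; ring.
by ring.
Qed.

Lemma near_dist (z e : C) : 0 < e -> \forall w \near z, `|z - w| < e.
Proof.
by move=> e0; exact: (@cvgr_dist_lt C C C (nbhs z) _ (fun w => w) z cvg_id e e0).
Qed.

Lemma pser_cder z : `|z| < 4^-1 -> cder (pser a) z (dpser a z).
Proof.
move=> z4; have near4 : \forall w \near z, `|w| <= 4^-1.
  have d0 : 0 < 4^-1 - `|z| by rewrite subr_gt0.
  apply: near_imp (near_dist z d0) => w zw.
  rewrite -[w](subrK z) (le_trans (ler_normD _ _))// -lerBrDr distrC; exact: ltW.
exists (fun w => dpser a z + (w - z) * limn (series (fun n => a n * taylor2 w z n))).
  have h : (w - z) * limn (series (fun n => a n * taylor2 w z n)) @[w --> z] --> (0 : C).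
    apply: (proj2 (@cvgr0Pnorm_lt C C C (nbhs z) _ _)) => e e0;
      have e16 : 0 < e / 16 by rewrite divr_gt0.
    apply: near_imp2 near4 (near_dist z e16) => w w4 zw.
    rewrite normrM distrC.
    have tb := dominated_lim (bounded_mul (fun n => taylor2_bound n w4 (ltW z4))).
    apply: le_lt_trans (ler_wpM2l (normr_ge0 _) tb) _.
    by rewrite -natrM -ltr_pdivlMr.
  by have := cvgD (cvg_cst_at (dpser a z) z) h; rewrite addr0; apply.
by apply: near_imp near4 => w w4; apply: pser_quot => //; exact: ltW.
Qed.

End Bounded.

(** * The series of [(1 - z) ^ (- 1 / 2)] and of [2F1(1/2, 1/4; 5/4; z)] *)

Definition scoef n : C := pochhammer (1 / 2) n / n`!%:R.
Definition fcoef n : C := pochhammer (1 / 2) n * pochhammer (1 / 4) n /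
  (pochhammer (5 / 4) n * n`!%:R).

Lemma pochhammerS (x : C) n : pochhammer x n.+1 = pochhammer x n * (x + n%:R).
Proof. by rewrite /pochhammer big_ord_recr. Qed.

Lemma scoefS n : scoef n.+1 * n.+1%:R = scoef n * (1 / 2 + n%:R).
Proof.
rewrite /scoef pochhammerS factS natrM; field.
by rewrite nat1r !pnatr_eq0 -lt0n fact_gt0.
Qed.

Lemma fcoefE n : fcoef n = scoef n / (4 * n%:R + 1).
Proof.
have pos k : 4 * k%:R + 1 != 0 :> C by rewrite -natrM natr1 pnatr_eq0.
have pos5 (k : nat) : 5 + k%:R * 4 != 0 :> C by rewrite -natrM -natrD pnatr_eq0.
have p5 k : pochhammer (5 / 4 : C) k != 0.
  elim: k => [|k IHk]; first by rewrite /pochhammer big_ord0 oner_neq0.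
  have e5 : 5 / 4 + k%:R = (5 + k%:R * 4) / 4 :> C by field.
  by rewrite pochhammerS mulf_neq0// e5 mulf_neq0 ?invr_eq0.
have e : pochhammer (1 / 4) n * (4 * n%:R + 1) = pochhammer (5 / 4 : C) n.
  elim: n => [|n IHn]; first by rewrite /pochhammer !big_ord0; ring.
  by rewrite !pochhammerS -IHn -[n.+1%:R]natr1; field.
have f0 : n`!%:R != 0 :> C by rewrite pnatr_eq0 -lt0n fact_gt0.
have := p5 n; rewrite -e mulf_eq0 negb_or => /andP[p4 _].
by rewrite /fcoef /scoef -e; field; rewrite f0 pos p4.
Qed.

Lemma scoef_bounds n : 0 <= scoef n <= 1.
Proof.
elim: n => [|n /andP[s0 s1]];
  first by rewrite /scoef /pochhammer big_ord0 fact0 divr1 ler01 lexx.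
have -> : scoef n.+1 = scoef n * ((1 / 2 + n%:R) / n.+1%:R).
  by rewrite mulrA -scoefS mulfK// pnatr_eq0.
have q0 : 0 <= (1 / 2 + n%:R) / n.+1%:R :> C by rewrite divr_ge0// addr_ge0// divr_ge0.
have q1 : (1 / 2 + n%:R) / n.+1%:R <= 1 :> C.
  rewrite ler_pdivrMr ?ltr0n// [1 * _.+1%:R]mul1r -[n.+1%:R]nat1r lerD2r mul1r.
  by rewrite invf_le1 ?ler1n.
by rewrite mulr_ge0// mulr_ile1.
Qed.

Lemma scoef_norm n : `|scoef n| <= 1.
Proof. by have /andP[s0 s1] := scoef_bounds n; rewrite ger0_norm. Qed.

Lemma fcoef_norm n : `|fcoef n| <= 1.
Proof.
rewrite fcoefE normrM; apply: mulr_ile1; rewrite ?scoef_norm//.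
rewrite -natrM natr1 normfV normr_nat invf_le1 ?ltr0n// ler1n//.
Qed.

Lemma pser0 (a : nat -> C) : (forall n, `|a n| <= 1) -> pser a 0 = a 0%N.
Proof.
move=> a1; have z0 : `|0 : C| <= 4^-1 by rewrite normr0 invr_ge0.
apply: norm_cvg_unique (pser_cvg a1 z0) _.
apply: (@cvg_near_eq C nat \oo _ _ (fun=> a 0%N)); last exact: cvg_cst.
exists 1%N => // -[//|n] _; rewrite /series /= big_nat_recl//= expr0 mulr1 big1 ?addr0//.
by move=> i _; rewrite expr0n mulr0.
Qed.

(** The coefficients satisfy [(4 n + 1) f_n = s_n]. *)
Lemma fser_ode z : `|z| < 4^-1 ->
  4 * (z * dpser fcoef z) + pser fcoef z = pser scoef z.
Proof.
move=> /ltW z4.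
have c1 : 4 * (z * series (fun n => fcoef n * (n%:R * z ^+ n.-1)) N) +
    series (fun n => fcoef n * z ^+ n) N @[N --> \oo] -->
    4 * (z * dpser fcoef z) + pser fcoef z.
  exact: (cvgD (cvgM (cvg_cst (4 : C)) (cvgM (cvg_cst z) (dpser_cvg fcoef_norm z4)))
    (pser_cvg fcoef_norm z4)).
apply: norm_cvg_unique c1 _.
rewrite (_ : (fun N => _) = series (fun n => scoef n * z ^+ n));
  first exact: (pser_cvg scoef_norm z4).
apply/funext => N; rewrite /series /= !mulr_sumr -big_split /=; apply: eq_bigr => n _.
have pos : 4 * n%:R + 1 != 0 :> C by rewrite -natrM natr1 pnatr_eq0.
rewrite fcoefE; case: n pos => [|n] pos /=; first by field.
by rewrite exprS; field.
Qed.

(** The coefficients satisfy [(n + 1) s_(n+1) = (n + 1 / 2) s_n], so that the partial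
    sums of both sides differ by one term, which tends to [0]. *)
Lemma sser_ode z : `|z| < 4^-1 -> (1 - z) * dpser scoef z = pser scoef z / 2.
Proof.
move=> /ltW z4; apply/eqP; rewrite -subr_eq0; apply/eqP.
have c1 : (1 - z) * series (fun n => scoef n * (n%:R * z ^+ n.-1)) N -
    series (fun n => scoef n * z ^+ n) N / 2 @[N --> \oo] -->
    (1 - z) * dpser scoef z - pser scoef z / 2.
  exact: (cvgB (cvgM (cvg_cst (1 - z)) (dpser_cvg scoef_norm z4))
    (cvgM (pser_cvg scoef_norm z4) (cvg_cst (2^-1 : C)))).
apply: norm_cvg_unique c1 _.
rewrite (_ : (fun N => _) = (fun N => - (scoef N * (N%:R * z ^+ N.-1)))).
  have := cvgN (cvg_series_cvg_0 (cvgP _ (dpser_cvg scoef_norm z4))).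
  by rewrite oppr0; apply.
apply/funext => N; rewrite /series /=; elim: N => [|N IHN].
  by rewrite !big_geq// !mul0r !mulr0 subrr oppr0.
rewrite !big_nat_recr//= [RHS](_ : _ = - (scoef N * (1 / 2 + N%:R) * z ^+ N)); last first.
  by rewrite -scoefS; ring.
set s1 := \sum_(0 <= i < N) scoef i * (i%:R * z ^+ i.-1) in IHN *.
set s2 := \sum_(0 <= i < N) scoef i * z ^+ i in IHN *.
transitivity (((1 - z) * s1 - s2 / 2) +
  ((1 - z) * (scoef N * (N%:R * z ^+ N.-1)) - scoef N * z ^+ N / 2)); first by field.
rewrite {}IHN {s1 s2}; case: N => [|N] /=; first by field.
by rewrite exprS; field.
Qed.

(** By [sser_ode] the left side has derivative zero, and its value at [0] is [1]. *)
Lemma sser_sqr z : `|z| < 4^-1 -> pser scoef z ^+ 2 * (1 - z) = 1.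
Proof.
move=> z4; pose k z := pser scoef z ^+ 2 * (1 - z).
have dk w : `|w| < 4^-1 -> cder k w 0.
  move=> w4; have dS := pser_cder scoef_norm w4.
  apply: cder_eq (cderM (cderX 2 dS) (cderD (cder_cst 1 w) (cderN (cder_id w)))) _.
  have := sser_ode w4; set s := pser _ _; set d := dpser _ _ => e.
  transitivity (2 * s * ((1 - w) * d) - s ^+ 2); first by ring.
  by rewrite e; field.
have := cder0_cst dk z4; rewrite /k => ->.
by rewrite (pser0 scoef_norm) /scoef /pochhammer big_ord0 fact0; field.
Qed.

End PowerSeries.

(** * The hypergeometric transformation *)

Section Transformation.
Variable R : realType.
Local Notation C := (Cplx R).
Variables (P Q : {poly C}) (c : C).
Hypothesis P0 : P.[0] != 0.
Hypothesis Q0 : Q.[0] != 0.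
Hypothesis PQ0 : Q.[0] = c ^+ 2 * P.[0].
Hypothesis ode : (P * Q - 2 *: ('X * wronsk P Q)) ^+ 2 * (1 - 'X) =
  c ^+ 2 *: (P * Q * (P ^+ 2 - 'X * Q ^+ 2)).

Let mu0 : C := P.[0] / Q.[0].
Let M (z : C) := P.[z] / Q.[z].
Let w z := M z / mu0.
Let g z := pser (@scoef R) (1 - w z).
Let Z z := z / M z ^+ 2.
Let S := pser (@scoef R).
Let F := pser (@fcoef R).
Let wr z := (wronsk P Q).[z].
(* [euler_g z * S (Z z)] is what [4 z d/dz + 1] makes of [g F (Z)]. *)
Let euler_g z := g z * (1 - 2 * z * wr z / (P.[z] * Q.[z])).
Let T z := euler_g z * S (Z z).

Let mu0_neq0 : mu0 != 0. Proof. by rewrite mulf_neq0 ?invr_eq0. Qed.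

(** The points where all the series in play converge, and [M] has no zero or pole. *)
Definition regular_at z :=
  [/\ P.[z] != 0, Q.[z] != 0, `|z| < 4^-1, `|1 - w z| < 4^-1 & `|Z z| < 4^-1].

Lemma ratio_at0 : w 0 = 1. Proof. by rewrite /w /M divff. Qed.
Lemma pullback_at0 : Z 0 = 0. Proof. by rewrite /Z mul0r. Qed.

Lemma regular_at0 : regular_at 0.
Proof. by split; rewrite ?ratio_at0 ?pullback_at0 ?subrr ?normr0 ?invr_gt0. Qed.

Lemma cder_rat z : regular_at z -> cder M z (wr z / Q.[z] ^+ 2).
Proof.
move=> [Pz Qz _ _ _];
  apply: cder_eq (cderM (cder_horner P z) (cderV Qz (cder_horner Q z))) _.
rewrite /wr /wronsk !(hornerD, hornerN, hornerM); field; exact: Qz.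
Qed.

Lemma rat_neq0 z : regular_at z -> M z != 0.
Proof. by case=> Pz Qz _ _ _; rewrite mulf_neq0 ?invr_eq0. Qed.

Lemma cder_ratio z : regular_at z -> cder w z (wr z / Q.[z] ^+ 2 / mu0).
Proof.
move=> gz; apply: cder_eq (cderM (cder_rat gz) (cder_cst mu0^-1 z)) _.
by rewrite mulr0 addr0.
Qed.

Lemma cder_branch z : regular_at z -> cder g z (- (g z * wr z / (2 * P.[z] * Q.[z]))).
Proof.
move=> gz; have [Pz Qz _ w4 _] := gz.
have dv : cder (fun u => 1 - w u) z (0 + - (wr z / Q.[z] ^+ 2 / mu0)).
  exact: (cderD (cder_cst 1 z) (cderN (cder_ratio gz))).
have dg : cder g z (dpser (@scoef R) (1 - w z) * (0 + - (wr z / Q.[z] ^+ 2 / mu0))).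
  exact: (@cder_comp C S (fun u => 1 - w u) z _ _ (pser_cder (@scoef_norm R) w4) dv).
apply: cder_eq dg _.
have := sser_ode w4; rewrite -/(g z) subKr => e.
have wz : w z != 0 by rewrite mulf_neq0 ?invr_eq0// rat_neq0.
have -> : dpser (@scoef R) (1 - w z) = g z / 2 / w z by rewrite -e mulrAC divff// mul1r.
rewrite /w /M; field.
by rewrite Pz Qz mu0_neq0.
Qed.

Lemma cder_pullback z : regular_at z ->
  cder Z z (M z ^- 2 - 2 * z * (wr z / Q.[z] ^+ 2) / M z ^+ 3).
Proof.
move=> gz; have M0 := rat_neq0 gz; have M20 : M z ^+ 2 != 0 by rewrite expf_neq0.
have dM2 := cderX 2 (cder_rat gz).
have dV := @cderV C (fun u => M u ^+ 2) z _ M20 dM2.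
have dZ := @cderM C (fun u => u) (fun u => (M u ^+ 2)^-1) z _ _ (cder_id z) dV.
have -> : M z ^- 2 - 2 * z * (wr z / Q.[z] ^+ 2) / M z ^+ 3 =
  1 * (M z ^+ 2)^-1 + z * (- (2%:R * M z ^+ 2.-1 * (wr z / Q.[z] ^+ 2)) / (M z ^+ 2) ^+ 2).
  by move: (M z) M0 (wr z / _) => Mz M0 v /=; field; exact: M0.
exact: dZ.
Qed.

Lemma branch_sqr z : regular_at z -> g z ^+ 2 * w z = 1.
Proof. by case=> _ _ _ w4 _; have := sser_sqr w4; rewrite subKr. Qed.

(** This is [ode] divided by [(P Q) ^ 2] and multiplied by [g ^ 2 = mu0 / M]. *)
Lemma euler_sqr z : regular_at z -> euler_g z ^+ 2 * (1 - z) = 1 - Z z.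
Proof.
move=> gz; have [Pz Qz _ _ _] := gz; have M0 := rat_neq0 gz.
have c2 : c ^+ 2 = mu0^-1 by rewrite /mu0 invf_div PQ0 mulfK.
have := congr1 (horner^~ z) ode.
have -> : ((P * Q - 2 *: ('X * wronsk P Q)) ^+ 2 * (1 - 'X)).[z] =
    (P.[z] * Q.[z] - 2 * (z * wr z)) ^+ 2 * (1 - z).
  rewrite /wr; move: (wronsk P Q) => v.
  by rewrite !(horner_exp, hornerM, hornerZ, hornerD, hornerN, hornerX, hornerC).
rewrite /= !(horner_exp, hornerZ, hornerM, hornerD, hornerN, hornerX) c2 => e.
transitivity (g z ^+ 2 * ((P.[z] * Q.[z] - 2 * (z * wr z)) ^+ 2 * (1 - z)) /
  (P.[z] * Q.[z]) ^+ 2).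
  by rewrite /euler_g; field; rewrite Pz Qz.
transitivity (g z ^+ 2 * w z * (1 - Z z)); last by rewrite (branch_sqr gz) mul1r.
rewrite e /w /Z /M; field.
by rewrite Pz Qz mu0_neq0.
Qed.

Lemma euler_pullback_sqr z : regular_at z -> T z ^+ 2 = S z ^+ 2.
Proof.
move=> gz; have [_ _ z4 _ Z4] := gz.
have z1 : 1 - z != 0.
  apply/eqP => /subr0_eq z1; move: z4; rewrite -z1 normr1.
  by rewrite invf_gt1 ?ltr0n// (ltr_nat _ 4 1).
apply: (mulIf z1); rewrite [RHS](sser_sqr z4).
transitivity (S (Z z) ^+ 2 * (1 - Z z)); last exact: sser_sqr.
by rewrite -(euler_sqr gz) /T; ring.
Qed.

Lemma near_cvg_lt (f : C -> C) (l e : C) : f z @[z --> (0 : C)] --> l -> 0 < e ->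
  \forall z \near (0 : C), `|l - f z| < e.
Proof. by move=> fl e0; exact: (@cvgr_dist_lt C C C (nbhs (0 : C)) _ f l fl e e0). Qed.

Lemma near_horner_neq0 (p : {poly C}) : p.[0] != 0 -> \forall z \near (0 : C), p.[z] != 0.
Proof.
move=> p0; exact: (@cvgr_neq0 C C C (nbhs (0 : C)) _ _ _ (cder_cvg (cder_horner p 0)) p0).
Qed.

Lemma near_regular_at : \forall z \near (0 : C), regular_at z.
Proof.
have q0 : 0 < 4^-1 :> C by rewrite invr_gt0.
have h1 := near_horner_neq0 P0; have h2 := near_horner_neq0 Q0.
have h3 := near_dist (0 : C) q0.
have h4 := near_cvg_lt (cder_cvg (cder_ratio regular_at0)) q0.
have h5 := near_cvg_lt (cder_cvg (cder_pullback regular_at0)) q0.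
near=> z; split.
- by near: z.
- by near: z.
- have : `|0 - z| < 4^-1 by near: z.
  by rewrite sub0r normrN.
- rewrite -[X in X - _]ratio_at0; by near: z.
- have : `|Z 0 - Z z| < 4^-1 by near: z.
  by rewrite pullback_at0 sub0r normrN.
Unshelve. all: by end_near. Qed.

Lemma branch_at0 : g 0 = 1.
Proof.
by rewrite /g ratio_at0 subrr (pser0 (@scoef_norm R)) /scoef /pochhammer big_ord0 fact0
  divr1.
Qed.

(** Both sides have the square [1 / (1 - z)] and tend to [1], so that they cannot be
    opposite near [0]. *)
Lemma near_euler_pullback : \forall z \near (0 : C), T z = S z.
Proof.
have S0 : S 0 = 1 by have := branch_at0; rewrite /g ratio_at0 subrr.
have q0 : 0 < 4^-1 :> C by rewrite invr_gt0.
have z04 : `|0 : C| < 4^-1 by rewrite normr0.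
have cS : S z @[z --> (0 : C)] --> (1 : C).
  by rewrite -S0; exact: (cder_cvg (pser_cder (@scoef_norm R) z04)).
have cSZ : S (Z z) @[z --> (0 : C)] --> (1 : C).
  have Z04 : `|Z 0| < 4^-1 by rewrite pullback_at0 normr0.
  have := cder_cvg (cder_comp (pser_cder (@scoef_norm R) Z04) (cder_pullback regular_at0)).
  by rewrite -/S pullback_at0 S0.
have ce : euler_g z @[z --> (0 : C)] --> (1 : C).
  have PQ00 : P.[0] * Q.[0] != 0 by rewrite mulf_neq0.
  have ch (p : {poly C}) : p.[z] @[z --> (0 : C)] --> p.[0] := cder_cvg (cder_horner p 0).
  have c1 : 2 * z @[z --> (0 : C)] --> 2 * (0 : C).
    exact: (@cvgM C C (nbhs (0 : C)) _ _ _ _ _ (cvg_cst_at 2 0) cvg_id).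
  have c2 : 2 * z * wr z @[z --> (0 : C)] --> 2 * 0 * wr 0.
    exact: (@cvgM C C (nbhs (0 : C)) _ _ _ _ _ c1 (ch (wronsk P Q))).
  have c3 : P.[z] * Q.[z] @[z --> (0 : C)] --> P.[0] * Q.[0].
    exact: (@cvgM C C (nbhs (0 : C)) _ _ _ _ _ (ch P) (ch Q)).
  have c4 : (P.[z] * Q.[z])^-1 @[z --> (0 : C)] --> (P.[0] * Q.[0])^-1.
    exact: (@cvgV C C (nbhs (0 : C)) _ _ _ PQ00 c3).
  have c5 : 2 * z * wr z / (P.[z] * Q.[z]) @[z --> (0 : C)] -->
      2 * 0 * wr 0 / (P.[0] * Q.[0]).
    exact: (@cvgM C C (nbhs (0 : C)) _ _ _ _ _ c2 c4).
  have c6 : 1 - 2 * z * wr z / (P.[z] * Q.[z]) @[z --> (0 : C)] -->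
      1 - 2 * 0 * wr 0 / (P.[0] * Q.[0]).
    exact: (@cvgB C C C (nbhs (0 : C)) _ _ _ _ _ (cvg_cst_at 1 0) c5).
  have c7 : euler_g z @[z --> (0 : C)] --> g 0 * (1 - 2 * 0 * wr 0 / (P.[0] * Q.[0])).
    exact: (@cvgM C C (nbhs (0 : C)) _ _ _ _ _ (cder_cvg (cder_branch regular_at0)) c6).
  have e0 : g 0 * (1 - 2 * 0 * wr 0 / (P.[0] * Q.[0])) = 1.
    by rewrite branch_at0 mulr0 !mul0r subr0 mulr1.
  by move: c7; rewrite e0.
have cT : T z @[z --> (0 : C)] --> (1 : C).
  have := @cvgM C C (nbhs (0 : C)) _ _ _ _ _ ce cSZ.
  by rewrite mulr1; apply.
have hT := near_cvg_lt cT ltr01; have hS := near_cvg_lt cS ltr01.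
near=> z.
have gz : regular_at z by near: z; exact: near_regular_at.
have Tz : `|1 - T z| < 1 by near: z.
have Sz : `|1 - S z| < 1 by near: z.
have /eqP := euler_pullback_sqr gz; rewrite eqf_sqr => /orP[/eqP//|/eqP TS].
have e2 : (1 - T z) + (1 - S z) = 2 by rewrite TS; ring.
have := le_lt_trans (ler_normD _ _) (ltrD Tz Sz).
by rewrite e2 normr_nat -[X in _ < X](natrD _ 1 1) ltxx.
Unshelve. all: by end_near. Qed.

(** The chain rule for [4 x d/dx + 1] applied to [F - g F (Z)], with derivatives as
    plain variables; [k] is such that [x Z' = Z (1 - k)] and [4 x g' = - g k]. *)
Lemma euler_algebra (x fx Fx gx dg FZ fZ dz k SZ Zx : C) :
  x * dz = Zx * (1 - k) -> x * dg = - (gx * k) / 4 ->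
  4 * (x * fx) + Fx = gx * (1 - k) * SZ -> 4 * (Zx * fZ) + FZ = SZ ->
  4 * (x * (fx - (dg * FZ + gx * (fZ * dz)))) + (Fx - gx * FZ) = 0.
Proof.
move=> zZ zg ez eZ.
transitivity ((4 * (x * fx) + Fx) - (4 * (x * dg) + gx) * FZ - 4 * gx * fZ * (x * dz)).
  by ring.
by rewrite ez zg zZ -eZ; field.
Qed.

(** Both sides solve [4 z y' + y = (1 - z) ^ (- 1 / 2)].  Their difference [H] satisfies
    [4 z H' + H = 0], so that [z H ^ 4] has derivative zero; it vanishes at [0]. *)
Lemma hyp_transformation : \forall z \near (0 : C), F z = g z * F (Z z).
Proof.
have near_GT : \forall z \near (0 : C), regular_at z /\ T z = S z.
  by apply: near_imp2 near_regular_at near_euler_pullback.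
have [rho /= rho0 ball_rho] := (nbhs_ballP _ _).1 near_GT.
pose H z := F z - g z * F (Z z); pose K z := z * H z ^+ 4.
have inb z : `|z| < rho -> regular_at z /\ T z = S z.
  by move=> zr; apply: ball_rho; rewrite -ball_normE /= sub0r normrN.
have dK z : `|z| < rho -> cder K z 0.
  move=> /inb[gz Tz]; have [Pz Qz z4 _ Z4] := gz.
  have dF := pser_cder (@fcoef_norm R) z4.
  have dFZ := cder_comp (pser_cder (@fcoef_norm R) Z4) (cder_pullback gz).
  have dH := cderD dF (cderN (cderM (cder_branch gz) dFZ)).
  apply: cder_eq (cderM (cder_id z) (cderX 4 dH)) _; rewrite -/F -/(H z) /=.
  set dHz := _ - _.
  suff e : 4 * (z * dHz) + H z = 0.
    transitivity (H z ^+ 3 * (4 * (z * dHz) + H z)); first by ring.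
    by rewrite e mulr0.
  have M0 := rat_neq0 gz; pose k := 2 * z * wr z / (P.[z] * Q.[z]).
  have zZ : z * (M z ^- 2 - 2 * z * (wr z / Q.[z] ^+ 2) / M z ^+ 3) = Z z * (1 - k).
    rewrite /Z /k; have -> : M z = P.[z] / Q.[z] by [].
    by field; rewrite Pz Qz.
  have zg : z * (- (g z * wr z / (2 * P.[z] * Q.[z]))) = - (g z * k) / 4.
    by rewrite /k; field; rewrite Pz Qz.
  have ez : 4 * (z * dpser (@fcoef R) z) + F z = g z * (1 - k) * S (Z z).
    by rewrite -[RHS]/(T z) Tz; exact: fser_ode z4.
  have eZ : 4 * (Z z * dpser (@fcoef R) (Z z)) + F (Z z) = S (Z z) := fser_ode Z4.
  exact: euler_algebra zZ zg ez eZ.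
have K0 z : `|z| < rho -> K z = 0.
  by move=> zr; rewrite (cder0_cst dK zr) /K mul0r.
have F0 : F 0 = 1.
  by rewrite /F (pser0 (@fcoef_norm R)) /fcoef /pochhammer !big_ord0 fact0; field.
apply: near_imp (near_dist (0 : C) rho0) => z; rewrite sub0r normrN => zr.
have [z0|z0] := eqVneq z 0; first by rewrite z0 pullback_at0 branch_at0 mul1r.
have /eqP := K0 z zr; rewrite /K mulf_eq0 (negbTE z0) expf_eq0 /= => /eqP.
exact: subr0_eq.
Qed.

Lemma inv_sqrt_branchP : inv_sqrt_branch w g.
Proof.
split; first exact: branch_at0.
apply: near_imp near_regular_at => z gz; split; first exact: (cder_cvg (cder_branch gz)).
have gw := branch_sqr gz; have g2 : g z ^+ 2 != 0.
  by apply/eqP => g2; move: gw; rewrite g2 mul0r => /esym/eqP; rewrite oner_eq0.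
by apply: (mulfI g2); rewrite gw divff.
Qed.

End Transformation.

(** * The theorem *)

Lemma cvg_infty_rev (R : realType) (f h : Cplx R -> Cplx R) (l : Cplx R) :
  h z @[z --> (0 : Cplx R)] --> l -> (forall s, s != 0 -> f s = h s^-1) ->
  f @ @infty_nbhs (Cplx R) --> l.
Proof.
move=> hl fh U /hl hU; have [rho /= rho0 ballU] := (nbhs_ballP _ _).1 hU.
exists rho^-1 => /=; first by rewrite invr_gt0.
move=> s /= rs; have s0 : s != 0.
  apply/eqP => s0; move: rs; rewrite s0 normr0 invr_lt0 => /(lt_trans rho0).
  by rewrite ltxx.
rewrite /= fh//; apply: ballU; rewrite -ball_normE /= sub0r normrN normfV.
by rewrite invf_plt ?posrE ?normr_gt0.
Qed.

Theorem theorem2p1 (R : realType) (phi : E1 (Cplx R) -> E1 (Cplx R)) (d : nat)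
    (phi_isogeny : E1_isogeny phi)
    (phi_neq0 : exists P, phi P <> None)
    (phi_degree : map_degree (@E1_coord (Cplx R)) (@E1_coord (Cplx R)) phi d) :
  exists (p q : {poly Cplx R}) (mu0 : Cplx R),
    let mu := fun s : Cplx R => p.[s] / q.[s] in
    (* z |-> mu (1/z), extended to z = 0 by its limit *)
    let mu_inv := fun z : Cplx R => if z == 0 then mu0 else mu z^-1 in
    [/\ q != 0 /\ coprimep p q,
        (* as p and q are coprime, x * mu (x ^ 2) has a pole iff q.[x ^ 2] = 0 *)
        forall a, let x := (val a).1 in
          E1_x (phi (Some a)) =
            if q.[x ^+ 2] == 0 then None else Some (x * mu (x ^+ 2)),
        mu0 != 0 /\ mu @ @infty_nbhs (Cplx R) --> mu0,
        exists g : Cplx R -> Cplx R,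
          inv_sqrt_branch (fun z => mu_inv z / mu0) g /\
          \forall z \near (0 : Cplx R),
            hyp2F1 (1 / 2) (1 / 4) (5 / 4) z =
            g z * hyp2F1 (1 / 2) (1 / 4) (5 / 4) (z / mu_inv z ^+ 2)
      & rational_degree (fun z : Cplx R => z / mu z^-1 ^+ 2) d].
Proof.
have [A [D [D0 AD phiX]]] := isogeny_x phi_isogeny phi_neq0.
have [r [rr phiY]] := isogeny_y phi_isogeny phi_neq0.
have sizeAD := isogeny_pole phi_isogeny phi_neq0 D0 phiX.
have A0 : A != 0 by rewrite -size_poly_gt0 (leq_trans _ sizeAD).
have [c c0 ode] := isogeny_ode phi_isogeny phi_neq0 D0 AD phiX rr phiY.
have [sA lDA] := ode_degree D0 sizeAD c0 ode.
have oddAD := ode_odd D0 sizeAD c0 ode.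
have [p [q [m [f [fP fA fD [top_p top_q] degA]]]]] := odd_ratio AD D0 sA oddAD.
have dE : d = (size A).-1.
  rewrite (isogeny_degreeE phi_isogeny phi_neq0 D0 phiX AD phi_degree).
  by rewrite (maxn_idPl (ltnW sizeAD)).
have q0 : q != 0.
  by apply: contraNneq D0 => q0; case: top_q => _; rewrite q0 coef0 => /esym/eqP;
    rewrite lead_coef_eq0.
pose P := rev_poly m p; pose Q := rev_poly m q.
have P0 : P.[0] != 0 by rewrite (rev_p0 top_p) lead_coef_eq0.
have Q0 : Q.[0] != 0 by rewrite (rev_q0 top_q) lead_coef_eq0.
have PQ0 : Q.[0] = c ^+ 2 * P.[0] by rewrite (rev_p0 top_p) (rev_q0 top_q).
have muE (z : Cplx R) : z != 0 -> P.[z] / Q.[z] = p.[z^-1] / q.[z^-1].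
  move=> z0; rewrite (rev_p top_p z0) (rev_q top_q z0) -mulf_div divff ?mul1r//.
  exact: expf_neq0.
have ode2 := ode_rev ode fA fD top_p top_q.
exists p, q, (P.[0] / Q.[0]) => mu mu_inv.
have muP : mu_inv = fun z => P.[z] / Q.[z].
  by apply/funext => z; rewrite /mu_inv; case: eqVneq => [->|z0]//; rewrite muE.
split.
- by split=> //; exact: even_coprime AD fP fA fD.
- move=> a; have aN : Some a <> None :> E1 (Cplx R) by [].
  rewrite (isogeny_xE phi_isogeny phi_neq0 D0 phiX AD aN) /= (q_sqr_eq0 fP fD).
  by case: eqVneq => // Dx; rewrite (ratio_sqr fP fA fD Dx).
- split; first by rewrite mulf_neq0 ?invr_eq0.
  have cM := cder_cvg (cder_rat (regular_at0 P0 Q0)).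
  by apply: (cvg_infty_rev cM) => s s0; rewrite muE ?invr_eq0// invrK.
- rewrite muP; exists (fun z => pser (@scoef R) (1 - P.[z] / Q.[z] / (P.[0] / Q.[0]))).
  split; first exact: inv_sqrt_branchP P0 Q0.
  exact: hyp_transformation P0 Q0 PQ0 ode2.
- rewrite dE -(rev_degree AD D0 A0 fP fA fD top_p top_q degA).
  apply: (fibre_rational_degree (rev_coprime AD A0 fP fA fD top_p top_q)).
    rewrite (rev_degree AD D0 A0 fP fA fD top_p top_q degA) -dE.
    rewrite (isogeny_degreeE phi_isogeny phi_neq0 D0 phiX AD phi_degree).
    exact: (isogeny_degree_gt0 phi_isogeny phi_neq0 D0 phiX).
  apply: filterS (cofinitely_neq 0) => z /eqP z0.
  rewrite /mu -muE// hornerM hornerX !horner_exp -/P -/Q.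
  by rewrite expr_div_n invf_div mulrA.
Qed.
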